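(* Let $\{D,T\}$ be a representation of the Baumslag-Solitar group $BS(1,2)$ on a Hilbert space $\mathcal{H}$, and let $\psi\in\mathcal{H}$ be a frame wavelet for $\{D,T\}$ with optimal frame bounds $A^2$ and $B^2$, where $0<A\le B<\infty$. Let $S$ be the frame operator of $\{D^jT^k\psi:j,k\in\mathbb{Z}\}$. Assume that $S^{-1/2}$ is in the local commutant, i.e. $$S^{-1/2}\in C_\psi(\{D^jT^k:j,k\in\mathbb{Z}\}).\qquad(\ast)$$ Then there exist: (i) a representation $\{D',T'\}$ of $BS(1,2)$ on a Hilbert space $\mathcal{K}$; (ii) an orthonormal wavelet $\psi_1\oplus\psi_2\in\mathcal{H}\oplus\mathcal{K}$ for the representation $\{D\oplus D',T\oplus T'\}$ of $BS(1,2)$ on $\mathcal{H}\oplus\mathcal{K}$; and (iii) a positive operator $E:\mathcal{H}\to\mathcal{H}$ with $\{A,B\}\subseteq\sigma(E)\subseteq[A,B]$, such that $$E(D^jT^k\psi_1)=D^jT^k\psi\qquad\text{for all }j,k\in\mathbb{Z}.$$ Conversely, if there exist objects as in (i)--(iii), then $(\ast)$ necessarily holds.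
   Context: A family $\{f_i\}_{i\in I}$ in a Hilbert space $\mathcal{H}$ is a frame for $\mathcal{H}$ if there exist $0<a\le b<\infty$ (frame bounds) such that $a\|x\|^2\le\sum_{i\in I}|\langle x,f_i\rangle|^2\le b\|x\|^2$ for all $x\in\mathcal{H}$. The optimal frame bounds are the supremum of all admissible $a$ and the infimum of all admissible $b$. The frame operator of a frame $\{f_i\}_{i\in I}$ is $Sx=\sum_{i\in I}\langle x,f_i\rangle f_i$, $x\in\mathcal{H}$. The Baumslag-Solitar group is $BS(1,2)=\langle d,t\mid dtd^{-1}=t^2\rangle$. A (unitary) representation of $BS(1,2)$ on $\mathcal{H}$ is given by a pair $\{D,T\}$ of unitary operators on $\mathcal{H}$ satisfying $DTD^{-1}=T^2$. A vector $\psi\in\mathcal{H}$ is a frame wavelet (respectively, orthonormal wavelet) for $\{D,T\}$ if the family $\{D^jT^k\psi\}_{j,k\in\mathbb{Z}}$, indexed by $(j,k)\in\mathbb{Z}^2$, is a frame (respectively, an orthonormal basis) for $\mathcal{H}$; the bounds of a frame wavelet are the bounds of this frame. The local commutant of a set $\mathcal{U}$ of unitary operators on $\mathcal{H}$ at $\psi\in\mathcal{H}$ is $$C_\psi(\mathcal{U})=\{R\in B(\mathcal{H}):RU\psi=UR\psi\ \text{ for all }U\in\mathcal{U}\},$$ where $B(\mathcal{H})$ is the algebra of bounded linear operators on $\mathcal{H}$. Positive operator means bounded positive (self-adjoint) operator, and $\sigma(E)$ is its spectrum. *)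

(* Defs.v *)
From HB Require Import structures.
From mathcomp Require Import all_boot all_order all_algebra.
From mathcomp Require Import complex.
From mathcomp Require Import finmap.
From mathcomp Require Import all_classical all_reals all_analysis.
From mathcomp Require Import ring.
From mathcomp.analysis.showcase Require summability.

Set Implicit Arguments.
Unset Strict Implicit.
Unset Printing Implicit Defensive.

Import Order.TTheory GRing.Theory Num.Theory.
Import numFieldNormedType.Exports.

Local Open Scope classical_set_scope.
Local Open Scope complex_scope.
Local Open Scope ring_scope.

(* Complex Hilbert spaces; the inner product is linear in its first variable. *)
HB.mixin Record NormedModule_isHilbert (R : realType) H
    & CompleteNormedModule R[i] H := {
  inner : H -> H -> R[i] ;
  innerDl : forall x y z, inner (x + y) z = inner x z + inner y z ;
  innerZl : forall a x z, inner (a *: x) z = a * inner x z ;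
  innerC : forall x y, inner x y = Num.conj (inner y x) ;
  inner_normE : forall x, inner x x = `|x| ^+ 2
}.

#[short(type="hilbertType")]
HB.structure Definition Hilbert (R : realType) :=
  {H of NormedModule_isHilbert R H & CompleteNormedModule R[i] H}.

Section inner_theory.
Variables (R : realType) (H : hilbertType R).
Implicit Types x y z : H.

Lemma innerDr x y z : inner x (y + z) = inner x y + inner x z.
Proof. by rewrite innerC innerDl rmorphD/= -!innerC. Qed.

Lemma innerZr a x y : inner x (a *: y) = Num.conj a * inner x y.
Proof. by rewrite innerC innerZl rmorphM/= -innerC. Qed.

Let inner_bilinear : bilinear_for
  (GRing.Scale.Law.clone _ _ *%R _)
  (GRing.Scale.Law.clone _ _ (@Num.conj R[i] \; *%R) _) (@inner R H).
Proof.
split=> [u' a x y|u a x y] /=; first by rewrite innerDl innerZl.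
by rewrite innerDr innerZr.
Qed.

HB.instance Definition _ := bilinear_isBilinear.Build R[i] H H R[i]
  (GRing.Scale.Law.clone _ _ *%R _)
  (GRing.Scale.Law.clone _ _ (@Num.conj R[i] \; *%R) _)
  (@inner R H) inner_bilinear.

Let inner_herm x y : inner x y = (-1) ^+ false * Num.conj (inner y x).
Proof. by rewrite expr0 mul1r innerC. Qed.

HB.instance Definition _ := isHermitianSesquilinear.Build R[i] H false
  (@Num.conj R[i]) (@inner R H) inner_herm.

Let inner_gt0 x : x != 0 -> 0 < inner x x.
Proof. by move=> x0; rewrite inner_normE exprn_gt0// normr_gt0. Qed.

HB.instance Definition _ := isDotProduct.Build R[i] H (@inner R H) inner_gt0.

End inner_theory.

(* An alias of the product, since H * K already carries the maximum norm, which
   is not the Hilbert norm of the direct sum. *)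
Definition hdsum (R : realType) (H K : hilbertType R) : Type := (H * K)%type.

Section hdsum_normed.
Variables (R : realType) (H K : hilbertType R).
Local Notation C := R[i].

HB.instance Definition _ := GRing.Lmodule.copy (hdsum H K) (H * K)%type.

Definition hdsum_norm (p : hdsum H K) : C :=
  sqrtC (`|p.1| ^+ 2 + `|p.2| ^+ 2).

Lemma hdsum_normE (p : hdsum H K) :
  hdsum_norm p ^+ 2 = `|p.1| ^+ 2 + `|p.2| ^+ 2.
Proof. by rewrite sqrtCK. Qed.

Let hdsum_norm_ge0 (p : hdsum H K) : 0 <= hdsum_norm p.
Proof. by rewrite sqrtC_ge0 addr_ge0// exprn_ge0. Qed.

Let minkowski2 (a b c d r s : C) : 0 <= a -> 0 <= b -> 0 <= c -> 0 <= d ->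
  0 <= r -> 0 <= s -> r ^+ 2 = a ^+ 2 + b ^+ 2 -> s ^+ 2 = c ^+ 2 + d ^+ 2 ->
  (a + c) ^+ 2 + (b + d) ^+ 2 <= (r + s) ^+ 2.
Proof.
move=> a0 b0 c0 d0 r0 s0 rE sE.
suff rs : a * c + b * d <= r * s.
  have -> : (a + c) ^+ 2 + (b + d) ^+ 2 =
    (r ^+ 2 + s ^+ 2) + (a * c + b * d) *+ 2 by rewrite rE sE; ring.
  have -> : (r + s) ^+ 2 = (r ^+ 2 + s ^+ 2) + (r * s) *+ 2 by ring.
  by rewrite lerD2l lerMn2r.
rewrite -(@ler_pXn2r _ 2)// ?nnegrE ?addr_ge0 ?mulr_ge0//.
have -> : (r * s) ^+ 2 = (a * c + b * d) ^+ 2 + (a * d - b * c) ^+ 2.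
  by rewrite exprMn rE sE; ring.
rewrite lerDl real_exprn_even_ge0// rpredB// ger0_real// mulr_ge0//.
Qed.

Let hdsum_ler_normD (p q : hdsum H K) :
  hdsum_norm (p + q) <= hdsum_norm p + hdsum_norm q.
Proof.
rewrite -(@ler_pXn2r _ 2)// ?nnegrE ?addr_ge0// hdsum_normE.
apply: (@le_trans _ _ ((`|p.1| + `|q.1|) ^+ 2 + (`|p.2| + `|q.2|) ^+ 2)).
  by apply: lerD; rewrite ler_pXn2r ?nnegrE ?addr_ge0// ler_normD.
by apply: minkowski2; rewrite ?hdsum_normE.
Qed.

Let hdsum_normrZ (l : C) (p : hdsum H K) :
  hdsum_norm (l *: p) = `|l| * hdsum_norm p.
Proof.
apply/eqP; rewrite -(@eqrXn2 _ 2)// ?mulr_ge0// exprMn !hdsum_normE.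
by rewrite !normrZ !exprMn mulrDr.
Qed.

Let hdsum_normr0_eq0 (p : hdsum H K) : hdsum_norm p = 0 -> p = 0.
Proof.
move=> p0; have := hdsum_normE p; rewrite p0 expr0n/= => /esym/eqP.
rewrite paddr_eq0 ?exprn_ge0// !sqrf_eq0 !normr_eq0.
by case: p {p0} => a b /= /andP[/eqP -> /eqP ->].
Qed.

HB.instance Definition _ := Lmodule_isNormed.Build C (hdsum H K)
  hdsum_ler_normD hdsum_normrZ hdsum_normr0_eq0.

Let hdsum_norm1 (p : hdsum H K) : `|p.1| <= `|p|.
Proof.
by rewrite -(@ler_pXn2r _ 2)// ?nnegrE// hdsum_normE lerDl exprn_ge0.
Qed.

Let hdsum_norm2 (p : hdsum H K) : `|p.2| <= `|p|.
Proof.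
by rewrite -(@ler_pXn2r _ 2)// ?nnegrE// hdsum_normE lerDr exprn_ge0.
Qed.

Let hdsum_norm_le (p : hdsum H K) : `|p| <= `|p.1| + `|p.2|.
Proof.
rewrite -(@ler_pXn2r _ 2)// ?nnegrE ?addr_ge0// hdsum_normE sqrrD.
by rewrite addrAC lerDl mulrn_wge0// mulr_ge0.
Qed.

Lemma hdsum_complete (F : set_system (hdsum H K)) :
  ProperFilter F -> cauchy F -> cvg F.
Proof.
move=> FF Fc.
have F1 : cvg ((fst : hdsum H K -> H) @ F).
  apply: cauchy_cvg; apply/cauchy_ballP => e e0.
  move/cauchy_ballP : Fc => /(_ e e0) [[A B] [/= FA FB] AB].
  exists ((fst : hdsum H K -> H) @` A, (fst : hdsum H K -> H) @` B) => /=.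
    split; rewrite /nbhs /=.
      by apply: filterS FA => p Ap /=; exists p.
    by apply: filterS FB => p Bp /=; exists p.
  move=> [_ _] [/= [p Ap <-] [q Bq <-]].
  have := AB (p, q) (conj Ap Bq); rewrite /= -!ball_normE /=.
  by apply: le_lt_trans; apply: (hdsum_norm1 (p - q)).
have F2 : cvg ((snd : hdsum H K -> K) @ F).
  apply: cauchy_cvg; apply/cauchy_ballP => e e0.
  move/cauchy_ballP : Fc => /(_ e e0) [[A B] [/= FA FB] AB].
  exists ((snd : hdsum H K -> K) @` A, (snd : hdsum H K -> K) @` B) => /=.
    split; rewrite /nbhs /=.
      by apply: filterS FA => p Ap /=; exists p.
    by apply: filterS FB => p Bp /=; exists p.
  move=> [_ _] [/= [p Ap <-] [q Bq <-]].
  have := AB (p, q) (conj Ap Bq); rewrite /= -!ball_normE /=.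
  by apply: le_lt_trans; apply: (hdsum_norm2 (p - q)).
apply/cvg_ex.
exists (((lim ((fst : hdsum H K -> H) @ F), lim ((snd : hdsum H K -> K) @ F)))
  : hdsum H K).
apply/cvgrPdist_lt => e e0.
have e2 : 0 < e / 2 by rewrite divr_gt0.
move/cvgrPdist_lt : F1 => /(_ _ e2) n1.
move/cvgrPdist_lt : F2 => /(_ _ e2) n2.
near=> p; apply: le_lt_trans (hdsum_norm_le _) _.
rewrite [e]splitr; apply: ltrD.
  by near: p; exact: n1.
by near: p; exact: n2.
Unshelve. all: by end_near. Qed.

HB.instance Definition _ :=
  Uniform_isComplete.Build (hdsum H K) hdsum_complete.

Definition hdsum_inner (p q : hdsum H K) : C := inner p.1 q.1 + inner p.2 q.2.

Let hdsum_innerDl (p q r : hdsum H K) :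
  hdsum_inner (p + q) r = hdsum_inner p r + hdsum_inner q r.
Proof. by rewrite /hdsum_inner !innerDl addrACA. Qed.

Let hdsum_innerZl a (p r : hdsum H K) :
  hdsum_inner (a *: p) r = a * hdsum_inner p r.
Proof. by rewrite /hdsum_inner !innerZl mulrDr. Qed.

Let hdsum_innerC (p q : hdsum H K) :
  hdsum_inner p q = Num.conj (hdsum_inner q p).
Proof. by rewrite /hdsum_inner rmorphD/= -!innerC. Qed.

Let hdsum_inner_normE (p : hdsum H K) : hdsum_inner p p = `|p| ^+ 2.
Proof. by rewrite hdsum_normE /hdsum_inner !inner_normE. Qed.

HB.instance Definition _ := NormedModule_isHilbert.Build R (hdsum H K)
  hdsum_innerDl hdsum_innerZl hdsum_innerC hdsum_inner_normE.

End hdsum_normed.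

Section operators.
Variables (R : realType) (H : hilbertType R).
Local Notation C := R[i].
Implicit Types (A : H -> H) (x y : H).

Definition bounded_operator A : Prop :=
  linear A /\ exists M : C, forall x, `|A x| <= M * `|x|.

Definition selfadjoint_operator A : Prop :=
  bounded_operator A /\ forall x y, inner (A x) y = inner x (A y).

(* The order of R[i] is such that 0 <= z means that z is real and
   nonnegative. *)
Definition positive_operator A : Prop :=
  selfadjoint_operator A /\ forall x, 0 <= inner (A x) x.

Definition inverse_operator A (B : H -> H) : Prop :=
  [/\ bounded_operator B, cancel A B & cancel B A].

Definition spectrum A : set C :=
  [set l | ~ exists B, inverse_operator (fun x => A x - l *: x) B].

(* inv_op and sqrt_op are only meaningful when the operator they denote exists;
   it is then unique. *)
Definition inv_op A : H -> H := get [set B | inverse_operator A B].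

Definition sqrt_op A : H -> H :=
  get [set P : H -> H | positive_operator P /\ P \o P = A].

Definition unitary_operator A : Prop :=
  [/\ linear A, bijective A & forall x y, inner (A x) (A y) = inner x y].

End operators.

Record unitary (R : realType) (H : hilbertType R) := Unitary {
  unitary_fun :> H -> H ;
  unitaryP : unitary_operator unitary_fun
}.

Section unitary_group.
Variables (R : realType) (H : hilbertType R).
Implicit Types U V : unitary H.

HB.instance Definition _ := gen_eqMixin (unitary H).
HB.instance Definition _ := gen_choiceMixin (unitary H).

Lemma unitary_ext U V : U =1 V -> U = V.
Proof.
case: U V => [U hU] [V hV] /= /funext UV.
by rewrite UV in hU *; rewrite (Prop_irrelevance hU hV).
Qed.

Let unitary_inverse U : exists V : unitary H, cancel U V /\ cancel V U.
Proof.
case: (unitaryP U) => Ul [V UK VK] Ui.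
suff hV : unitary_operator V by exists (Unitary hV).
split; last by move=> x y; rewrite -Ui !VK.
  by move=> a x y; apply: (can_inj UK); rewrite Ul !VK.
by exists U.
Qed.

Let unitary1_subproof : unitary_operator (@idfun H).
Proof. by split => //; exists idfun. Qed.

Let unitaryM_subproof U V : unitary_operator (U \o V).
Proof.
case: (unitaryP U) (unitaryP V) => Ul Ub Ui [Vl Vb Vi]; split.
- by move=> a x y /=; rewrite Vl Ul.
- exact: bij_comp.
- by move=> x y /=; rewrite Ui Vi.
Qed.

Definition unitary1 : unitary H := Unitary unitary1_subproof.
Definition unitaryM U V : unitary H := Unitary (unitaryM_subproof U V).
Definition unitaryV U : unitary H := projT1 (cid (unitary_inverse U)).

Lemma unitaryK U : cancel U (unitaryV U).
Proof. exact: (projT2 (cid (unitary_inverse U))).1. Qed.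

Lemma unitaryVK U : cancel (unitaryV U) U.
Proof. exact: (projT2 (cid (unitary_inverse U))).2. Qed.

Let mulA : associative unitaryM.
Proof. by move=> U V W; exact: unitary_ext. Qed.
Let mul1 : left_id unitary1 unitaryM.
Proof. by move=> U; exact: unitary_ext. Qed.
Let mulr1 : right_id unitary1 unitaryM.
Proof. by move=> U; exact: unitary_ext. Qed.
Let mulV : left_inverse unitary1 unitaryV unitaryM.
Proof. by move=> U; apply: unitary_ext => x /=; rewrite unitaryK. Qed.
Let mulrV : right_inverse unitary1 unitaryV unitaryM.
Proof. by move=> U; apply: unitary_ext => x /=; rewrite unitaryVK. Qed.

HB.instance Definition _ := isGroup.Build (unitary H) mulA mul1 mulr1 mulV mulrV.

End unitary_group.

Definition expgz (G : groupType) (g : G) (j : int) : G :=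
  match j with Posz n => (g ^+ n)%g | Negz n => (g ^- n.+1)%g end.

Section direct_sum.
Variables (R : realType) (H K : hilbertType R).

Definition hdpair (x : H) (y : K) : hdsum H K := (x, y).

Let udsum_subproof (U : unitary H) (V : unitary K) :
  unitary_operator (fun p : hdsum H K => hdpair (U p.1) (V p.2)).
Proof.
case: (unitaryP U) (unitaryP V) => Ul _ Ui [Vl _ Vi]; split.
- move=> a p q.
  exact: (congr2 hdpair (Ul a p.1 q.1) (Vl a p.2 q.2)).
- exists (fun p : hdsum H K => hdpair (unitaryV U p.1) (unitaryV V p.2)).
    by move=> [x y]; rewrite /hdpair /= !unitaryK.
  by move=> [x y]; rewrite /hdpair /= !unitaryVK.
- by move=> p q; rewrite [LHS]/inner/= /hdsum_inner/= Ui Vi.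
Qed.

Definition udsum (U : unitary H) (V : unitary K) : unitary (hdsum H K) :=
  Unitary (udsum_subproof U V).

Lemma udsumM (U1 U2 : unitary H) (V1 V2 : unitary K) :
  udsum (U1 * U2)%g (V1 * V2)%g = (udsum U1 V1 * udsum U2 V2)%g.
Proof. exact: unitary_ext. Qed.

End direct_sum.

Section frames.
Variables (R : realType) (H : hilbertType R) (I : choiceType).
Implicit Types (f : I -> H) (x : H).

(* The norm and the modulus take values in R[i]; their values are real. *)
Definition energy f x : \bar R :=
  (\esum_(i in [set: I]) (complex.Re (`|inner x (f i)| ^+ 2))%:E)%E.

Definition frame_bounds f (a b : R) : Prop :=
  [/\ 0 < a, a <= b & forall x,
    ((a * complex.Re (`|x| ^+ 2))%:E <= energy f x
      <= (b * complex.Re (`|x| ^+ 2))%:E)%E].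

Definition is_frame f : Prop := exists a b, frame_bounds f a b.

Definition optimal_frame_bounds f (a b : R) : Prop :=
  a = sup [set a' | exists b', frame_bounds f a' b'] /\
  b = inf [set b' | exists a', frame_bounds f a' b'].

(* Unconditional sum: limit along the net of finite subsets of I. *)
Definition frame_operator f x : H :=
  summability.sum (fun i => inner x (f i) *: f i).

Definition orthonormal_basis f : Prop :=
  (forall i j, inner (f i) (f j) = (i == j)%:R) /\
  (forall x, summability.partial_sum (fun i => inner x (f i) *: f i)
               @ summability.totally --> x).

End frames.

Section wavelets.
Variables (R : realType) (H : hilbertType R).
Implicit Types (D T : unitary H) (psi : H).

Definition BS12_rep D T : Prop := (D * T * D^-1 = T ^+ 2)%g.

Definition dilation_translation D T (jk : int * int) : unitary H :=
  (expgz D jk.1 * expgz T jk.2)%g.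

Definition wavelet_system D T psi (jk : int * int) : H :=
  dilation_translation D T jk psi.

Definition frame_wavelet D T psi : Prop := is_frame (wavelet_system D T psi).

Definition orthonormal_wavelet D T psi : Prop :=
  orthonormal_basis (wavelet_system D T psi).

Definition local_commutant (UU : set (unitary H)) psi : set (H -> H) :=
  [set A | bounded_operator A /\ forall U, UU U -> A (U psi) = U (A psi)].

End wavelets.

Lemma BS12_rep_udsum (R : realType) (H K : hilbertType R)
    (D T : unitary H) (D' T' : unitary K) :
  BS12_rep D T -> BS12_rep D' T' -> BS12_rep (udsum D D') (udsum T T').
Proof.
rewrite /BS12_rep => /(congr1 (fun U => U * D)%g) + /(congr1 (fun U => U * D')%g).
rewrite !mulgVK => DT DT'; apply: (canLR (mulgK _)).
by rewrite !expg2 -!udsumM DT DT' !expg2.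
Qed.

(* Main.v *)
From HB Require Import structures.
Require Import Defs.
From mathcomp Require Import all_boot all_order all_algebra.
From mathcomp Require Import complex.
From mathcomp Require Import finmap.
From mathcomp Require Import all_classical all_reals all_analysis.
From mathcomp Require Import zify ring lra.
From mathcomp.analysis.showcase Require summability.

(** Let f_i be the vectors D^j T^k psi and S their frame operator, so that
    inner (S x) y is the sum of inner x f_i times inner f_i y.

    Suppose that P = S^(-1/2) lies in the local commutant, and put
    psi1 = P psi.  The vectors g_i = D^j T^k psi1 are the P f_i; they form a
    Parseval frame because P S P = 1, and E = S^(1/2) maps them to the f_i.
    The main point is then that a Parseval wavelet is the first component of
    an orthonormal wavelet ([parseval_dilation]).

    In l2 of the index set, let K be the orthogonal complement of the
    coefficient sequences of the vectors of H, and let k_i be the projection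
    to K of the i-th unit vector.  Then the pairs (g_i, k_i) form an
    orthonormal basis of the direct sum ([naimark]).  The dilation D' must be
    the unitary k_(j,n) |-> k_(j+1,n).  The relation
    T D^(-m) = D^(-m) T^(2^m) forces T' k_(-m,n) = k_(-m,n+2^m), which
    determines T' only on the closed span K0 of the k_(j,n) with j <= 0.
    On D' K0 the operator T' has to be a square root of D' T' D'^-1 which
    extends T' on K0.  Since D' T' D'^-1 is unitary there and preserves K0,
    it has a square root on the complement of K0 in D' K0.  Repeating this
    along the increasing spaces D'^n K0, whose union is dense, gives T'
    ([doubling_extension]).

    Unitary operators have square roots by an argument without spectral
    theorem ([unitary_sqrt]): the binomial series gives a square root F of
    1 + U, as U is a contraction.  From F^2 = 1 + U and its adjoint one reads
    off F^2 = U (adj F)^2, and F is normal, so F = W (adj F) for a partial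
    isometry W, which is a square root of U off the kernel of 1 + U.  On that
    kernel U is -1 and the imaginary unit serves.

    The spectrum of E lies in [A, B] because A <= E <= B.  If A or B were
    missing from it, the positive operator E - A or B - E would be invertible,
    hence bounded below, and the frame bounds A^2, B^2 would not be optimal
    ([sqrt_spectrum]).

    Conversely, an orthonormal wavelet with first component psi1 makes the
    vectors g_i a Parseval frame, and E g_i = f_i gives S = E^2.  As 0 is not
    in the spectrum, E is invertible, so E^-1 is S^(-1/2) by uniqueness of
    positive square roots, and it maps f_i back to g_i.

    Closed spans are handled as double annihilators and bounded operators as
    adjoint pairs.  Operator identities then follow by algebra, and limits
    enter only in the projection theorem, in two iterations (square root,
    inverse), in sums over the index set and in the completeness of l2. *)

Set Implicit Arguments.
Unset Strict Implicit.
Unset Printing Implicit Defensive.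

Import Order.TTheory GRing.Theory Num.Theory.
Import numFieldNormedType.Exports.

Local Open Scope classical_set_scope.
Local Open Scope complex_scope.
Local Open Scope ring_scope.

(** * Inner products and adjointable operators *)

Section inner_basics.
Variables (R : realType) (H : hilbertType R).
Implicit Types x y z : H.
Local Notation C := R[i].

Lemma inner0l x : inner 0 x = 0. Proof. exact: linear0l. Qed.
Lemma inner0r x : inner x 0 = 0. Proof. exact: linear0r. Qed.
Lemma innerNl x y : inner (- x) y = - inner x y. Proof. exact: linearNl. Qed.
Lemma innerBl x y z : inner (x - y) z = inner x z - inner y z.
Proof. exact: linearBl. Qed.
Lemma innerBr x y z : inner x (y - z) = inner x y - inner x z.
Proof. exact: linearBr. Qed.
Lemma inner_suml (I : Type) (r : seq I) (P : pred I) (F : I -> H) y :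
  inner (\sum_(i <- r | P i) F i) y = \sum_(i <- r | P i) inner (F i) y.
Proof. exact: linear_sumlz. Qed.
Lemma inner_sumr (I : Type) (r : seq I) (P : pred I) (F : I -> H) y :
  inner y (\sum_(i <- r | P i) F i) = \sum_(i <- r | P i) inner y (F i).
Proof. exact: linear_sumr. Qed.

Lemma inner_eq0C x y : inner x y = 0 -> inner y x = 0.
Proof. by move=> xy; rewrite innerC xy rmorph0. Qed.

Lemma inner_xx0 x : inner x x = 0 -> x = 0.
Proof. by rewrite inner_normE => /eqP; rewrite sqrf_eq0 normr_eq0 => /eqP. Qed.

Lemma inner_inj x y : (forall z, inner x z = inner y z) -> x = y.
Proof.
by move=> xy; apply/eqP; rewrite -subr_eq0; apply/eqP/inner_xx0; rewrite innerBl xy subrr.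
Qed.

Lemma inner_ge0 x : 0 <= inner x x.
Proof. by rewrite inner_normE exprn_ge0. Qed.

Lemma normBsq x y :
  `|x - y| ^+ 2 = `|x| ^+ 2 - inner x y - inner y x + `|y| ^+ 2.
Proof.
rewrite -!inner_normE innerBl !innerBr; ring.
Qed.

Lemma normDsq x y :
  `|x + y| ^+ 2 = `|x| ^+ 2 + inner x y + inner y x + `|y| ^+ 2.
Proof.
rewrite -!inner_normE innerDl !innerDr; ring.
Qed.

Lemma parallelogram x y :
  `|x + y| ^+ 2 + `|x - y| ^+ 2 = 2 * `|x| ^+ 2 + 2 * `|y| ^+ 2.
Proof. by rewrite normDsq normBsq; ring. Qed.

End inner_basics.

(** Linearity follows from the existence of an adjoint, so this is a
    convenient substitute for bounded operators: sums, compositions and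
    adjoints are again of this form without any estimate. *)
Record op (R : realType) (X Y : hilbertType R) := Op {
  opf :> X -> Y ;
  opstar : Y -> X ;
  opP : forall x y, inner (opf x) y = inner x (opstar y) }.

Section op_theory.
Variables (R : realType).
Implicit Types X Y Z : hilbertType R.

Fact op_linear X Y (A : op X Y) : linear A.
Proof.
move=> a x y; apply: inner_inj => z.
by rewrite opP innerDl innerZl [in RHS]innerDl innerZl !opP.
Qed.
HB.instance Definition _ X Y (A : op X Y) :=
  GRing.isLinear.Build R[i] X Y _ (opf A) (op_linear A).

Lemma opfD X Y (A : op X Y) x y : A (x + y) = A x + A y. Proof. exact: raddfD. Qed.
Lemma opfB X Y (A : op X Y) x y : A (x - y) = A x - A y. Proof. exact: raddfB. Qed.
Lemma opf0 X Y (A : op X Y) : A 0 = 0. Proof. exact: raddf0. Qed.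
Lemma opfZ X Y (A : op X Y) a x : A (a *: x) = a *: A x. Proof. exact: linearZ. Qed.

Fact adj_subproof X Y (A : op X Y) (y : Y) (x : X) :
  inner (opstar A y) x = inner y (A x).
Proof. by rewrite innerC -opP -innerC. Qed.
Definition adj X Y (A : op X Y) : op Y X := Op (adj_subproof A).

Lemma adjP X Y (A : op X Y) x y : inner (A x) y = inner x (adj A y).
Proof. exact: opP. Qed.
Lemma adjP' X Y (A : op X Y) x y : inner x (A y) = inner (adj A x) y.
Proof. by rewrite (adjP (adj A)). Qed.

Fact id_subproof X (x y : X) : inner x y = inner x y. Proof. by []. Qed.
Definition op1 X : op X X := @Op _ _ _ (fun x : X => x) (fun x => x) (@id_subproof X).

Fact comp_subproof X Y Z (A : op Y Z) (B : op X Y) x y :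
  inner (A (B x)) y = inner x (adj B (adj A y)).
Proof. by rewrite !adjP. Qed.
Definition opM X Y Z (A : op Y Z) (B : op X Y) : op X Z :=
  @Op _ _ _ (fun x => A (B x)) (fun y => adj B (adj A y)) (comp_subproof A B).

Fact add_subproof X Y (A B : op X Y) x y :
  inner (A x + B x) y = inner x (adj A y + adj B y).
Proof. by rewrite innerDl innerDr !adjP. Qed.
Definition opD X Y (A B : op X Y) : op X Y :=
  @Op _ _ _ (fun x => A x + B x) (fun x => adj A x + adj B x) (add_subproof A B).

Fact scale_subproof X Y a (A : op X Y) x y :
  inner (a *: A x) y = inner x (Num.conj a *: adj A y).
Proof. by rewrite innerZl innerZr adjP conjCK. Qed.
Definition opZ X Y a (A : op X Y) : op X Y :=
  @Op _ _ _ (fun x => a *: A x) (fun x => Num.conj a *: adj A x)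
    (scale_subproof a A).

Fact sub_subproof X Y (A B : op X Y) x y :
  inner (A x - B x) y = inner x (adj A y - adj B y).
Proof. by rewrite innerBl innerBr !adjP. Qed.
Definition opB X Y (A B : op X Y) : op X Y :=
  @Op _ _ _ (fun x => A x - B x) (fun x => adj A x - adj B x) (sub_subproof A B).

Fact unitary_linear X (U : unitary X) : linear U.
Proof. by case: (unitaryP U). Qed.
HB.instance Definition _ X (U : unitary X) :=
  GRing.isLinear.Build R[i] X X _ (unitary_fun U) (unitary_linear U).

Lemma unitaryfD X (U : unitary X) x y : U (x + y) = U x + U y.
Proof. exact: raddfD. Qed.
Lemma unitaryfB X (U : unitary X) x y : U (x - y) = U x - U y.
Proof. exact: raddfB. Qed.
Lemma unitaryf0 X (U : unitary X) : U 0 = 0. Proof. exact: raddf0. Qed.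

Lemma unitary_inner X (U : unitary X) x y : inner (U x) (U y) = inner x y.
Proof. by case: (unitaryP U). Qed.

Fact unitary_adj X (U : unitary X) x y :
  inner (U x) y = inner x (unitaryV U y).
Proof. by rewrite -[y in LHS](unitaryVK U) unitary_inner. Qed.
Definition uop X (U : unitary X) : op X X := Op (unitary_adj U).

Lemma unitary_norm X (U : unitary X) x : `|U x| = `|x|.
Proof.
apply/eqP; rewrite -(@eqrXn2 _ 2)//; apply/eqP.
by rewrite -!inner_normE unitary_inner.
Qed.

Fact op_unitary_subproof X (A : op X X) :
  (forall x, adj A (A x) = x) -> (forall x, A (adj A x) = x) -> unitary_operator A.
Proof.
move=> A1 A2; split; first exact: op_linear.
  by exists (adj A).
by move=> x y; rewrite adjP A1.
Qed.
Definition op_unitary X (A : op X X) h1 h2 : unitary X :=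
  Unitary (@op_unitary_subproof X A h1 h2).

Lemma comm_unitaryV X (A : op X X) (U : unitary X) :
  (forall x, A (U x) = U (A x)) -> forall x, A (unitaryV U x) = unitaryV U (A x).
Proof. by move=> AU x; rewrite -[LHS](unitaryK U) -AU unitaryVK. Qed.

End op_theory.

(** Stated for a form on a module without topology: besides inner products,
    it serves positive operators, finite sums, and l2 before its norm exists. *)
Lemma form_cauchy_schwarz (R : realType) (V : lmodType R[i]) (f : V -> V -> R[i]) :
  (forall x y z, f (x + y) z = f x z + f y z) ->
  (forall k x y, f (k *: x) y = k * f x y) ->
  (forall x y, f x y = Num.conj (f y x)) ->
  (forall x, 0 <= f x x) ->
  forall x y, `|f x y| ^+ 2 <= f x x * f y y.
Proof.
move=> fD fZ fC f0 x y.
have fZr k u v : f u (k *: v) = Num.conj k * f u v.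
  by rewrite fC fZ rmorphM /= -fC.
have fDr u v w : f u (v + w) = f u v + f u w by rewrite fC fD rmorphD /= -!fC.
set a := f x x; set b := f y y; set c := f x y.
have cC : f y x = Num.conj c by rewrite fC.
(* the form at x - s c y, for real s: a quadratic polynomial in s *)
have key (s : R[i]) : 0 <= s ->
    0 <= a - s * `|c| ^+ 2 *+ 2 + s ^+ 2 * `|c| ^+ 2 * b.
  move=> s0; have := f0 (x + (- (s * c)) *: y).
  rewrite fD !fDr !fZ !fZr -/a -/b -/c cC.
  rewrite rmorphN rmorphM /= geC0_conj // normCK; congr (_ <= _); ring.
have b0 : 0 <= b by exact: f0.
have a0 : 0 <= a by exact: f0.
have c0 : 0 <= `|c| ^+ 2 by rewrite exprn_ge0.
have [b_eq0|b_neq0] := eqVneq b 0.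
  have [->|c_neq0] := eqVneq (`|c| ^+ 2) 0; first by rewrite b_eq0 mulr0.
  have cgt : 0 < `|c| ^+ 2 by rewrite lt0r c_neq0.
  have := key ((a + 1) / (`|c| ^+ 2)) (divr_ge0 (addr_ge0 a0 ler01) c0).
  rewrite b_eq0 mulr0 addr0 divfK // => h; exfalso; move: h.
  have -> : a - (a + 1) *+ 2 = - (a + 2) by ring.
  by rewrite oppr_ge0 => /(lt_le_trans (ltr_wpDl a0 (ltr0Sn _ 1))); rewrite ltxx.
have bgt : 0 < b by rewrite lt0r b_neq0.
have := key b^-1; rewrite invr_ge0 => /(_ b0).
have -> : a - b^-1 * `|c| ^+ 2 *+ 2 + b^-1 ^+ 2 * `|c| ^+ 2 * b = a - `|c| ^+ 2 / b.
  by field.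
by rewrite subr_ge0 ler_pdivrMr.
Qed.

Section cauchy_schwarz.
Variables (R : realType) (H : hilbertType R).
Local Notation C := R[i].

Lemma op_cauchy_schwarz (E : op H H) :
  (forall x y, inner (E x) y = inner x (E y)) ->
  (forall x, 0 <= inner (E x) x) ->
  forall x y, `|inner (E x) y| ^+ 2 <= inner (E x) x * inner (E y) y.
Proof.
move=> Es E0; apply: (form_cauchy_schwarz (f := fun x y => inner (E x) y)) => //.
- by move=> x y z; rewrite opfD innerDl.
- by move=> k x y; rewrite opfZ innerZl.
- by move=> x y; rewrite Es innerC.
Qed.

Lemma cauchy_schwarz (x y : H) : `|inner x y| <= `|x| * `|y|.
Proof.
rewrite -(@ler_pXn2r _ 2) ?nnegrE ?mulr_ge0 // exprMn -!inner_normE.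
exact: (@op_cauchy_schwarz (@op1 R H)) (fun _ _ => erefl) (@inner_ge0 R H) x y.
Qed.

End cauchy_schwarz.

(** * Convergence in complex normed spaces *)

Section complex_order.
Variable R : realType.
Local Notation C := R[i].

Lemma complex_ge0P (z : C) : 0 <= z -> z = (complex.Re z)%:C /\ 0 <= complex.Re z.
Proof. by case: z => a b; rewrite lecE /= => /andP[/eqP -> a0]. Qed.

Lemma complex_gt0P (z : C) : 0 < z -> z = (complex.Re z)%:C /\ 0 < complex.Re z.
Proof. by case: z => a b; rewrite ltcE /= => /andP[/eqP -> a0]. Qed.

Lemma normE_Re (V : normedModType C) (x : V) : `|x| = (complex.Re `|x|)%:C.
Proof. by case: (complex_ge0P (normr_ge0 x)). Qed.

(** A predicate rather than a structure, so that it also applies to the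
    complex numbers seen as a normed space over themselves. *)
Definition complete_space (V : normedModType C) :=
  forall F : set_system V, ProperFilter F -> cauchy F -> cvg F.

Lemma cvg_of_near (V : normedModType C) (T : Type) (F : set_system T)
  {FF : ProperFilter F} (u : T -> V) : complete_space V ->
  (forall e : R, 0 < e -> exists x : V, \forall y \near F, `|x - u y| < e%:C) ->
  cvg (u @ F).
Proof.
move=> Vc h; apply: Vc; apply: cauchy_exP => e e0.
have [-> /h [x hx]] := complex_gt0P e0.
by exists x; rewrite -ball_normE.
Qed.

(** A bounded increasing real sequence that dominates the increments of u
    makes u Cauchy; both operator iterations below converge in this way. *)
Lemma dominated_increments_cvg (V : completeNormedModType C) (u : nat -> V) (r : nat -> R) (M : R)
    (c : C) : 0 <= c ->
  (forall n, r n <= r n.+1) -> (forall n, r n <= M) ->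
  (forall n, `|u n.+1 - u n| <= (r n.+1 - r n)%:C * c) ->
  cvg (u @ \oo).
Proof.
move=> c0 r_incr rM ur.
have ur' m n : `|u (n + m)%N - u n| <= (r (n + m)%N - r n)%:C * c.
  elim: m => [|m IH]; first by rewrite addn0 !subrr normr0 mul0r.
  rewrite addnS -(subrKA (u (n + m)%N)) -(subrKA (r (n + m)%N)).
  rewrite rmorphD mulrDl; apply: le_trans (ler_normD _ _) _.
  by rewrite lerD.
have [c1 c1_0] := complex_ge0P c0; rewrite c1 in ur'.
move: (complex.Re c) c1_0 ur' => k k0 ur'.
have rS : has_sup (range r).
  by split; [exists (r 0%N), 0%N | exists M => _ [n _ <-]].
apply: cvg_of_near => [|e e0]; first exact: cauchy_cvg.
have d0 : 0 < e / (k + 1) by rewrite divr_gt0 // ltr_wpDl.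
have [_ [N _ <-] hN] := sup_adherent d0 rS.
exists (u N); near=> n.
have Nn : (N <= n)%N by near: n; exact: nbhs_infty_ge.
rewrite distrC -(subnKC Nn); apply: le_lt_trans (ur' _ _) _.
rewrite subnKC // -rmorphM ltcR.
have : r n <= sup (range r) by apply: ub_le_sup; [case: rS | exists n].
move=> rn; have : r n - r N <= e / (k + 1) by lra.
move=> /(ler_wpM2r k0) /le_lt_trans; apply.
rewrite mulrAC ltr_pdivrMr ?ltr_wpDl // ltr_pM2l //; lra.
Unshelve. all: by end_near. Qed.

End complex_order.

(** * Square roots of 1 - Z for a contraction Z *)

Section limits.
Variables (R : realType).
Local Notation C := R[i].

Lemma normed_cvg_unique (V : normedModType C) (T : Type) (F : set_system T)
    {FF : ProperFilter F} (u : T -> V) (l l' : V) :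
  u @ F --> l -> u @ F --> l' -> l = l'.
Proof. exact: (@cvg_unique _ (@norm_hausdorff _ _)). Qed.

Lemma cvg_innerl (H : hilbertType R) (T : Type) (F : set_system T) {FF : Filter F}
    (u : T -> H) (l y : H) :
  u @ F --> l -> (fun t => inner (u t) y : C^o) @ F --> (inner l y : C^o).
Proof.
move=> ul; apply/cvgrPdist_lt => e e0.
have y1 : 0 < `|y| + 1 by rewrite ltr_wpDl.
move/cvgrPdist_lt : ul => /(_ (e / (`|y| + 1)) (divr_gt0 e0 y1)).
apply: filterS => t; rewrite ltr_pdivlMr // => lt.
rewrite -innerBl; apply: le_lt_trans (cauchy_schwarz _ _) _.
by apply: le_lt_trans lt; rewrite ler_wpM2l // lerDl.
Qed.

Lemma cvg_innerr (H : hilbertType R) (T : Type) (F : set_system T) {FF : Filter F}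
    (u : T -> H) (l y : H) :
  u @ F --> l -> (fun t => inner y (u t) : C^o) @ F --> (inner y l : C^o).
Proof.
move=> ul; apply/cvgrPdist_lt => e e0.
have y1 : 0 < `|y| + 1 by rewrite ltr_wpDl.
move/cvgrPdist_lt : ul => /(_ (e / (`|y| + 1)) (divr_gt0 e0 y1)).
apply: filterS => t; rewrite ltr_pdivlMr // => lt.
rewrite -innerBr; apply: le_lt_trans (cauchy_schwarz _ _) _.
by rewrite mulrC; apply: le_lt_trans lt; rewrite ler_wpM2l // lerDl.
Qed.

Lemma cvg_norm_le (V : normedModType C) (T : Type) (F : set_system T)
    {FF : ProperFilter F} (u : T -> V) (l : V) (M : R) :
  u @ F --> l -> (\forall t \near F, `|u t| <= M%:C) -> `|l| <= M%:C.
Proof.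
move=> ul uM; rewrite normE_Re lecR; apply/ler_addgt0Pr => e e0.
have e0' : 0 < e%:C by rewrite ltcR.
move/cvgrPdist_lt : ul => /(_ _ e0') ul.
have [t [t1 t2]] := filter_ex (filterI ul uM).
rewrite -lecR rmorphD /= -normE_Re -[l](subrKC (u t)).
by apply: le_trans (ler_normD _ _) _; rewrite lerD // ltW.
Qed.

Lemma cvg_lipschitz (V W : normedModType C) (T : Type) (F : set_system T)
    {FF : Filter F} (A : V -> W) (u : T -> V) (l : V) (k : C) : 0 <= k ->
  (forall x y, `|A x - A y| <= k * `|x - y|) ->
  u @ F --> l -> (fun t => A (u t)) @ F --> A l.
Proof.
move=> k0 Ak ul; apply/cvgrPdist_lt => e e0.
have k1 : 0 < k + 1 by rewrite ltr_wpDl.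
move/cvgrPdist_lt : ul => /(_ (e / (k + 1)) (divr_gt0 e0 k1)).
apply: filterS => t; rewrite ltr_pdivlMr // => lt.
apply: le_lt_trans (Ak _ _) _.
by rewrite mulrC; apply: le_lt_trans lt; rewrite ler_wpM2l // lerDl.
Qed.

(** Convergence of the adjoints is required as well: it provides the adjoint
    of the limit. *)
Lemma pointwise_lim_op (X Y : hilbertType R) (A : nat -> op X Y) :
  (forall x, cvg ((fun n => A n x) @ \oo)) ->
  (forall y, cvg ((fun n => adj (A n) y) @ \oo)) ->
  exists L : op X Y, (forall x, (fun n => A n x) @ \oo --> L x) /\
    (forall y, (fun n => adj (A n) y) @ \oo --> adj L y).
Proof.
move=> cA cB.
pose L x : Y := lim ((fun n => A n x) @ \oo).
pose L' y : X := lim ((fun n => adj (A n) y) @ \oo).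
have LL' x y : inner (L x) y = inner x (L' y).
  pose proof (h1 := cvg_innerl (y := y) (cA x)).
  pose proof (h2 := cvg_innerr (y := x) (cB y)).
  have e : (fun n => inner (A n x) y) = (fun n => inner x (adj (A n) y)).
    by apply/funext => n; rewrite adjP.
  rewrite e in h1; exact: (normed_cvg_unique (V := C^o) h1 h2).
by exists (Op LL').
Qed.

Definition contraction (X Y : hilbertType R) (A : op X Y) :=
  forall x, `|A x| <= `|x|.

Lemma adj_bound (X Y : hilbertType R) (A : op X Y) (k : C) : 0 <= k ->
  (forall x, `|A x| <= k * `|x|) -> forall y, `|adj A y| <= k * `|y|.
Proof.
move=> k0 Ak y.
have [->|n0] := eqVneq `|adj A y| 0; first by rewrite mulr_ge0.
have ngt : 0 < `|adj A y| by rewrite lt0r n0 normr_ge0.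
rewrite -(ler_pM2r ngt) -expr2 -inner_normE -adjP.
rewrite -[X in X <= _]ger0_norm; last by rewrite adjP inner_ge0.
apply: le_trans (cauchy_schwarz _ _) _.
by rewrite mulrAC ler_wpM2r.
Qed.

End limits.

Section square_root.
Variables (R : realType) (H : hilbertType R).
Local Notation C := R[i].

Lemma real_complex_half : (2^-1 : R)%:C = 2^-1 :> C.
Proof. by rewrite fmorphV rmorph_nat. Qed.

(** The iteration for the fixed point Y = (Z + Y^2) / 2, for which
    (1 - Y)^2 = 1 - Z; it starts at 0, written as an operator with an
    adjoint. *)
Fixpoint root_iter (Z : op H H) (n : nat) : op H H :=
  if n is m.+1 then opZ 2^-1 (opD Z (opM (root_iter Z m) (root_iter Z m)))
  else opZ 0 Z.

Lemma adj_root_iter Z n x : adj (root_iter Z n) x = root_iter (adj Z) n x.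
Proof.
elim: n x => [|n IH] x; first by rewrite /= conjC0.
rewrite /= geC0_conj ?invr_ge0 //.
have {}IH : opstar (root_iter Z n) =1 root_iter (adj Z) n by exact: IH.
by rewrite !IH.
Qed.

(** The same iteration for the number Z = 1.  Comparing with it bounds the
    iterates and their increments. *)
Fixpoint root_rate (n : nat) : R :=
  if n is m.+1 then 2^-1 * (1 + root_rate m ^+ 2) else 0.

Lemma root_rate_ge0_le1 n : 0 <= root_rate n <= 1.
Proof. by elim: n => [|n /andP[IH1 IH2]] /=; apply/andP; split; nra. Qed.

Lemma root_rate_incr n : root_rate n <= root_rate n.+1.
Proof. by have /andP[? ?] := root_rate_ge0_le1 n; rewrite /=; nra. Qed.

Variable Z : op H H.
Hypothesis Z1 : contraction Z.

Lemma root_iter_bound n x :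
  `|root_iter Z n x| <= (root_rate n)%:C * `|x|.
Proof.
elim: n x => [|n IH] x /=; first by rewrite scale0r normr0 mul0r.
have /andP[r0 r1] := root_rate_ge0_le1 n.
rewrite normrZ ger0_norm ?invr_ge0 // rmorphM /= real_complex_half rmorphD rmorph1 /=.
rewrite -mulrA ler_wpM2l ?invr_ge0 //.
apply: le_trans (ler_normD _ _) _; rewrite mulrDl mul1r lerD //.
apply: le_trans (IH _) _; rewrite rmorphXn /= expr2 -mulrA.
by rewrite ler_wpM2l // lecR.
Qed.

(** Induction on Y_(n+1)^2 - Y_n^2 =
    Y_(n+1) (Y_(n+1) - Y_n) + (Y_(n+1) - Y_n) Y_n, which is term by term
    the factorization of the increments of the scalar iteration. *)
Lemma root_iter_diff n x :
  `|root_iter Z n.+1 x - root_iter Z n x| <=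
    (root_rate n.+1 - root_rate n)%:C * `|x|.
Proof.
elim: n x => [|n IH] x.
  rewrite /= !scale0r !addr0 !subr0 expr0n /= addr0 mulr1.
  rewrite normrZ ger0_norm ?invr_ge0 // real_complex_half.
  by rewrite ler_wpM2l ?invr_ge0.
set y := root_iter Z n in IH *; set y1 := root_iter Z n.+1 in IH *.
have -> : root_iter Z n.+2 x - y1 x = 2^-1 *: (y1 (y1 x - y x) + (y1 (y x) - y (y x))).
  have E2 : root_iter Z n.+2 x = 2^-1 *: (Z x + y1 (y1 x)) by [].
  have E1 : y1 x = 2^-1 *: (Z x + y (y x)) by [].
  rewrite E2 [X in _ - X]E1 -scalerBr (opfB y1); congr (_ *: _).
  by rewrite subrKA opprD addrACA subrr add0r.
set r := root_rate n in IH *; set r1 := root_rate n.+1 in IH *.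
have -> : root_rate n.+2 - r1 = 2^-1 * (r1 * (r1 - r) + (r1 - r) * r).
  by rewrite /r1 /= -/r; field.
have By : forall x, `|y x| <= r%:C * `|x| := root_iter_bound n.
have By1 : forall x, `|y1 x| <= r1%:C * `|x| := root_iter_bound n.+1.
have rr1 : r <= r1 := root_rate_incr n.
have /andP[r0 _] := root_rate_ge0_le1 n; rewrite -/r in r0.
have /andP[r10 _] := root_rate_ge0_le1 n.+1; rewrite -/r1 in r10.
clearbody y y1 r r1.
rewrite normrZ ger0_norm ?invr_ge0 // rmorphM /= real_complex_half rmorphD /=.
rewrite -mulrA ler_wpM2l ?invr_ge0 //.
apply: le_trans (ler_normD _ _) _; rewrite mulrDl lerD //.
  apply: le_trans (By1 _) _.
  by rewrite rmorphM /= -mulrA ler_wpM2l // lecR.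
apply: le_trans (IH _) _; rewrite rmorphM /= -mulrA ler_wpM2l //.
by rewrite lecR subr_ge0.
Qed.

Lemma root_iter_cvg x : cvg ((fun n => root_iter Z n x) @ \oo).
Proof.
apply: (@dominated_increments_cvg _ _ _ root_rate 1 `|x|) => //; first exact: root_rate_incr.
- by move=> n; have /andP[] := root_rate_ge0_le1 n.
- by move=> n; exact: (root_iter_diff n x).
Qed.

End square_root.

Section square_root_limit.
Variables (R : realType) (H : hilbertType R).
Local Notation C := R[i].

(** The iterates of root_iter converge to Y with Y = (Z + Y^2) / 2, and
    F = 1 - Y.  The commutation clause holds because the
    iterates are polynomials in Z; taking A to be an adjoint, it also yields
    the commutation properties of the adjoint of F. *)
Lemma contraction_sqrt (Z : op H H) : contraction Z ->
  exists F : op H H, [/\ forall x, F (F x) = x - Z x,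
    forall x, `|x - F x| <= `|x|,
    forall A : op H H, (forall x, A (Z x) = Z (A x)) -> forall x, A (F x) = F (A x) &
    (forall x, adj Z x = Z x) -> forall x, adj F x = F x].
Proof.
move=> Z1.
have Z1' : contraction (adj Z).
  by move=> y; rewrite -[leRHS]mul1r; apply: adj_bound => // x; rewrite mul1r.
have [] := @pointwise_lim_op _ _ _ (root_iter Z).
- exact: root_iter_cvg.
- move=> y; under eq_fun do rewrite adj_root_iter; exact: root_iter_cvg.
move=> Y [Yl Yl'].
have Yx1 n x : `|root_iter Z n x| <= `|x|.
  apply: le_trans (root_iter_bound Z1 n x) _.
  by rewrite -[leRHS]mul1r ler_wpM2r // lecR; have /andP[] := root_rate_ge0_le1 R n.
have Y1 x : `|Y x| <= `|x|.
  rewrite (normE_Re x); apply: cvg_norm_le (Yl x) _.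
  by near=> n; rewrite -normE_Re.
have Ylim (x : H) (l : H) : (fun n => root_iter Z n x) @ \oo --> l -> Y x = l.
  move=> h; exact: normed_cvg_unique (Yl x) h.
have YY x : Y x = 2^-1 *: (Z x + Y (Y x)).
  apply: Ylim; rewrite -(cvg_shiftS).
  apply: cvgZr; apply: cvgD; first exact: cvg_cst.
  have h1 : (fun n => root_iter Z n (Y x)) @ \oo --> Y (Y x) by exact: Yl.
  have h2 : (fun n => root_iter Z n (root_iter Z n x - Y x)) @ \oo --> (0 : H).
    apply/cvgrPdist_lt => e e0.
    move/cvgrPdist_lt : (Yl x) => /(_ e e0); apply: filterS => n lt.
    by rewrite sub0r normrN; apply: le_lt_trans (Yx1 _ _) _; rewrite distrC.
  have e n : root_iter Z n (root_iter Z n x) =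
      root_iter Z n (Y x) + root_iter Z n (root_iter Z n x - Y x).
    by rewrite opfB addrC subrK.
  rewrite (eq_cvg _ _ e) -[Y (Y x)]addr0; exact: cvgD h1 h2.
exists (opB (@op1 R H) Y); split => /=.
- move=> x; rewrite opfB; have e : Y x + Y x = Z x + Y (Y x).
    have := YY x; set w := _ + Y (Y x) => ->.
    by rewrite -scalerDl (_ : _ + _ = 1) ?scale1r //; field.
  by rewrite -[Z x](addrK (Y (Y x))) -e !opprB opprD (addrCA (Y (Y x))) [RHS]addrA.
- by move=> x; rewrite opprB addrC subrK.
- move=> A AZ x; rewrite opfB; congr (_ - _).
  have AY n y : root_iter Z n (A y) = A (root_iter Z n y).
    elim: n y => [|n IH] y /=; first by rewrite !scale0r opf0.
    by rewrite opfZ opfD -AZ !IH.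
  apply: inner_inj => z; rewrite adjP.
  pose proof (h1 := cvg_innerl (y := adj A z) (Yl x)).
  pose proof (h2 := cvg_innerl (y := z) (Yl (A x))).
  rewrite (eq_cvg _ _ (fun n => congr1 (inner ^~ z) (AY n x))) in h2.
  rewrite (eq_cvg _ _ (fun n => adjP A _ z)) in h2.
  exact: (normed_cvg_unique (V := C^o) h1 h2).
- move=> ZZ x; congr (_ - _); apply/esym/Ylim.
  have e n y : root_iter Z n y = adj (root_iter Z n) y.
    rewrite adj_root_iter; elim: n y => [|n IH] y /=; first by rewrite !scale0r.
    by rewrite !IH (ZZ y).
  rewrite (eq_cvg _ _ (fun n => e n x)); exact: Yl'.
Unshelve. all: by end_near. Qed.
End square_root_limit.

(** * Inverses of coercive operators *)

Section neumann.
Variables (R : realType) (H : hilbertType R).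
Local Notation C := R[i].

(** The partial sums of the geometric series, from G_(n+1) = 1 + Z G_n. *)
Fixpoint neumann_iter (Z : op H H) (n : nat) : op H H :=
  if n is m.+1 then opD (@op1 _ H) (opM Z (neumann_iter Z m)) else opZ 0 Z.

Lemma neumann_iter_comm Z n x :
  neumann_iter Z n (Z x) = Z (neumann_iter Z n x).
Proof.
elim: n x => [|n IH] x /=; first by rewrite !scale0r opf0.
by rewrite IH -opfD.
Qed.

Lemma adj_neumann_iter Z n x :
  adj (neumann_iter Z n) x = neumann_iter (adj Z) n x.
Proof.
elim: n x => [|n IH] x; first by rewrite /= conjC0.
have IH' : opstar (neumann_iter Z n) =1 neumann_iter (adj Z) n by exact: IH.
by rewrite /= IH' (neumann_iter_comm (adj Z)).
Qed.

Lemma neumann_iter_cvg (Z : op H H) (q : R) : 0 <= q < 1 ->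
  (forall x, `|Z x| <= q%:C * `|x|) ->
  forall x, cvg ((fun n => neumann_iter Z n x) @ \oo).
Proof.
move=> /andP[q0 q1] Zq x.
pose fix r n : R := if n is m.+1 then 1 + q * r m else 0.
have r_bound n : 0 <= r n <= (1 - q)^-1.
  have q1' : 0 < 1 - q by lra.
  elim: n => [|n /andP[IH1 IH2]] /=; first by rewrite lexx invr_ge0 ltW.
  apply/andP; split; first by nra.
  have : q * r n <= q * (1 - q)^-1 by rewrite ler_wpM2l.
  have : (1 - q)^-1 = 1 + q * (1 - q)^-1 by field; lra.
  lra.
have r_incr n : r n <= r n.+1.
  by elim: n => [|n IH] /=; [lra | rewrite lerD2l ler_wpM2l].
apply: (@dominated_increments_cvg _ _ _ r (1 - q)^-1 `|x|) => // n.
  by have /andP[] := r_bound n.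
elim: n => [|n IH]; first by rewrite /= !scale0r opf0 !(addr0, subr0) mulr0 addr0 mul1r.
have -> : neumann_iter Z n.+2 x - neumann_iter Z n.+1 x =
    Z (neumann_iter Z n.+1 x - neumann_iter Z n x).
  by rewrite opfB /= opprD addrACA subrr add0r.
have -> : r n.+2 - r n.+1 = q * (r n.+1 - r n) by rewrite /=; ring.
apply: le_trans (Zq _) _.
by rewrite rmorphM /= -mulrA ler_wpM2l // lecR.
Qed.

Lemma neumann (Z : op H H) (q : R) : 0 <= q < 1 ->
  (forall x, `|Z x| <= q%:C * `|x|) ->
  exists G : op H H, (forall x, G (x - Z x) = x) /\ (forall x, G x - Z (G x) = x).
Proof.
move=> q01 Zq; have q0 : 0 <= q%:C :> C by rewrite lecR; case/andP : q01.
have Zq' := adj_bound q0 Zq.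
have fix_lim (Y G : op H H) : (forall x, `|Y x| <= q%:C * `|x|) ->
    (forall x, (fun n => neumann_iter Y n x) @ \oo --> G x) ->
    forall x, G x - Y (G x) = x.
  move=> Yq GY x; apply/eqP; rewrite subr_eq; apply/eqP.
  apply: (normed_cvg_unique (GY x)); rewrite -cvg_shiftS.
  apply: cvgD; first exact: cvg_cst.
  apply: (cvg_lipschitz q0 _ (GY x)) => y z; rewrite -opfB; exact: Yq.
have [] := @pointwise_lim_op _ _ _ (neumann_iter Z).
- exact: neumann_iter_cvg q01 Zq.
- move=> y; under eq_fun do rewrite adj_neumann_iter.
  exact: neumann_iter_cvg q01 Zq' y.
move=> G [Gl Gl']; exists G; split; last exact: fix_lim Zq Gl.
move=> x; apply: inner_inj => z.
have Gl'' y : (fun n => neumann_iter (adj Z) n y) @ \oo --> adj G y.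
  by rewrite -(eq_cvg _ _ (fun n => adj_neumann_iter Z n y)).
have := fix_lim _ _ Zq' Gl'' z.
by rewrite adjP innerBl adjP -innerBr => ->.
Qed.

(** The number w rotates the numerical range of T into a right half-plane.
    For k a small multiple of w, 1 - k T is then a strict contraction, so
    k T is inverted by the geometric series. *)
Lemma coercive_inverse (T : op H H) (M c : R) (w : C) : 0 < c ->
  (forall x, `|T x| <= M%:C * `|x|) -> `|w| = 1 ->
  (forall x, (2 * c)%:C * `|x| ^+ 2 <=
     w * inner (T x) x + Num.conj (w * inner (T x) x)) ->
  exists B : op H H, [/\ forall x, B (T x) = x, forall x, T (B x) = x &
    forall x, `|B x| <= (c^-1)%:C * `|x|].
Proof.
move=> c0 TM w1 Tc.
pose m := `|M| + c.
have cm : c <= m by rewrite lerDr.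
have m0 : 0 < m by exact: lt_le_trans cm.
have Tm x : `|T x| <= m%:C * `|x|.
  apply: le_trans (TM x) _; rewrite ler_wpM2r // lecR.
  by rewrite (le_trans (ler_norm _)) // lerDl ltW.
(* rho minimizes 1 - 2 rho c + rho^2 m^2, a bound for the square of the norm of 1 - k T *)
pose rho := c / m ^+ 2.
pose k : C := rho%:C * w.
have rho0 : 0 < rho by rewrite divr_gt0 // exprn_gt0.
pose q2 := 1 - c ^+ 2 / m ^+ 2.
have q2_0 : 0 <= q2 < 1.
  rewrite subr_ge0 ler_pdivrMr ?exprn_gt0 // mul1r ler_pXn2r ?nnegrE ?(ltW c0, ltW m0) // cm.
  by rewrite gtrBl divr_gt0 // exprn_gt0.
pose q := Num.sqrt q2.
pose Z := opB (@op1 _ H) (opZ k T).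
have Zq x : `|Z x| <= q%:C * `|x|.
  have q0 : 0 <= q by rewrite sqrtr_ge0.
  rewrite -(@ler_pXn2r _ 2) ?nnegrE ?mulr_ge0 ?lecR //.
  rewrite exprMn -rmorphXn /= sqr_sqrtr; last by case/andP : q2_0.
  rewrite normBsq innerZl innerZr (innerC x (T x)) normrZ.
  have rhoE : `|rho%:C : C| = rho%:C by rewrite ger0_norm // lecR ltW.
  rewrite /k normrM w1 mulr1 rhoE.
  have := Tc x; set t := inner (T x) x => ht.
  have -> : `|x| ^+ 2 - Num.conj (rho%:C * w) * Num.conj t - rho%:C * w * t +
     (rho%:C * `|T x|) ^+ 2 =
     `|x| ^+ 2 - rho%:C * (w * t + Num.conj (w * t)) + rho%:C ^+ 2 * `|T x| ^+ 2.
    have rC : Num.conj rho%:C = rho%:C :> C by rewrite geC0_conj // lecR ltW.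
    have -> : Num.conj (rho%:C * w) = rho%:C * Num.conj w.
      by rewrite [LHS]rmorphM; congr (_ * _).
    have -> : Num.conj (w * t) = Num.conj w * Num.conj t by rewrite [LHS]rmorphM.
    by ring.
  have h1 : rho%:C ^+ 2 * `|T x| ^+ 2 <= rho%:C ^+ 2 * (m%:C ^+ 2 * `|x| ^+ 2).
    apply: ler_wpM2l; first by rewrite exprn_ge0 // lecR ltW.
    rewrite -exprMn ler_pXn2r ?nnegrE ?Tm // mulr_ge0 // lecR ltW //.
  have h2 : rho%:C * ((2 * c)%:C * `|x| ^+ 2) <= rho%:C * (w * t + Num.conj (w * t)).
    by apply: ler_wpM2l; first by rewrite lecR ltW.
  apply: le_trans (lerD (lerB (lexx _) h2) h1) _.
  rewrite le_eqVlt; apply/orP; left; apply/eqP.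
  have -> : q2 = 1 - rho * (2 * c) + rho ^+ 2 * m ^+ 2.
    by rewrite /q2 /rho; field; lra.
  rewrite !(rmorphD, rmorphM, rmorphN, rmorphXn, rmorph1) /=; clearbody rho m; ring.
have q01 : 0 <= q < 1.
  by rewrite sqrtr_ge0 /= -[X in _ < X]sqrtr1 ltr_sqrt //; case/andP : q2_0.
have [G [G1 G2]] := neumann q01 Zq.
have ZE x : x - Z x = k *: T x by rewrite /= opprB addrC subrK.
have B1 x : k *: G (T x) = x by rewrite -opfZ -ZE G1.
have B2 x : T (k *: G x) = x by rewrite opfZ -ZE G2.
exists (opZ k G); split => // x /=.
set y := k *: G x; have := Tc y; rewrite B2 => h.
have [->|y0] := eqVneq `|y| 0; first by rewrite mulr_ge0 // lecR invr_ge0 ltW.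
have ygt : 0 < `|y| by rewrite lt0r y0 normr_ge0.
rewrite fmorphV mulrC ler_pdivlMr ?ltcR // mulrC.
rewrite -(ler_pM2r ygt) -mulrA -expr2.
have two0 : 0 < 2 :> C by [].
rewrite -(ler_pM2l two0) mulrA -(rmorph_nat (real_complex R)) -rmorphM /=.
rewrite rmorph_nat; apply: (le_trans h).
set t := w * inner x y.
have t0 : 0 <= t + Num.conj t.
  by apply: le_trans h; rewrite mulr_ge0 ?exprn_ge0 // lecR mulr_ge0 // ltW.
rewrite -(ger0_norm t0); apply: le_trans (ler_normD _ _) _.
rewrite norm_conjC mulr_natl mulr2n lerD // /t normrM w1 mul1r; exact: cauchy_schwarz.
Qed.

End neumann.

(** * Orthogonal projections and isometric extensions *)

Section projection.
Variables (R : realType) (H : hilbertType R).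
Local Notation C := R[i].
Implicit Types (S : set H) (x y z m : H).

Definition perp S : set H := [set y | forall a, S a -> inner y a = 0].

Lemma perp0 S : perp S 0.
Proof. by move=> a _; rewrite inner0l. Qed.
Lemma perpD S x y : perp S x -> perp S y -> perp S (x + y).
Proof. by move=> Sx Sy a Sa; rewrite innerDl Sx // Sy // addr0. Qed.
Lemma perpZ S c x : perp S x -> perp S (c *: x).
Proof. by move=> Sx a Sa; rewrite innerZl Sx // mulr0. Qed.
Lemma perpB S x y : perp S x -> perp S y -> perp S (x - y).
Proof. by move=> Sx Sy a Sa; rewrite innerBl Sx // Sy // subr0. Qed.

(** A minimizing sequence is Cauchy by the parallelogram identity. *)
Lemma nearest_point S x : exists2 y, perp S y &
  forall m, perp S m -> `|x - y| <= `|x - m|.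
Proof.
pose nn z := complex.Re (`|z| ^+ 2).
have nnE z : `|z| ^+ 2 = (nn z)%:C by case: (complex_ge0P (exprn_ge0 2 (normr_ge0 z))).
have nn0 z : 0 <= nn z by rewrite -lecR -nnE exprn_ge0.
pose D := [set nn (x - m) | m in perp S].
have D_inf : has_inf D.
  split; first by exists (nn (x - 0)); exists 0 => //; exact: perp0.
  by exists 0 => _ [m _ <-].
pose d := inf D.
have d_le m : perp S m -> d <= nn (x - m).
  by move=> Sm; apply: ge_inf; [case: D_inf | exists m].
have /choice [y yP] n : exists y, perp S y /\ nn (x - y) < d + n.+1%:R^-1.
  have n0 : 0 < n.+1%:R^-1 :> R by rewrite invr_gt0 ltr0n.
  by have [_ [m Sm <-] lt] := inf_adherent n0 D_inf; exists m.
have dist n k : nn (y n - y k) <= 2 * n.+1%:R^-1 + 2 * k.+1%:R^-1.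
  have [Sn ltn] := yP n; have [Sk ltk] := yP k.
  have := parallelogram (x - y n) (x - y k).
  have := d_le _ (perpZ 2^-1 (perpD Sn Sk)); set mid := 2^-1 *: _ => dmid.
  have -> : x - y n + (x - y k) = 2 *: (x - mid).
    rewrite scalerBr scalerA divff ?pnatr_eq0 // scale1r scaler_nat mulr2n.
    by rewrite addrACA opprD.
  have -> : x - y n - (x - y k) = - (y n - y k) by rewrite !opprB addrC addrA subrK.
  rewrite normrN normrZ exprMn normr_nat !nnE -(rmorph_nat (real_complex R) 2).
  rewrite -rmorphXn -!rmorphM -!rmorphD /= => /(@complexI _) e.
  rewrite expr2 in e; move: (nn _) (nn _) (nn _) (nn _) (_^-1) (_^-1) dmid ltn ltk e. move=> *; lra.
have ycvg : cvg (y @ \oo).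
  apply: cvg_of_near => [|e e0]; first exact: cauchy_cvg.
  have e4 : 0 < e ^+ 2 / 4 by rewrite divr_gt0 // exprn_gt0.
  have [N _ Nlt] := near_infty_natSinv_lt (PosNum e4).
  exists (y N); near=> n.
  have Nn : (N <= n)%N by near: n; exact: nbhs_infty_ge.
  rewrite -(@ltr_pXn2r _ 2) ?nnegrE ?lecR ?(ltW e0) // nnE -rmorphXn ltcR.
  apply: le_lt_trans (dist _ _) _.
  have := Nlt N (leqnn N); have := Nlt n Nn => /=.
  by move: (N.+1%:R^-1) (n.+1%:R^-1) (e ^+ 2) => a b c *; lra.
have Sl : perp S (lim (y @ \oo)).
  move=> a Sa.
  pose proof (h := cvg_innerl (y := a) ycvg).
  have e0 n : inner (y n) a = 0 by exact: (yP n).1.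
  rewrite (eq_cvg _ _ e0) in h.
  exact: (normed_cvg_unique (V := C^o) h (@cvg_cst C^o _ _ _ _)).
exists (lim (y @ \oo)) => // m Sm.
set l := lim _ in Sl *.
rewrite -(@ler_pXn2r _ 2) ?nnegrE // !nnE lecR.
apply: le_trans (d_le _ Sm); apply/ler_addgt0Pr => e e0.
have xl : (fun n => x - y n) @ \oo --> x - l by apply: cvgB => //; exact: cvg_cst.
have := @cvg_norm_le _ _ _ _ _ _ _ (Num.sqrt (d + e)) xl.
have d0 : 0 <= d by apply: lb_le_inf; [case: D_inf | move=> _ [k _ <-]].
have de0 : 0 <= d + e by rewrite addr_ge0 // ltW.
have h1 z : (`|z| <= (Num.sqrt (d + e))%:C) = (nn z <= d + e).
  rewrite -(@ler_pXn2r _ 2) ?nnegrE ?lecR ?sqrtr_ge0 // nnE -rmorphXn /=.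
  by rewrite sqr_sqrtr // lecR.
rewrite h1; apply.
have [N _ Nlt] := near_infty_natSinv_lt (PosNum e0).
near=> n; rewrite h1.
have Nn : (N <= n)%N by near: n; exact: nbhs_infty_ge.
have /= lt1 := Nlt n Nn; have [_ lt2] := yP n.
by apply/ltW/(lt_trans lt2); rewrite ltrD2l.
Unshelve. all: by end_near. Qed.

(** The nearest point y is characterized by orthogonality of x - y to the
    subspace: compare its distance with that of y + s c m, where
    c = inner (x - y) m. *)
Lemma perp_decomp S x : exists2 y, perp S y & perp (perp S) (x - y).
Proof.
have [y Sy ymin] := nearest_point S x.
exists y => // m Sm; set z := x - y in ymin *; set c := inner z m.
have [m_eq0|m0] := eqVneq m 0; first by rewrite /c m_eq0 inner0r.
have mgt : 0 < `|m| ^+ 2 by rewrite exprn_gt0 // normr_gt0.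
pose s : C := (`|m| ^+ 2)^-1.
have s0 : 0 <= s by rewrite invr_ge0 ltW.
have : `|z| ^+ 2 <= `|z - (s * c) *: m| ^+ 2.
  rewrite ler_pXn2r ?nnegrE // /z -addrA -opprD; apply: ymin.
  by apply: perpD => //; exact: perpZ.
rewrite normBsq innerZl innerZr normrZ exprMn (innerC m z) -/c !rmorphM /=.
rewrite normrM exprMn (ger0_norm s0) (geC0_conj s0).
have -> : `|z| ^+ 2 - s * Num.conj c * c - s * c * Num.conj c + s ^+ 2 * `|c| ^+ 2 * `|m| ^+ 2 =
  `|z| ^+ 2 - s * `|c| ^+ 2.
  by rewrite normCK /s; field; rewrite normr_eq0.
rewrite lerBrDr gerDl => h.
have : s * `|c| ^+ 2 == 0 by rewrite eq_le h mulr_ge0 // exprn_ge0.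
rewrite mulf_eq0 invr_eq0 (gt_eqF mgt) /= sqrf_eq0 normr_eq0 => /eqP //.
Qed.

Definition perp_proj_fun S x : H := projT1 (cid2 (perp_decomp S x)).

Lemma perp_proj_mem S x : perp S (perp_proj_fun S x).
Proof. by rewrite /perp_proj_fun; case: cid2. Qed.

Lemma perp_proj_compl S x : perp (perp S) (x - perp_proj_fun S x).
Proof. by rewrite /perp_proj_fun; case: cid2. Qed.

Fact perp_proj_subproof S x y :
  inner (perp_proj_fun S x) y = inner x (perp_proj_fun S y).
Proof.
have e1 : inner (x - perp_proj_fun S x) (perp_proj_fun S y) = 0.
  exact: (@perp_proj_compl S x _ (@perp_proj_mem S y)).
have e2 : inner (perp_proj_fun S x) (y - perp_proj_fun S y) = 0.
  by apply: inner_eq0C; exact: (@perp_proj_compl S y _ (@perp_proj_mem S x)).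
move/eqP : e1; rewrite innerBl subr_eq0 => /eqP ->.
by move/eqP : e2; rewrite innerBr subr_eq0 => /eqP.
Qed.

(** The double annihilator is the closed span of S, so this is the orthogonal
    projection onto the closed span of S. *)
Definition span_proj S : op H H := Op (@perp_proj_subproof (perp S)).

Lemma span_proj_compl S x : perp S (x - span_proj S x).
Proof.
move=> a Sa; apply: (@perp_proj_compl (perp S) x) => m Sm.
exact/inner_eq0C/Sm.
Qed.

Lemma span_proj_id S x : perp (perp S) x -> span_proj S x = x.
Proof.
move=> Sx; apply/esym/eqP; rewrite -subr_eq0; apply/eqP/inner_xx0.
have h : perp (perp S) (x - span_proj S x).
  by apply: perpB => //; exact: perp_proj_mem.
exact: (h _ (@span_proj_compl S x)).
Qed.

Lemma span_proj_mem S x : S x -> span_proj S x = x.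
Proof. by move=> Sx; apply: span_proj_id => m Sm; apply/inner_eq0C/Sm. Qed.

Lemma span_proj_perp S x : perp S x -> span_proj S x = 0.
Proof.
move=> Sx; apply: inner_xx0.
have h : perp (perp S) (span_proj S x) by exact: perp_proj_mem.
apply: h; rewrite -[span_proj S x](subKr x).
by apply: perpB => //; exact: span_proj_compl.
Qed.

Lemma span_proj_idem S x : span_proj S (span_proj S x) = span_proj S x.
Proof. by apply: span_proj_id; exact: perp_proj_mem. Qed.

End projection.

Section isometric_extension.
Variable R : realType.

(** S and its annihilator together are total; the proof only uses adjoints:
    the adjoint of A - B takes its values in the annihilator, where A - B
    vanishes. *)
Lemma op_eq_on_span (X Y : hilbertType R) (A B : op X Y) (S : set X) :
  (forall x, S x -> A x = B x) -> (forall x, perp S x -> A x = B x) ->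
  forall x, A x = B x.
Proof.
move=> AS AP.
have D0 z : adj A z - adj B z = 0.
  set d := _ - _.
  have dS : perp S d.
    move=> s Ss; apply: inner_eq0C.
    by rewrite innerBr -!adjP AS // subrr.
  by apply: inner_xx0; rewrite {2}/d innerBr -!adjP AP // subrr.
move=> x; apply: inner_inj => z; rewrite !adjP; congr (inner _ _).
by apply/eqP; rewrite -subr_eq0 D0.
Qed.

Lemma op_eq_on_total (X Y : hilbertType R) (A B : op X Y) (S : set X) :
  (forall x, perp S x -> x = 0) -> (forall x, S x -> A x = B x) ->
  forall x, A x = B x.
Proof.
move=> S0 AS; apply: (op_eq_on_span AS) => x /S0 ->; by rewrite !opf0.
Qed.

Lemma scaler_halfD (V : lmodType R[i]) (x : V) : 2^-1 *: x + 2^-1 *: x = x.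
Proof. by rewrite -scalerDl (_ : _ + _ = 1) ?scale1r //; field. Qed.

Section hdsum_op.
Variables X Y : hilbertType R.

Lemma hdsum_innerE (p q : hdsum X Y) :
  inner p q = inner p.1 q.1 + inner p.2 q.2.
Proof. by []. Qed.

Fact hdinl_subproof (x : X) (p : hdsum X Y) :
  inner (hdpair x (0 : Y)) p = inner x p.1.
Proof. by rewrite hdsum_innerE /= inner0l addr0. Qed.
Definition hdinl : op X (hdsum X Y) := Op hdinl_subproof.

Fact hdsnd_subproof (p : hdsum X Y) (y : Y) :
  inner p.2 y = inner p (hdpair (0 : X) y).
Proof. by rewrite hdsum_innerE /= inner0r add0r. Qed.
Definition hdsnd : op (hdsum X Y) Y := Op hdsnd_subproof.

End hdsum_op.

(** The closed span of the pairs (e i, e' i) is the graph of the isometry to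
    be built.  If Q projects onto it, then (e i, 0) is the half-sum of
    (e i, e' i), which Q fixes, and of (e i, - e' i), which Q kills by equality
    of the Gram matrices.  So W is twice the second component of Q (x, 0),
    and its adjoint is twice the first component of Q (0, y). *)
Lemma isometric_extension (X Y : hilbertType R) (I : Type) (e : I -> X) (e' : I -> Y) :
  (forall i j, inner (e i) (e j) = inner (e' i) (e' j)) ->
  exists W : op X Y, [/\ forall i, W (e i) = e' i,
    forall i, adj W (e' i) = e i,
    forall x, adj W (W x) = span_proj (range e) x &
    forall y, W (adj W y) = span_proj (range e') y].
Proof.
move=> gram.
pose G : set (hdsum X Y) := range (fun i => hdpair (e i) (e' i)).
pose W := opZ 2 (opM (hdsnd X Y) (opM (span_proj G) (hdinl X Y))).
have proj1 i : span_proj G (hdpair (e i) 0) = 2^-1 *: hdpair (e i) (e' i).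
  have -> : hdpair (e i) (0 : Y) =
      2^-1 *: (hdpair (e i) (e' i) : hdsum X Y) + 2^-1 *: hdpair (e i) (- e' i).
    by apply: congr2; rewrite /= ?scalerN ?subrr // ?addNr // scaler_halfD.
  rewrite opfD !opfZ span_proj_mem; last by exists i.
  rewrite [X in _ + _ *: X]span_proj_perp ?scaler0 ?addr0 //.
  by move=> _ [j _ <-]; rewrite hdsum_innerE /= innerNl gram subrr.
have proj2 i : span_proj G (hdpair 0 (e' i)) = 2^-1 *: hdpair (e i) (e' i).
  have -> : hdpair (0 : X) (e' i) =
      2^-1 *: (hdpair (e i) (e' i) : hdsum X Y) + 2^-1 *: hdpair (- e i) (e' i).
    by apply: congr2; rewrite /= ?scalerN ?subrr // ?addNr // scaler_halfD.
  rewrite opfD !opfZ span_proj_mem; last by exists i.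
  rewrite [X in _ + _ *: X]span_proj_perp ?scaler0 ?addr0 //.
  by move=> _ [j _ <-]; rewrite hdsum_innerE /= innerNl gram addNr.
have WE x : W x = 2 *: (span_proj G (hdpair x 0)).2 by [].
have W'E y : adj W y = 2 *: (span_proj G (hdpair 0 y)).1.
  by rewrite -[in RHS](@geC0_conj _ 2).
have two2 : 2 / 2 = 1 :> R[i] by rewrite divff // pnatr_eq0.
have We i : W (e i) = e' i.
  by rewrite WE proj1 /= scalerA two2 scale1r.
have We' i : adj W (e' i) = e i.
  by rewrite W'E proj2 /= scalerA two2 scale1r.
have Wp x : perp (range e) x -> W x = 0.
  move=> ex; rewrite WE span_proj_perp ?scaler0 //.
  by move=> _ [j _ <-]; rewrite hdsum_innerE /= inner0l addr0 ex //; exists j.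
have Wp' y : perp (range e') y -> adj W y = 0.
  move=> ey; rewrite W'E span_proj_perp ?scaler0 //.
  by move=> _ [j _ <-]; rewrite hdsum_innerE /= inner0l add0r ey //; exists j.
exists W; split => //.
- apply: (@op_eq_on_span _ _ (opM (adj W) W) (span_proj (range e)) (range e)).
    by move=> _ [i _ <-]; rewrite span_proj_mem; [exact: etrans (congr1 _ (We i)) _|exists i].
  by move=> x ex; rewrite span_proj_perp //; apply: etrans (congr1 _ (Wp _ ex)) _; rewrite opf0.
- apply: (@op_eq_on_span _ _ (opM W (adj W)) (span_proj (range e')) (range e')).
    by move=> _ [i _ <-]; rewrite span_proj_mem; [exact: etrans (congr1 _ (We' i)) _|exists i].
  by move=> x ex; rewrite span_proj_perp //; apply: etrans (congr1 _ (Wp' _ ex)) _; rewrite opf0.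
Qed.

End isometric_extension.

(** * Square roots of unitary operators *)

Section unitary_sqrt.
Variables (R : realType) (H : hilbertType R).
Local Notation C := R[i].

Lemma perp_range (X : hilbertType R) (A : op X H) y :
  perp (range A) y <-> adj A y = 0.
Proof.
split=> [Ay|Ay _ [x _ <-]].
  apply: inner_xx0; rewrite adjP; apply: Ay; exists (adj A y) => //.
by rewrite adjP' Ay inner0l.
Qed.

Lemma span_proj_eq (S S' : set H) : perp S = perp S' -> span_proj S = span_proj S'.
Proof. by rewrite /span_proj => ->. Qed.

Lemma adj_comm (A B : op H H) : (forall x, A (B x) = B (A x)) ->
  forall x, adj A (adj B x) = adj B (adj A x).
Proof. by move=> AB x; apply: inner_inj => z; rewrite -!adjP' AB. Qed.

(** With F F = 1 + U and the partial isometry W such that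
    W (adj F) = F, the root is W plus the imaginary unit times the
    projection onto the kernel of F, which is the kernel of 1 + U.  The last
    clause is needed to keep subspaces invariant; its hypothesis only mentions
    U, as commutation with the inverse of U follows. *)
Lemma unitary_sqrt (U : unitary H) : exists V : unitary H,
  (forall x, V (V x) = U x) /\
  forall A : op H H, (forall x, A (U x) = U (A x)) -> forall x, A (V x) = V (A x).
Proof.
pose Z := opZ (-1) (uop U).
have Z1 : contraction Z by move=> x; rewrite /= scaleN1r normrN unitary_norm.
have [F [FF _ Fcomm _]] := contraction_sqrt Z1.
have {}FF x : F (F x) = x + U x by rewrite FF /= scaleN1r opprK.
have FC (A : op H H) : (forall x, A (U x) = U (A x)) -> forall x, A (F x) = F (A x).
  by move=> AU; apply: Fcomm => x; rewrite /= opfZ AU.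
have F'C (A : op H H) : (forall x, A (U x) = U (A x)) ->
    forall x, A (adj F x) = adj F (A x).
  move=> AU x; apply: (@adj_comm (adj A) F); apply: FC.
  by move=> y; apply: (@adj_comm A (adj (uop U))) => z /=; exact: (comm_unitaryV AU).
have F'F x : adj F (F x) = F (adj F x).
  apply: (FC (adj F)) => {}x; apply/esym/(@F'C (uop U)) => y //=.
have F'F' x : adj F (adj F x) = x + unitaryV U x.
  apply: inner_inj => z; rewrite -!adjP' FF innerDr innerDl; congr (_ + _).
  by rewrite -(adjP' (uop U)).
have F0 x : F x = 0 <-> adj F x = 0.
  split=> Fx; apply: inner_xx0; last by rewrite adjP F'F Fx opf0 inner0r.
  by rewrite -adjP' -F'F Fx opf0 inner0r.
(* normality of F *)
have gram x y : inner (adj F x) (adj F y) = inner (F x) (F y).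
  by rewrite -adjP' -F'F -adjP.
have [W [WF WF' W'W WW']] := isometric_extension gram.
set P := span_proj (range (adj F)) in W'W.
have perpF x : perp (range (adj F)) x <-> F x = 0 by rewrite perp_range.
have perpF' x : perp (range F) x <-> F x = 0 by rewrite perp_range -F0.
have PE : span_proj (range F) = P.
  by apply: span_proj_eq; apply/seteqP; split=> x; rewrite /= perpF perpF'.
rewrite PE in WW'.
have PF' x : P (adj F x) = adj F x by apply: span_proj_mem; exists x.
have P0 x : F x = 0 -> P x = 0 by move/perpF; exact: span_proj_perp.
have FP x : F (x - P x) = 0 by apply/perpF; exact: span_proj_compl.
have PP x : P (P x) = P x by exact: span_proj_idem.
have W0 x : F x = 0 -> W x = 0.
  by move=> Fx; apply: inner_xx0; rewrite adjP W'W P0 // inner0r.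
have W'0 x : F x = 0 -> adj W x = 0.
  by move=> Fx; apply: inner_xx0; rewrite adjP WW' P0 // inner0r.
have WP x : W (P x) = W x.
  by apply/esym/eqP; rewrite -subr_eq0 -opfB W0.
have W'P x : adj W (P x) = adj W x.
  by apply/esym/eqP; rewrite -subr_eq0 -opfB W'0.
have PW x : P (W x) = W x by rewrite -WW' W'W WP.
have PW' x : P (adj W x) = adj W x by rewrite -W'W WW' W'P.
(* both sides agree on the range of (adj F)^2: W^2 (adj F)^2 = F^2 = 1 + U = U (adj F)^2 *)
have WWU x : W (W x) = U (P x).
  apply: (@op_eq_on_span _ _ _ (opM W W) (opM (uop U) P) (range (opM (adj F) (adj F)))).
    move=> _ [y _ <-]; change (W (W (adj F (adj F y))) = U (P (adj F (adj F y)))).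
    rewrite WF -F'F WF FF PF' F'F' unitaryfD unitaryVK.
    by rewrite addrC.
  move=> y /perp_range Fy.
  have {}Fy : F y = 0 by apply: inner_xx0; rewrite adjP (F0 _).1 ?inner0r.
  by change (W (W y) = U (P y)); rewrite (W0 _ Fy) opf0 (P0 _ Fy) unitaryf0.
pose V := opD W (opZ 'i (opB (@op1 _ H) P)).
have VE x : V x = W x + 'i *: (x - P x) by [].
have V'E x : adj V x = adj W x - 'i *: (x - P x).
  by rewrite -scaleNr -conjCi.
have PV x : P (V x) = W x by rewrite VE opfD opfZ opfB PP subrr scaler0 addr0 PW.
have PV' x : P (adj V x) = adj W x.
  by rewrite V'E opfB opfZ opfB PP subrr scaler0 subr0 PW'.
have ii (y : H) : 'i *: ('i *: y) = - y by rewrite scalerA -expr2 sqrCi scaleN1r.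
have V'V x : adj V (V x) = x.
  rewrite V'E PV {2}VE addrAC subrr add0r ii opprK VE opfD opfZ.
  by rewrite (W'0 _ (FP x)) scaler0 addr0 W'W addrC subrK.
have VV' x : V (adj V x) = x.
  rewrite VE PV' {2}V'E addrAC subrr add0r scalerN ii opprK V'E opfB opfZ.
  by rewrite (W0 _ (FP x)) scaler0 subr0 WW' addrC subrK.
exists (op_unitary V'V VV'); split.
  move=> x; change (V (V x) = U x).
  rewrite VE PV {2}VE addrAC subrr add0r ii VE opfD opfZ.
  rewrite (W0 _ (FP x)) scaler0 addr0 WWU.
  have := FF (x - P x); rewrite FP opf0 => /esym/eqP; rewrite addr_eq0 => /eqP ->.
  by rewrite opprK raddfB /= addrC subrK.
move=> A AU x; change (A (V x) = V (A x)).
have FA z : F z = 0 -> F (A z) = 0 by move=> Fz; rewrite -FC // Fz opf0.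
have AP y : A (P y) = P (A y).
  apply: (@op_eq_on_span _ _ _ (opM A P) (opM P A) (range (adj F))).
    move=> _ [z _ <-]; change (A (P (adj F z)) = P (A (adj F z))).
    by rewrite PF' F'C // PF'.
  move=> z /perpF Fz; change (A (P z) = P (A z)).
  by rewrite (P0 _ Fz) (P0 _ (FA _ Fz)) opf0.
have AW y : A (W y) = W (A y).
  apply: (@op_eq_on_span _ _ _ (opM A W) (opM W A) (range (adj F))).
    move=> _ [z _ <-]; change (A (W (adj F z)) = W (A (adj F z))).
    by rewrite WF F'C // WF FC.
  move=> z /perpF Fz; change (A (W z) = W (A z)).
  by rewrite (W0 _ Fz) (W0 _ (FA _ Fz)) opf0.
by rewrite !VE opfD opfZ opfB AP AW.
Qed.

End unitary_sqrt.

(** * Solving D T D^-1 = T^2 along a chain of subspaces *)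

Section doubling.
Variables (R : realType) (K : hilbertType R).

Definition projection (P : op K K) :=
  (forall x, adj P x = P x) /\ (forall x, P (P x) = P x).

(** T1 is T on the range of P and a square root of G off it.  The last clause
    keeps T1 compatible with the next, larger projection Q. *)
Lemma doubling_step (G T : unitary K) (P : op K K) : projection P ->
  (forall x, P (T x) = T (P x)) -> (forall x, T (T (P x)) = G (P x)) ->
  exists T1 : unitary K, [/\ forall x, T1 (T1 x) = G x,
    forall x, T1 (P x) = T (P x) &
    forall Q : op K K, (forall x, Q (G x) = G (Q x)) -> (forall x, Q (P x) = P x) ->
      (forall x, P (Q x) = P x) -> forall x, Q (T1 x) = T1 (Q x)].
Proof.
move=> [P_adj PP] PT TTP.
have PT' := comm_unitaryV PT.
(* T commutes with P and G = T^2 on the range of P, so G and its inverse preserve that range *)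
have GVP z : unitaryV G (P z) = P (unitaryV T (unitaryV T z)).
  apply: (can_inj (unitaryK G)); rewrite unitaryVK -TTP.
  by rewrite -!PT !unitaryVK.
have PG x : P (G x) = G (P x).
  apply: inner_inj => z; rewrite adjP P_adj (unitary_adj G) GVP.
  by rewrite -TTP !unitary_adj adjP P_adj.
have [V [VV Vcomm]] := unitary_sqrt G.
have PV := Vcomm _ PG; have PV' := comm_unitaryV PV.
pose T1 := opD (opM (uop T) P) (opM (uop V) (opB (@op1 _ K) P)).
have T1E x : T1 x = T (P x) + V (x - P x) by [].
have T1'E y : adj T1 y = P (unitaryV T y) + (unitaryV V y - P (unitaryV V y)).
  by rewrite -!P_adj.
have PT1 x : P (T1 x) = T (P x).
  by rewrite T1E opfD PT PP PV opfB PP subrr unitaryf0 addr0.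
have PT1' y : P (adj T1 y) = unitaryV T (P y).
  by rewrite T1'E opfD opfB !PP subrr addr0 PT'.
have T1K x : adj T1 (T1 x) = x.
  rewrite T1'E !PV' !PT' -unitaryfB PT1 unitaryK T1E addrC [_ + V _]addrC addrK.
  by rewrite unitaryK subrK.
have T1VK y : T1 (adj T1 y) = y.
  rewrite T1E PT1' unitaryVK T1'E PT' [_ + (_ - _)]addrC addrK PV' -unitaryfB.
  by rewrite unitaryVK addrC subrK.
exists (op_unitary T1K T1VK); split.
- move=> x; change (T1 (T1 x) = G x).
  rewrite T1E PT1 {1}T1E [T (P x) + _]addrC addrK TTP VV.
  by rewrite -unitaryfD addrC subrK.
- by move=> x; change (T1 (P x) = T (P x)); rewrite T1E PP subrr unitaryf0 addr0.
- move=> Q QG QP PQ x; change (Q (T1 x) = T1 (Q x)).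
  by rewrite !T1E opfD -PT QP PQ PT Vcomm // opfB QP.
Qed.

Variables (D : unitary K) (P0 : op K K).
Hypothesis P0_proj : projection P0.
Hypothesis P0_incr : forall x, D (P0 (unitaryV D (P0 x))) = P0 x.
Hypothesis P0_total :
  forall y, (forall n, P0 (iter n (unitaryV D) y) = 0) -> y = 0.

(** The projection D^n P0 D^-n onto the n-th space of the chain. *)
Fixpoint translate (n : nat) : op K K :=
  if n is m.+1 then opM (uop D) (opM (translate m) (adj (uop D))) else P0.

Lemma translateS n x : translate n.+1 x = D (translate n (unitaryV D x)).
Proof. by []. Qed.

Lemma translateE n x : translate n x = iter n D (P0 (iter n (unitaryV D) x)).
Proof.
by elim: n x => [//|n IH] x; rewrite translateS IH [iter n.+1 (unitaryV D) x]iterSr.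
Qed.

Lemma translate_proj n : projection (translate n).
Proof.
elim: n => [//|n [IH1 IH2]]; split => x.
  change (D (adj (translate n) (unitaryV D x)) = D (translate n (unitaryV D x))).
  by rewrite IH1.
by rewrite !translateS unitaryK IH2.
Qed.

Lemma translate_succ n x : translate n.+1 (translate n x) = translate n x.
Proof.
elim: n x => [|n IH] x; first exact: P0_incr.
by rewrite (translateS n.+1) (translateS n x) unitaryK IH.
Qed.

Lemma translate_mono n m x : (n <= m)%N -> translate m (translate n x) = translate n x.
Proof.
move=> /subnKC <-; elim: (m - n)%N x => [|k IH] x.
  by rewrite addn0; case: (translate_proj n).
by rewrite addnS -IH translate_succ.
Qed.

Lemma translate_mono' n m x : (n <= m)%N -> translate n (translate m x) = translate n x.
Proof.
move=> nm; apply: inner_inj => z.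
by rewrite !adjP !(translate_proj _).1 translate_mono.
Qed.

(** Iterate [doubling_step] with G = D t_n D^-1 and the n-th projection: the
    unitary t_(n+1) is a square root of D t_n D^-1 and agrees with t_n on the
    n-th space.  The t_n are therefore compatible on a dense union, and
    [isometric_extension] glues them. *)
Lemma doubling_extension (T0 : unitary K) :
  (forall x, P0 (T0 x) = T0 (P0 x)) ->
  (forall x, T0 (T0 (P0 x)) = D (T0 (unitaryV D (P0 x)))) ->
  exists T : unitary K, (forall x, T (T x) = D (T (unitaryV D x))) /\
    forall x, T (P0 x) = T0 (P0 x).
Proof.
move=> PT0 TTP0.
pose G T := unitaryM D (unitaryM T (unitaryV D)).
(* what the n-th unitary must satisfy for doubling_step to apply *)
pose inv n (T : unitary K) := (forall x, translate n (T x) = T (translate n x)) /\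
  (forall x, T (T (translate n x)) = G T (translate n x)).
pose rel n (T T1 : unitary K) := (forall x, T1 (T1 x) = G T x) /\
  (forall x, T1 (translate n x) = T (translate n x)).
have /choice [f fP] (p : nat * unitary K) :
    exists T1, inv p.1 p.2 -> inv p.1.+1 T1 /\ rel p.1 p.2 T1.
  case: p => n T /=; have [iT|niT] := pselect (inv n T); last by exists T.
  have [T1 [T1G T1P T1C]] := doubling_step (translate_proj n) iT.1 iT.2.
  exists T1 => _; split; last by split.
  split=> x; last first.
    by rewrite T1G translateS /= !unitaryK T1P.
  apply: T1C => [{}x|{}x|{}x]; first by rewrite /= !unitaryK iT.1.
    exact: translate_succ.
  by apply: translate_mono'.
pose fix t n := if n is m.+1 then f (m, t m) else T0.
have t_inv n : inv n (t n).
  by elim: n => [|n IH] /=; [split | have [] := fP (n, t n) IH].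
have t_rel n : rel n (t n) (t n.+1) by have [] := fP (n, t n) (t_inv n).
(* all later unitaries agree with t n on the n-th space *)
have t_stable n m x : (n <= m)%N -> t m (translate n x) = t n (translate n x).
  move=> /subnKC <-; elim: (m - n)%N => [|k IH]; first by rewrite addn0.
  rewrite addnS -IH -{1}(@translate_mono n (n + k)) ?leq_addr // (t_rel _).2.
  by rewrite translate_mono ?leq_addr.
pose e (p : nat * K) := translate p.1 p.2.
pose e' (p : nat * K) := t p.1 (translate p.1 p.2).
have gram p q : inner (e p) (e q) = inner (e' p) (e' q).
  rewrite /e' -(t_stable p.1 (maxn p.1 q.1)) ?leq_maxl //.
  by rewrite -(t_stable q.1 (maxn p.1 q.1)) ?leq_maxr // unitary_inner.
have [W [We _ W'W WW']] := isometric_extension gram.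
have {}We n x : W (translate n x) = t n (translate n x) by exact: (We (n, x)).
have e_total y : perp (range e) y -> y = 0.
  move=> ye; apply: P0_total => n.
  have : translate n y = 0.
    by apply: inner_xx0; rewrite adjP (translate_proj n).1; apply: ye; exists (n, translate n y).
  rewrite translateE; elim: n (P0 _) => [//|k IH] z /= Dz.
  by apply: IH; rewrite -[LHS](unitaryK D) Dz unitaryf0.
have e'_total y : perp (range e') y -> y = 0.
  move=> ye; apply: e_total => _ [[n x] _ <-]; rewrite /e /=.
  rewrite -[x](unitaryVK (t n)) (t_inv n).1.
  by apply: ye; exists (n, unitaryV (t n) x).
have WK x : adj W (W x) = x.
  by rewrite W'W span_proj_id // => m /e_total ->; rewrite inner0r.
have WVK x : W (adj W x) = x.
  by rewrite WW' span_proj_id // => m /e'_total ->; rewrite inner0r.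
exists (op_unitary WK WVK); split; last by move=> x; exact: (We 0%N).
apply: (@op_eq_on_total _ _ _ (opM W W) (opM (uop D) (opM W (adj (uop D)))) (range e)).
  exact: e_total.
move=> _ [[n x] _ <-]; rewrite /e /= -translate_succ; move: (translate n x) => z.
change (W (W (translate n.+1 z)) = D (W (unitaryV D (translate n.+1 z)))).
rewrite We -(t_inv n.+1).1 We (t_inv n.+1).1 (t_rel n).1.
by rewrite translateS unitaryK We /= unitaryK.
Qed.

End doubling.

(** * Unordered sums and square-summable families *)

Section complex_complete.
Variable R : realType.
Local Notation C := R[i].

Lemma norm_complex_i : `|'i%C : C| = 1.
Proof. by rewrite normc_def /= expr0n /= add0r expr1n sqrtr1. Qed.

Lemma norm_complex_le (z : C) :
  `|z| <= (`|complex.Re z| + `|complex.Im z|)%:C.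
Proof.
rewrite [X in `|X|]complexE; apply: le_trans (ler_normD _ _) _.
rewrite rmorphD /= normrM norm_complex_i mul1r !normc_def /= !expr0n /= !addr0.
by rewrite !sqrtr_sqr.
Qed.

Lemma norm_complex_ge_Im (z : C) : `|complex.Im z|%:C <= `|z|.
Proof.
have := normc_ge_Re (z * 'i%C).
by rewrite ReiNIm normrN normrM norm_complex_i mulr1.
Qed.

(** Real and imaginary parts are Cauchy in R. *)
Lemma complex_complete (F : set_system C^o) : ProperFilter F -> cauchy F -> cvg F.
Proof.
move=> FF Fc.
have part (f : C -> R) : (forall x y, f (x - y) = f x - f y) ->
    (forall z, `|f z|%:C <= `|z|) -> cvg ((f : C^o -> R^o) @ F).
  move=> fB f1; apply: cauchy_cvg; apply/cauchy_ballP => e e0.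
  have e0' : 0 < e%:C :> C by rewrite ltcR.
  move/cauchy_ballP : Fc => /(_ _ e0') [[A B] [/= FA FB] AB].
  exists (f @` A, f @` B) => /=.
    split; rewrite /nbhs /=.
      by apply: filterS FA => p Ap /=; exists p.
    by apply: filterS FB => p Bp /=; exists p.
  move=> [_ _] [/= [p Ap <-] [q Bq <-]].
  have := AB (p, q) (conj Ap Bq); rewrite /= -!ball_normE /= => pq.
  by rewrite -ltcR -fB; apply: le_lt_trans (f1 _) pq.
have F1 := part (@complex.Re R) (raddfB _) (@normc_ge_Re R).
have F2 := part (@complex.Im R) (raddfB _) norm_complex_ge_Im.
apply/cvg_ex; set a := lim _ in F1; set b := lim _ in F2.
exists ((a +i* b)%C : C^o); apply/cvgrPdist_lt => e e0.
have [eE r0] := complex_gt0P e0; set r := complex.Re e in eE r0.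
have r2 : 0 < r / 2 by rewrite divr_gt0.
move/cvgrPdist_lt : F1 => /(_ _ r2) n1.
move/cvgrPdist_lt : F2 => /(_ _ r2) n2.
near=> p; apply: le_lt_trans (norm_complex_le _) _; rewrite eE ltcR.
rewrite [r]splitr; apply: ltrD.
  by rewrite (raddfB (@complex.Re R)) /=; near: p; exact: n1.
by rewrite (raddfB (@complex.Im R)) /=; near: p; exact: n2.
Unshelve. all: by end_near. Qed.

End complex_complete.

#[global] Existing Instance summability.totally_filter.

Section unordered_sums.
Variables (R : realType) (I : choiceType).
Local Notation C := R[i].
Import finmap.
Local Notation totally := (@summability.totally I).

Lemma partial_sumE (V : zmodType) (u : I -> V) (F : {fset I}) :
  summability.partial_sum u F = \sum_(i <- F) u i.
Proof. by rewrite big_seq_fsetE. Qed.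

Lemma near_totally (F0 : {fset I}) : \forall F \near totally, (F0 `<=` F)%fset.
Proof. by exists F0. Qed.

Lemma sum_fsetD (V : zmodType) (u : I -> V) (F G : {fset I}) : (F `<=` G)%fset ->
  \sum_(i <- G) u i = \sum_(i <- F) u i + \sum_(i <- (G `\` F)%fset) u i.
Proof.
move=> FG; rewrite (big_fsetID _ (mem F)); congr (_ + _); apply: eq_fbigl => i.
  by rewrite !inE /=; apply: andb_idl; exact: (fsubsetP FG).
by rewrite !inE /= andbC.
Qed.

Lemma sum_tail_small (r : I -> R) (M : R) : (forall i, 0 <= r i) ->
  (forall F : {fset I}, \sum_(i <- F) r i <= M) ->
  forall d, 0 < d -> exists F0 : {fset I}, forall F, (F0 `<=` F)%fset ->
    \sum_(i <- (F `\` F0)%fset) r i < d.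
Proof.
move=> r0 rM d d0.
pose D := range (fun F : {fset I} => \sum_(i <- F) r i).
have D_sup : has_sup D.
  by split; [exists (\sum_(i <- fset0%fset) r i), fset0%fset | exists M => _ [F _ <-]].
have [_ [F0 _ <-] lt] := sup_adherent d0 D_sup.
exists F0 => F F0F.
have : \sum_(i <- F) r i <= sup D by apply: ub_le_sup; [case: D_sup | exists F].
by rewrite (sum_fsetD _ F0F); lra.
Qed.

(** Unconditional convergence of u when its finite sums are small as soon as
    those of a nonnegative summable family r are.  Smallness of finite sums,
    instead of termwise domination, covers the series of a frame expansion. *)
Lemma dominated_sum_cvg (V : normedModType C) (u : I -> V) (r : I -> R) (M : R) :
  complete_space V -> (forall i, 0 <= r i) ->
  (forall F : {fset I}, \sum_(i <- F) r i <= M) ->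
  (forall e : R, 0 < e -> exists2 d, 0 < d & forall F : {fset I},
     \sum_(i <- F) r i < d -> `|\sum_(i <- F) u i| < e%:C) ->
  cvg (summability.partial_sum u @ totally).
Proof.
move=> Vc r0 rM ru; apply: cvg_of_near => // e e0.
have [d d0 hd] := ru e e0.
have [F0 hF0] := sum_tail_small r0 rM d0.
exists (\sum_(i <- F0) u i); apply: filterS (near_totally F0) => F F0F.
rewrite partial_sumE (sum_fsetD _ F0F) opprD addNKr normrN.
exact/hd/hF0.
Qed.

(** The real number |z|^2; the modulus itself is complex-valued here. *)
Definition sq_modulus (z : C) : R := complex.Re (`|z| ^+ 2).

Lemma sq_modulusE z : (sq_modulus z)%:C = `|z| ^+ 2.
Proof. by have [<-] := complex_ge0P (exprn_ge0 2 (normr_ge0 z)). Qed.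

Lemma sq_modulus_ge0 z : 0 <= sq_modulus z.
Proof. by rewrite -lecR sq_modulusE exprn_ge0. Qed.

Definition l2 (x : I -> C) : Prop :=
  exists M : R, forall F : {fset I}, \sum_(i <- F) sq_modulus (x i) <= M.

Definition l2_inner (x y : I -> C) : C :=
  lim ((summability.partial_sum (fun i => x i * Num.conj (y i)) : {fset I} -> C^o)
    @ totally).

Lemma l2_inner_cvg x y : l2 x -> l2 y ->
  (summability.partial_sum (fun i => x i * Num.conj (y i)) : {fset I} -> C^o)
    @ totally --> (l2_inner x y : C^o).
Proof.
move=> [M xM] [N yN].
apply: (@dominated_sum_cvg C^o _ (fun i => sq_modulus (x i) + sq_modulus (y i)) (M + N)).
- exact: complex_complete.
- by move=> i; rewrite addr_ge0 // sq_modulus_ge0.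
- by move=> F; rewrite big_split /= lerD.
move=> e e0; exists e => // F lt.
apply: le_lt_trans (ler_norm_sum _ _ _) _.
rewrite -ltcR in lt; apply: le_lt_trans lt; rewrite rmorph_sum /=.
apply: ler_sum => i _; rewrite normrM norm_conjC rmorphD /= !sq_modulusE.
have : 0 <= (`|x i| - `|y i|) ^+ 2 by rewrite real_exprn_even_ge0 // rpredB // normr_real.
have : 0 <= `|x i| * `|y i| by rewrite mulr_ge0.
move: `|x i| `|y i| => a b ab0 /(addr_ge0 ab0); rewrite -subr_ge0; congr (_ <= _).
ring.
Qed.

End unordered_sums.

(** * The inner product of square-summable families *)

Section ip_theory.
Variables (R : realType) (I : choiceType).
Local Notation C := R[i].
Implicit Types x y z : I -> C.
Local Notation totally := (@summability.totally I).
Local Notation psum u := (summability.partial_sum u : {fset I} -> C^o).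

(** The order on complex numbers is partial; nonnegativity is expressed as
    equality with the modulus, which passes to limits. *)
Lemma cvg_complex_ge0 (T : Type) (F : set_system T) {FF : ProperFilter F}
    (u : T -> C^o) (l : C^o) : u @ F --> l ->
  (\forall t \near F, 0 <= (u t : C)) -> 0 <= (l : C).
Proof.
move=> ul u0.
have h : (fun t => `|u t| : C^o) @ F --> (`|l| : C^o).
  apply: (cvg_lipschitz (A := fun z : C^o => `|z| : C^o) ler01 _ ul) => a b.
  by rewrite mul1r; exact: ler_dist_dist.
have h' : u @ F --> (`|l| : C^o).
  apply: cvg_trans h; apply: near_eq_cvg.
  by apply: filterS u0 => t t0; rewrite ger0_norm.
by rewrite (normed_cvg_unique (V := C^o) ul h').
Qed.

Lemma l20 : l2 (fun _ : I => 0 : C).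
Proof.
by exists 0 => F; rewrite big1 // => i _; rewrite /sq_modulus normr0 expr0n.
Qed.

Lemma l2D x y : l2 x -> l2 y -> l2 (fun i => x i + y i).
Proof.
move=> [M xM] [N yN]; exists (2 * M + 2 * N) => F.
apply: (@le_trans _ _ (2 * \sum_(i <- F) sq_modulus (x i) + 2 * \sum_(i <- F) sq_modulus (y i))).
  rewrite !mulr_sumr -big_split /=; apply: ler_sum => i _.
  rewrite !mulr_natl -lecR [leRHS]rmorphD !rmorphMn /= !sq_modulusE.
  apply: (@le_trans _ _ ((`|x i| + `|y i|) ^+ 2)).
    by rewrite ler_pXn2r ?nnegrE ?addr_ge0 // ler_normD.
  have : 0 <= (`|x i| - `|y i|) ^+ 2.
    by rewrite real_exprn_even_ge0 // rpredB // normr_real.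
  rewrite -subr_ge0 => h; rewrite -subr_ge0; apply: le_trans h _.
  by rewrite le_eqVlt; apply/orP; left; apply/eqP; ring.
by rewrite lerD // ler_pM2l.
Qed.

Lemma l2Z k x : l2 x -> l2 (fun i => k * x i).
Proof.
move=> [M xM]; exists (sq_modulus k * M) => F.
have -> : \sum_(i <- F) sq_modulus (k * x i) = sq_modulus k * \sum_(i <- F) sq_modulus (x i).
  rewrite mulr_sumr; apply: eq_bigr => i _; apply: complexI.
  by rewrite rmorphM /= !sq_modulusE normrM exprMn.
by rewrite ler_wpM2l // sq_modulus_ge0.
Qed.

Lemma l2_inner_unique x y l : l2 x -> l2 y ->
  psum (fun i => x i * Num.conj (y i)) @ totally --> (l : C^o) -> l2_inner x y = l.
Proof.
by move=> x2 y2; exact: (normed_cvg_unique (V := C^o) (l2_inner_cvg x2 y2)).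
Qed.

Lemma l2_innerDl x y z : l2 x -> l2 y -> l2 z ->
  l2_inner (fun i => x i + y i) z = l2_inner x z + l2_inner y z.
Proof.
move=> x2 y2 z2; apply: l2_inner_unique => //; first exact: l2D.
have e F : psum (fun i => (x i + y i) * Num.conj (z i)) F =
    psum (fun i => x i * Num.conj (z i)) F + psum (fun i => y i * Num.conj (z i)) F.
  by rewrite !partial_sumE -big_split; apply: eq_bigr => i _; rewrite mulrDl.
rewrite (eq_cvg _ _ e); exact: cvgD (l2_inner_cvg x2 z2) (l2_inner_cvg y2 z2).
Qed.

Lemma l2_innerZl k x y : l2 x -> l2 y -> l2_inner (fun i => k * x i) y = k * l2_inner x y.
Proof.
move=> x2 y2; apply: l2_inner_unique => //; first exact: l2Z.
have e F : psum (fun i => k * x i * Num.conj (y i)) F =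
    k *: psum (fun i => x i * Num.conj (y i)) F.
  rewrite !partial_sumE scaler_sumr.
  by apply: eq_bigr => i _; rewrite -mulrA.
rewrite (eq_cvg _ _ e); exact: cvgZr (l2_inner_cvg x2 y2).
Qed.

Lemma l2_innerC x y : l2 x -> l2 y -> l2_inner x y = Num.conj (l2_inner y x).
Proof.
move=> x2 y2; apply: l2_inner_unique => //.
have e F : psum (fun i => x i * Num.conj (y i)) F =
    Num.conj (psum (fun i => y i * Num.conj (x i)) F).
  rewrite !partial_sumE rmorph_sum; apply: eq_bigr => i _.
  by rewrite rmorphM /= conjCK mulrC.
rewrite (eq_cvg _ _ e).
apply: (cvg_lipschitz (A := fun z : C^o => Num.conj (z : C) : C^o) ler01 _ (l2_inner_cvg y2 x2)).
by move=> a b; rewrite mul1r -rmorphB norm_conjC.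
Qed.

Lemma l2_innerBr x y z : l2 x -> l2 y -> l2 z ->
  l2_inner x (fun i => y i - z i) = l2_inner x y - l2_inner x z.
Proof.
move=> x2 y2 z2; have n2 := l2Z (-1) z2.
have -> : (fun i => y i - z i) = (fun i => y i + -1 * z i).
  by apply/funext => i; rewrite mulN1r.
rewrite (l2_innerC x2 (l2D y2 n2)) (l2_innerDl y2 n2 x2) (l2_innerZl _ z2 x2) mulN1r rmorphB /=.
by rewrite -!l2_innerC.
Qed.

Lemma l2_partial_sum_selfE x (F : {fset I}) : psum (fun i => x i * Num.conj (x i)) F = (\sum_(i <- F) sq_modulus (x i))%:C.
Proof.
rewrite partial_sumE rmorph_sum; apply: eq_bigr => i _.
by rewrite [RHS]sq_modulusE normCK.
Qed.

Lemma l2_inner_ge0 x : l2 x -> 0 <= l2_inner x x.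
Proof.
move=> x2; apply: (cvg_complex_ge0 (l2_inner_cvg x2 x2)); apply: nearW => F.
by rewrite l2_partial_sum_selfE lecR sumr_ge0 // => i _; exact: sq_modulus_ge0.
Qed.

(** Restrict the net to the finite sets containing F: along it the partial
    sums minus the one over F are nonnegative. *)
Lemma sum_le_l2_inner x (F : {fset I}) : l2 x -> (\sum_(i <- F) sq_modulus (x i))%:C <= l2_inner x x.
Proof.
move=> x2; rewrite -subr_ge0.
have h := l2_inner_cvg x2 x2.
have h2 : (fun G : {fset I} => psum (fun i => x i * Num.conj (x i)) (F `|` G)%fset) @ totally
    --> (l2_inner x x : C^o).
  move=> A /h /= [F0 _ F0A]; exists F0 => // G /= F0G.
  by apply: F0A => /=; apply: fsubset_trans F0G _; exact: fsubsetUr.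
pose a : C^o := (\sum_(i <- F) sq_modulus (x i))%:C.
have hc : (fun _ : {fset I} => a) @ totally --> a by exact: cvg_cst.
pose proof (h3 := cvgB h2 hc).
pose proof (h4 := cvg_complex_ge0 h3); apply: h4; apply: nearW => G.
change (0 <= (psum (fun i => x i * Num.conj (x i)) (F `|` G)%fset : C) - a).
rewrite /a l2_partial_sum_selfE -rmorphB lecR (sum_fsetD _ (fsubsetUl F G)) addrAC subrr add0r.
by rewrite sumr_ge0 // => i _; exact: sq_modulus_ge0.
Qed.

Lemma l2_inner_le x (M : R) : (forall F : {fset I}, \sum_(i <- F) sq_modulus (x i) <= M) ->
  l2_inner x x <= M%:C.
Proof.
move=> xM; have x2 : l2 x by exists M.
rewrite -subr_ge0.
pose a : C^o := M%:C.
have hc : (fun _ : {fset I} => a) @ totally --> a by exact: cvg_cst.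
pose proof (h3 := cvgB hc (l2_inner_cvg x2 x2)).
pose proof (h4 := cvg_complex_ge0 h3); apply: h4; apply: nearW => F.
change (0 <= a - (psum (fun i => x i * Num.conj (x i)) F : C)).
by rewrite /a l2_partial_sum_selfE -rmorphB lecR subr_ge0.
Qed.

Lemma norm_le_l2_inner x i : l2 x -> `|x i| ^+ 2 <= l2_inner x x.
Proof.
move=> x2; apply: le_trans (sum_le_l2_inner [fset i]%fset x2).
by rewrite big_seq_fset1 sq_modulusE.
Qed.

Lemma l2_inner_eq0 x : l2 x -> l2_inner x x = 0 -> forall i, x i = 0.
Proof.
move=> x2 x0 i; have := norm_le_l2_inner i x2; rewrite x0 => h.
have : `|x i| ^+ 2 == 0 by rewrite eq_le h exprn_ge0.
by rewrite sqrf_eq0 normr_eq0 => /eqP.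
Qed.

Definition unit_vector (j i : I) : C := (i == j)%:R.

Lemma l2_unit_vector j : l2 (unit_vector j).
Proof.
exists 1 => F; have [jF|jF] := boolP (j \in F).
  rewrite (big_fsetD1 j) //= big1_fset ?addr0 /unit_vector ?eqxx ?/sq_modulus ?normr1 ?expr1n //.
  by move=> i; rewrite !inE => /andP[/negPf -> _] _; rewrite normr0 expr0n.
rewrite big1_fset // => i iF _; rewrite /unit_vector.
by case: eqP => [ij|_]; [rewrite -ij iF in jF | rewrite /sq_modulus normr0 expr0n].
Qed.

Lemma l2_inner_unit_vector x j : l2 x -> l2_inner x (unit_vector j) = x j.
Proof.
move=> x2; apply: l2_inner_unique => //; first exact: l2_unit_vector.
have e : \forall F \near totally,
    x j = psum (fun i => x i * Num.conj (unit_vector j i)) F.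
  apply: filterS (near_totally [fset j]%fset) => F; rewrite fsub1set => jF.
  rewrite partial_sumE (big_fsetD1 j) //= big1_fset /unit_vector ?eqxx ?conjC1 ?mulr1 ?addr0 //.
  by move=> i; rewrite !inE => /andP[/negPf -> _] _; rewrite conjC0 mulr0.
have hc : (fun _ : {fset I} => x j : C^o) @ totally --> (x j : C^o) by exact: cvg_cst.
by apply: cvg_trans hc; exact: near_eq_cvg.
Qed.

End ip_theory.

(** * Annihilators in l2 as Hilbert spaces *)

(** The type of the Hilbert space below depends on the family, so the proof of
    square summability has to travel with it. *)
Record l2_family (R : realType) (I : choiceType) (J : Type) := L2Family {
  l2_fam :> J -> I -> R[i] ;
  l2_famP : forall j, l2 (l2_fam j) }.

Section annihilator.
Variables (R : realType) (I : choiceType) (J : Type) (v : l2_family R I J).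
Local Notation C := R[i].

(** The orthogonal complement in l2 of the vectors v j.  With an empty index
    type J it is l2 itself. *)
Definition ann_pred : {pred I -> C^o} :=
  fun x => `[< l2 (x : I -> C) /\ forall j, l2_inner (x : I -> C) (v j) = 0 >].

Fact ann_submod : submod_closed ann_pred.
Proof.
have ip0 j : l2_inner (fun _ : I => 0 : C) (v j) = 0.
  have e : (fun _ : I => 0 : C) = (fun i => 0 * v j i).
    by apply/funext => i; rewrite mul0r.
  by rewrite e l2_innerZl ?mul0r //; exact: l2_famP.
split; first by apply/asboolP; split; [exact: l20 | exact: ip0].
move=> k x y /asboolP[x2 xv] /asboolP[y2 yv]; apply/asboolP.
have kx2 := l2Z k x2; split; first exact: (l2D kx2 y2).
move=> j; have vj := l2_famP v j.
by rewrite [LHS](l2_innerDl kx2 y2 vj) (l2_innerZl k x2 vj) xv yv mulr0 addr0.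
Qed.
HB.instance Definition _ := GRing.isSubmodClosed.Build C (I -> C^o) ann_pred
  (GRing.submod_closed_semi ann_submod).

Record annihilator := Annihilator {
  ann_val : I -> C^o ; ann_valP : ann_val \in ann_pred }.

HB.instance Definition _ := [isSub for ann_val].
HB.instance Definition _ := [Choice of annihilator by <:].
HB.instance Definition _ := [SubChoice_isSubLmodule of annihilator by <:].

Implicit Types p q : annihilator.

Lemma ann_l2 p : l2 (ann_val p : I -> C).
Proof. by have /asboolP[] := ann_valP p. Qed.

Lemma ann_orthogonal p j : l2_inner (ann_val p : I -> C) (v j) = 0.
Proof. by have /asboolP[_] := ann_valP p; apply. Qed.

Definition ann_inner p q : C := l2_inner (ann_val p) (ann_val q).

Lemma ann_innerDl p q r : ann_inner (p + q) r = ann_inner p r + ann_inner q r.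
Proof. exact: l2_innerDl (ann_l2 p) (ann_l2 q) (ann_l2 r). Qed.

Lemma ann_innerZl k p q : ann_inner (k *: p) q = k * ann_inner p q.
Proof. exact: l2_innerZl (ann_l2 p) (ann_l2 q). Qed.

Lemma ann_innerC p q : ann_inner p q = Num.conj (ann_inner q p).
Proof. exact: l2_innerC (ann_l2 p) (ann_l2 q). Qed.

Lemma ann_inner_ge0 p : 0 <= ann_inner p p.
Proof. exact: l2_inner_ge0 (ann_l2 p). Qed.

Lemma ann_cauchy_schwarz p q :
  `|ann_inner p q| ^+ 2 <= ann_inner p p * ann_inner q q.
Proof.
exact: (form_cauchy_schwarz ann_innerDl ann_innerZl ann_innerC ann_inner_ge0).
Qed.

End annihilator.

Section ann_normed.
Variables (R : realType) (I : choiceType) (J : Type) (v : l2_family R I J).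
Local Notation C := R[i].
Local Notation K := (annihilator v).
Implicit Types p q : K.

Definition ann_norm p : C := sqrtC (ann_inner p p).

Let ann_norm_ge0 p : 0 <= ann_norm p.
Proof. by rewrite sqrtC_ge0 ann_inner_ge0. Qed.

Let ann_normE p : ann_norm p ^+ 2 = ann_inner p p.
Proof. by rewrite sqrtCK. Qed.

Let ann_ler_normD p q : ann_norm (p + q) <= ann_norm p + ann_norm q.
Proof.
rewrite -(@ler_pXn2r _ 2) ?nnegrE ?addr_ge0 // ann_normE.
set c := ann_inner p q.
have -> : ann_inner (p + q) (p + q) = ann_inner p p + (c + Num.conj c) + ann_inner q q.
  rewrite ann_innerDl ![ann_inner _ (p + q)]ann_innerC !ann_innerDl !rmorphD /=.
  by rewrite -!ann_innerC /c; ring.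
rewrite sqrrD !ann_normE lerD2r lerD2l.
have cr : c + Num.conj c \is Num.real by rewrite CrealE rmorphD /= conjCK addrC.
apply: le_trans (real_ler_norm cr) _; apply: le_trans (ler_normD _ _) _.
rewrite norm_conjC -mulr2n lerMn2r /=.
rewrite -(@ler_pXn2r _ 2) ?nnegrE ?mulr_ge0 // exprMn !ann_normE.
exact: ann_cauchy_schwarz.
Qed.

Let ann_normrZ (k : C) p : ann_norm (k *: p) = `|k| * ann_norm p.
Proof.
apply/eqP; rewrite -(@eqrXn2 _ 2) ?mulr_ge0 // exprMn !ann_normE.
rewrite ann_innerZl ann_innerC ann_innerZl rmorphM /= -ann_innerC mulrA.
by rewrite -normCK.
Qed.

Let ann_normr0_eq0 p : ann_norm p = 0 -> p = 0.
Proof.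
move=> p0; have := ann_normE p; rewrite p0 expr0n /= => /esym h.
by apply: val_inj; apply/funext => i; exact: (l2_inner_eq0 (ann_l2 p) h).
Qed.

HB.instance Definition _ := Lmodule_isNormed.Build C K
  ann_ler_normD ann_normrZ ann_normr0_eq0.

Lemma ann_norm_sq p : `|p| ^+ 2 = ann_inner p p.
Proof. exact: ann_normE. Qed.

Lemma ann_coord_le p i : `|ann_val p i : C| <= `|p|.
Proof.
by rewrite -(@ler_pXn2r _ 2) ?nnegrE // ann_norm_sq; exact: norm_le_l2_inner (ann_l2 p).
Qed.

(** l2 is the annihilator of the empty family, where the general inequality
    for positive forms applies. *)
Lemma l2_cauchy_schwarz (x y : I -> C) : l2 x -> l2 y ->
  `|l2_inner x y| ^+ 2 <= l2_inner x x * l2_inner y y.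
Proof.
move=> x2 y2.
have [w _] : exists w : l2_family R I void, True.
  by exists (@L2Family R I void (fun=> fun=> 0) (fun=> l20 _ _)).
have xP : (x : I -> C^o) \in ann_pred w by apply/asboolP; split => // -[].
have yP : (y : I -> C^o) \in ann_pred w by apply/asboolP; split => // -[].
exact: (ann_cauchy_schwarz (Annihilator xP) (Annihilator yP)).
Qed.

(** The coordinates converge to some l.  Finite sums of |p_i - l_i|^2 are
    limits of finite sums of |p_i - q_i|^2, hence bounded by e^2 uniformly for
    p in a small set; so l is square-summable, p tends to l in norm, and
    orthogonality to the v j survives by Cauchy-Schwarz. *)
Lemma ann_complete (F : set_system K) : ProperFilter F -> cauchy F -> cvg F.
Proof.
move=> FF Fc.
have coord i : cvg ((fun p : K => ann_val p i : C^o) @ F).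
  apply: complex_complete; apply/cauchy_ballP => e e0.
  move/cauchy_ballP : Fc => /(_ e e0) [[A B] [/= FA FB] AB].
  exists ((fun p : K => ann_val p i) @` A, (fun p : K => ann_val p i) @` B) => /=.
    split; rewrite /nbhs /=.
      by apply: filterS FA => p Ap /=; exists p.
    by apply: filterS FB => p Bp /=; exists p.
  move=> [_ _] [/= [p Ap <-] [q Bq <-]].
  have := AB (p, q) (conj Ap Bq); rewrite /= -!ball_normE /=.
  by apply: le_lt_trans; exact: (ann_coord_le (p - q) i).
pose l i : C := lim ((fun p : K => ann_val p i : C^o) @ F).
have sq_cvg p i : (fun q : K => (sq_modulus (ann_val p i - ann_val q i))%:C : C^o) @ F -->
    ((sq_modulus (ann_val p i - l i))%:C : C^o).
  have hc : (fun _ : K => ann_val p i : C^o) @ F --> (ann_val p i : C^o).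
    exact: cvg_cst.
  pose proof (h1 := cvg_norm (cvgB hc (coord i))).
  pose proof (h2 := cvgM h1 h1).
  rewrite sq_modulusE expr2; apply: cvg_trans h2.
  by apply: near_eq_cvg; apply: nearW => q; rewrite sq_modulusE expr2.
have sum_cvg p (G : {fset I}) :
   (fun q : K => (\sum_(i <- G) sq_modulus (ann_val p i - ann_val q i))%:C : C^o) @ F -->
    ((\sum_(i <- G) sq_modulus (ann_val p i - l i))%:C : C^o).
  elim: (G : seq I) => [|i s IH].
    have hc : (fun _ : K => 0%:C : C^o) @ F --> (0%:C : C^o) by exact: cvg_cst.
    rewrite big_nil; apply: cvg_trans hc; apply: near_eq_cvg.
    by apply: nearW => q; rewrite big_nil.
  rewrite big_cons rmorphD /=.
  have e q : (\sum_(i <- i :: s) sq_modulus (ann_val p i - ann_val q i))%:C =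
      ((sq_modulus (ann_val p i - ann_val q i))%:C : C^o) +
      (\sum_(i <- s) sq_modulus (ann_val p i - ann_val q i))%:C.
    by rewrite big_cons rmorphD.
  rewrite (eq_cvg _ _ e); exact: cvgD (sq_cvg p i) IH.
have near_sum (e : R) : 0 < e -> \forall p \near F, forall G : {fset I},
    \sum_(i <- G) sq_modulus (ann_val p i - l i) <= e ^+ 2.
  move=> e0; have e0' : 0 < e%:C :> C by rewrite ltcR.
  move/cauchy_ballP : Fc => /(_ _ e0') [[A B] [/= FA FB] AB].
  apply: filterS FA => p Ap G; rewrite -lecR -subr_ge0.
  pose a : C^o := (e ^+ 2)%:C.
  have hc : (fun _ : K => a) @ F --> a by exact: cvg_cst.
  pose proof (h1 := cvgB hc (sum_cvg p G)).
  pose proof (h2 := cvg_complex_ge0 h1); apply: h2.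
  apply: filterS FB => q Bq.
  change (0 <= (e ^+ 2)%:C - (\sum_(i <- G) sq_modulus (ann_val p i - ann_val q i))%:C :> C).
  rewrite subr_ge0; apply: le_trans (sum_le_l2_inner G (ann_l2 (p - q))) _.
  have := AB (p, q) (conj Ap Bq); rewrite /= -!ball_normE /= => pq.
  rewrite -[leLHS]/(ann_inner (p - q) (p - q)) -ann_norm_sq rmorphXn /=.
  by rewrite ler_pXn2r ?nnegrE ?(ltW e0') // ltW.
(* l = p - (p - l), to transfer properties from p to l *)
have l_dec p (M : R) :
    (forall G : {fset I}, \sum_(i <- G) sq_modulus (ann_val p i - l i) <= M) ->
    l2 l /\ forall y : I -> C, l2 y ->
      l2_inner l y = l2_inner (ann_val p) y - l2_inner (fun i => ann_val p i - l i) y.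
  move=> pM; have pl2 : l2 (fun i => ann_val p i - l i) by exists M.
  have n2 := l2Z (-1) pl2; have p2 := ann_l2 p.
  have -> : l = (fun i => ann_val p i + -1 * (ann_val p i - l i)).
    by apply/funext => i; rewrite mulN1r opprB addrC subrK.
  split; first exact: (l2D p2 n2).
  move=> y y2; rewrite (l2_innerDl p2 n2 y2) (l2_innerZl _ pl2 y2) mulN1r.
  congr (_ - l2_inner _ _); apply/funext => i; rewrite mulN1r opprB; ring.
have [p0 p0P] := filter_ex (near_sum 1 ltr01).
have [l_l2 _] := l_dec p0 _ p0P.
have l_ip j : l2_inner l (v j) = 0.
  have vj := l2_famP v j.
  have [nE n0] := complex_ge0P (l2_inner_ge0 vj); set n := complex.Re _ in nE n0.
  apply/eqP; rewrite -normr_eq0 -sqrf_eq0 -sq_modulusE -(rmorph0 (real_complex R)).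
  rewrite (inj_eq (@complexI _)) eq_le sq_modulus_ge0 andbT; apply/ler_addgt0Pr => d d0.
  have n1 : 0 < n + 1 by rewrite ltr_wpDl.
  have dn : 0 < d / (n + 1) by rewrite divr_gt0.
  have e0 : 0 < Num.sqrt (d / (n + 1)) by rewrite sqrtr_gt0.
  have [p pP] := filter_ex (near_sum _ e0).
  rewrite sqr_sqrtr ?(ltW dn) // in pP.
  have [_ /(_ _ vj)] := l_dec p _ pP; rewrite ann_orthogonal sub0r => ->.
  have pl2 : l2 (fun i => ann_val p i - l i) by exists (d / (n + 1)).
  rewrite add0r -lecR sq_modulusE normrN; apply: le_trans (l2_cauchy_schwarz pl2 vj) _.
  rewrite nE; apply: le_trans (ler_wpM2r _ (l2_inner_le pP)) _; first by rewrite lecR.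
  rewrite -rmorphM lecR mulrAC ler_pdivrMr // ler_pM2l // lerDl ler01 //.
have lP : (l : I -> C^o) \in ann_pred v by apply/asboolP.
apply/cvg_ex; exists (Annihilator lP : K); apply/cvgrPdist_lt => e e0.
have [eE r0] := complex_gt0P e0; set r := complex.Re e in eE r0.
have r2 : 0 < r / 2 by rewrite divr_gt0.
apply: filterS (near_sum _ r2) => p pP; rewrite distrC eE.
apply: (@le_lt_trans _ _ (r / 2)%:C); last by rewrite ltcR; lra.
rewrite -(@ler_pXn2r _ 2) ?nnegrE ?lecR ?(ltW r2) // ann_norm_sq -rmorphXn.
exact: l2_inner_le pP.
Qed.

HB.instance Definition _ := Uniform_isComplete.Build K ann_complete.

Let ann_inner_normE p : ann_inner p p = `|p| ^+ 2.
Proof. by rewrite ann_norm_sq. Qed.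

HB.instance Definition _ := NormedModule_isHilbert.Build R K
  (@ann_innerDl _ _ _ v) (@ann_innerZl _ _ _ v) (@ann_innerC _ _ _ v) ann_inner_normE.

End ann_normed.

(** * Frames and the frame operator *)

Section finite_cauchy_schwarz.
Variables (R : realType) (I : choiceType).
Local Notation C := R[i].

Lemma sum_cauchy_schwarz (x y : I -> C) (F : {fset I}) :
  `|\sum_(i <- F) x i * y i| ^+ 2 <=
    (\sum_(i <- F) sq_modulus (x i))%:C * (\sum_(i <- F) sq_modulus (y i))%:C.
Proof.
pose f (u w : I -> C^o) : C := \sum_(i <- F) u i * Num.conj (w i : C).
have fuu u : f u u = (\sum_(i <- F) sq_modulus (u i))%:C.
  by rewrite rmorph_sum; apply: eq_bigr => i _; rewrite [RHS]sq_modulusE normCK.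
have -> : \sum_(i <- F) x i * y i = f x (fun i => Num.conj (y i)).
  by apply: eq_bigr => i _; rewrite conjCK.
have -> : \sum_(i <- F) sq_modulus (y i) = \sum_(i <- F) sq_modulus (Num.conj (y i)).
  by apply: eq_bigr => i _; apply: complexI; rewrite !sq_modulusE norm_conjC.
rewrite -fuu -(fuu (fun i => Num.conj (y i))).
apply: form_cauchy_schwarz => [u w z|k u w|u w|u].
- by rewrite /f -big_split; apply: eq_bigr => i _; rewrite mulrDl.
- by rewrite /f mulr_sumr; apply: eq_bigr => i _; rewrite mulrA.
- rewrite /f rmorph_sum; apply: eq_bigr => i _.
  by rewrite rmorphM /= conjCK mulrC.
- by rewrite fuu lecR sumr_ge0 // => i _; exact: sq_modulus_ge0.
Qed.

End finite_cauchy_schwarz.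

Section frames.
Variables (R : realType) (H : hilbertType R) (I : choiceType).
Local Notation C := R[i].
Local Notation totally := (@summability.totally I).
Implicit Types (f : I -> H) (x y : H).

Definition frame_coef f x : I -> C := fun i => inner x (f i).

Definition bessel f (b : R) := forall x (F : {fset I}),
  (\sum_(i <- F) sq_modulus (frame_coef f x i))%:C <= b%:C * `|x| ^+ 2.

Lemma norm_sq_Re x : `|x| ^+ 2 = (complex.Re (`|x| ^+ 2))%:C.
Proof. by case: (complex_ge0P (exprn_ge0 2 (normr_ge0 x))). Qed.

Lemma frame_coef_l2 f b x : bessel f b -> l2 (frame_coef f x).
Proof.
move=> fb; exists (b * complex.Re (`|x| ^+ 2)) => F.
by rewrite -lecR rmorphM /= -norm_sq_Re; exact: fb.
Qed.

Lemma fset_le_energy f x (F : {fset I}) :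
  ((\sum_(i <- F) sq_modulus (frame_coef f x i))%:E <= energy f x)%E.
Proof.
apply: esum_ge; exists [set` F]; first by split => //; exact: finite_fset.
by rewrite fsbig_finite ?set_fsetK //= sumEFin.
Qed.

Lemma energy_le f x (M : R) :
  (forall F : {fset I}, \sum_(i <- F) sq_modulus (frame_coef f x i) <= M) <->
  (energy f x <= M%:E)%E.
Proof.
split=> [h|h F].
  apply: ge_ereal_sup => _ [A [finA _] <-].
  by rewrite fsbig_finite //= sumEFin lee_fin.
by rewrite -lee_fin; apply: le_trans (fset_le_energy f x F) h.
Qed.

Lemma energyE f x : l2 (frame_coef f x) ->
  energy f x = (complex.Re (l2_inner (frame_coef f x) (frame_coef f x)))%:E.
Proof.
move=> x2; have [ipE ip0] := complex_ge0P (l2_inner_ge0 x2).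
apply/eqP; rewrite eq_le; apply/andP; split.
  apply/energy_le => F; rewrite -lecR -ipE; exact: sum_le_l2_inner.
have : (energy f x \is a fin_num).
  case: x2 => M /energy_le eM; rewrite fin_numElt; apply/andP; split.
    by apply: lt_le_trans (fset_le_energy f x fset0); rewrite ltNyr.
  by apply: le_lt_trans eM _; rewrite ltry.
move=> /fineK e; rewrite -e lee_fin -lecR -ipE; apply: l2_inner_le.
by apply/energy_le; rewrite e.
Qed.

Lemma frame_boundsP f a b : 0 < a -> a <= b ->
  frame_bounds f a b <-> bessel f b /\ forall x,
    a%:C * `|x| ^+ 2 <= l2_inner (frame_coef f x) (frame_coef f x) <= b%:C * `|x| ^+ 2.
Proof.
move=> a0 ab; split.
  move=> [_ _ h]; have fb : bessel f b.
    move=> x F; have /andP[_ /energy_le h2] := h x.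
    by rewrite norm_sq_Re -rmorphM lecR; exact: h2.
  split => // x; have := h x; rewrite (energyE (frame_coef_l2 x fb)).
  have [-> _] := complex_ge0P (l2_inner_ge0 (frame_coef_l2 x fb)).
  by rewrite /= norm_sq_Re -!rmorphM !lecR !lee_fin.
move=> [fb h]; split => // x; rewrite (energyE (frame_coef_l2 x fb)).
have := h x; have [-> _] := complex_ge0P (l2_inner_ge0 (frame_coef_l2 x fb)).
by rewrite /= norm_sq_Re -!rmorphM !lecR !lee_fin.
Qed.

(** Pair s = sum c_i f_i with itself: |s|^2 is the sum of c_i times the
    conjugates of the coefficients of s, and the Bessel bound for s cancels
    one factor |s|^2. *)
Lemma synthesis_bound f b (c : I -> C) (F : {fset I}) : bessel f b ->
  `|\sum_(i <- F) c i *: f i| ^+ 2 <= `|b|%:C * (\sum_(i <- F) sq_modulus (c i))%:C.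
Proof.
move=> fb; set s := \sum_(i <- F) _.
have [->|s0] := eqVneq s 0.
  rewrite normr0 expr0n mulr_ge0 // ?lecR // sumr_ge0 // => i _; exact: sq_modulus_ge0.
have sgt : 0 < `|s| ^+ 2 by rewrite exprn_gt0 // normr_gt0.
rewrite -(ler_pM2r sgt).
have e : `|s| ^+ 2 = \sum_(i <- F) c i * Num.conj (frame_coef f s i).
  rewrite -inner_normE {1}/s inner_suml; apply: eq_bigr => i _.
  by rewrite innerZl /frame_coef -innerC.
have := sum_cauchy_schwarz c (fun i => Num.conj (frame_coef f s i)) F.
rewrite -e ger0_norm ?exprn_ge0 // => h.
rewrite -expr2; apply: le_trans h _.
rewrite mulrAC [leRHS]mulrC; apply: ler_wpM2l.
  by rewrite lecR sumr_ge0 // => i _; exact: sq_modulus_ge0.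
have -> : \sum_(i <- F) sq_modulus (Num.conj (frame_coef f s i)) = \sum_(i <- F) sq_modulus (frame_coef f s i).
  by apply: eq_bigr => i _; apply: complexI; rewrite !sq_modulusE norm_conjC.
apply: le_trans (fb s F) _; rewrite ler_wpM2r ?exprn_ge0 // lecR ler_norm //.
Qed.

Lemma synthesis_cvg f b (c : I -> C) : bessel f b -> l2 c ->
  cvg (summability.partial_sum (fun i => c i *: f i) @ totally).
Proof.
move=> fb [M cM].
apply: (@dominated_sum_cvg _ _ _ _ (fun i => sq_modulus (c i)) M) => //.
- exact: cauchy_cvg.
- by move=> i; exact: sq_modulus_ge0.
move=> e e0; have b1 : 0 < `|b| + 1 by rewrite ltr_wpDl.
exists (e ^+ 2 / (`|b| + 1)) => [|F lt]; first by rewrite divr_gt0 // exprn_gt0.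
rewrite -(@ltr_pXn2r _ 2) ?nnegrE ?lecR ?(ltW e0) //.
apply: le_lt_trans (synthesis_bound c F fb) _.
rewrite -rmorphM -rmorphXn ltcR.
apply: (@le_lt_trans _ _ ((`|b| + 1) * \sum_(i <- F) sq_modulus (c i))).
  by rewrite ler_wpM2r ?lerDl // sumr_ge0 // => i _; exact: sq_modulus_ge0.
by rewrite mulrC -ltr_pdivlMr.
Qed.

Lemma frame_operator_cvg f b x : bessel f b ->
  summability.partial_sum (fun i => inner x (f i) *: f i) @ totally -->
    frame_operator f x.
Proof. by move=> fb; apply: (synthesis_cvg fb); exact: frame_coef_l2 fb. Qed.

Lemma inner_frame_operator f b x y : bessel f b ->
  inner (frame_operator f x) y = l2_inner (frame_coef f x) (frame_coef f y).
Proof.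
move=> fb; pose proof (h := cvg_innerl (y := y) (frame_operator_cvg (x := x) fb)).
apply/esym/l2_inner_unique; [exact: frame_coef_l2 fb|exact: frame_coef_l2 fb|].
apply: cvg_trans h; apply: near_eq_cvg; apply: nearW => F.
rewrite !partial_sumE inner_suml; apply: eq_bigr => i _.
by rewrite innerZl /frame_coef -innerC.
Qed.

Lemma orthonormal_bessel f : (forall i j, inner (f i) (f j) = (i == j)%:R) ->
  bessel f 1.
Proof.
move=> fo x F; rewrite mul1r.
pose s := \sum_(i <- F) frame_coef f x i *: f i.
have sf j : j \in F -> inner s (f j) = frame_coef f x j.
  move=> jF; rewrite inner_suml (big_fsetD1 j) //= innerZl fo eqxx mulr1.
  rewrite big1_fset ?addr0 // => i; rewrite !inE => /andP[/negPf ij _] _.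
  by rewrite innerZl fo ij mulr0.
have e1 : inner s s = (\sum_(i <- F) sq_modulus (frame_coef f x i))%:C.
  rewrite {2}/s inner_sumr rmorph_sum; apply: eq_fbigr => i iF _.
  by rewrite innerZr sf // [RHS]sq_modulusE normCK mulrC.
have e2 : inner x s = (\sum_(i <- F) sq_modulus (frame_coef f x i))%:C.
  rewrite inner_sumr rmorph_sum; apply: eq_bigr => i _.
  by rewrite innerZr [RHS]sq_modulusE normCK mulrC.
have := exprn_ge0 2 (normr_ge0 (x - s)).
rewrite normBsq (innerC s x) e2 geC0_conj; last first.
  by rewrite lecR sumr_ge0 // => i _; exact: sq_modulus_ge0.
by rewrite -(inner_normE s) e1 subrK subr_ge0.
Qed.

(** The sum of the expansion of x has the same coefficients as x, so the
    difference vanishes by totality. *)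
Lemma orthonormal_basis_total f :
  (forall i j, inner (f i) (f j) = (i == j)%:R) ->
  (forall x, (forall i, inner x (f i) = 0) -> x = 0) ->
  orthonormal_basis f.
Proof.
move=> fo ft; split => // x; have fb := orthonormal_bessel fo.
suff e : frame_operator f x = x by rewrite -[in X in _ --> X]e; exact: frame_operator_cvg fb.
apply/eqP; rewrite -subr_eq0; apply/eqP/ft => j.
rewrite innerBl (inner_frame_operator _ _ fb).
have -> : frame_coef f (f j) = unit_vector R j.
  by apply/funext => i; rewrite /frame_coef fo eq_sym.
by rewrite l2_inner_unit_vector ?subrr //; exact: frame_coef_l2 fb.
Qed.

End frames.

(** * Naimark complements and powers in BS(1,2) *)

Section naimark.
Variables (R : realType) (H : hilbertType R) (I : choiceType).
Local Notation C := R[i].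

Definition parseval (g : I -> H) := (forall x, l2 (frame_coef g x)) /\
  forall x y, l2_inner (frame_coef g x) (frame_coef g y) = inner x y.

(** K is the orthogonal complement in l2 of the coefficient sequences, and k i
    is the projection of the i-th unit vector, that is, the unit vector minus
    the coefficient sequence of g i.  Pairing y in K with k i gives the i-th
    coordinate of y. *)
Lemma naimark (g : I -> H) : parseval g ->
  exists (K : hilbertType R) (k : I -> K),
    [/\ forall i j, inner (k i) (k j) = (i == j)%:R - inner (g i) (g j),
        forall y, (forall i, inner y (k i) = 0) -> y = 0 &
        forall x y, (forall i, inner x (g i) + inner y (k i) = 0) -> x = 0 /\ y = 0].
Proof.
move=> [g2 gp].
pose v := L2Family g2; pose K := annihilator v : hilbertType R.
have u2 j : l2 (unit_vector R j : I -> C) by exact: l2_unit_vector.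
pose kfun i : I -> C := fun j => unit_vector R i j - frame_coef g (g i) j.
have k2 i : l2 (kfun i).
  have -> : kfun i = (fun j => unit_vector R i j + -1 * frame_coef g (g i) j).
    by apply/funext => j; rewrite mulN1r.
  exact: l2D (u2 i) (l2Z (-1) (g2 (g i))).
have ip_k (x : I -> C) i : l2 x -> l2_inner x (kfun i) = x i - l2_inner x (frame_coef g (g i)).
  by move=> x2; rewrite l2_innerBr // l2_inner_unit_vector.
have kP i : (kfun i : I -> C^o) \in ann_pred v.
  apply/asboolP; split; [exact: k2 | move=> y].
  rewrite (l2_innerC (k2 i) (g2 y)) (ip_k _ _ (g2 y)) [l2_inner _ _]gp subrr.
  by rewrite conjC0.
pose k i : K := Annihilator (kP i).
have inner_k (y : K) i : inner y (k i) = ann_val y i.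
  by rewrite [LHS](ip_k _ _ (ann_l2 y)) (ann_orthogonal y) subr0.
have k_total (y : K) : (forall i, inner y (k i) = 0) -> y = 0.
  by move=> yk; apply: val_inj; apply/funext => i; rewrite -[LHS]inner_k yk.
exists K, k; split => // [i j|x y xy].
  by rewrite inner_k /= /kfun /unit_vector /frame_coef eq_sym.
suff x0 : x = 0.
  by split => //; apply: k_total => i; rewrite -[RHS](xy i) x0 inner0l add0r.
have yE : frame_coef g x = (fun i => -1 * ann_val y i).
  apply/funext => i; rewrite mulN1r; apply/eqP.
  by rewrite -addr_eq0 -inner_k; apply/eqP; exact: xy.
apply: inner_xx0; rewrite -gp {1}yE (l2_innerZl _ (ann_l2 y) (g2 x)).
by rewrite [l2_inner _ _](ann_orthogonal y x) mulr0.
Qed.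

End naimark.

Section gram_unitary.
Variables (R : realType) (K : hilbertType R) (I : Type).

(** The isometric extension W maps the closed span of e onto itself, as both
    families have the same range; U is W there and the identity on the
    complement. *)
Lemma gram_unitary (e e' : I -> K) :
  (forall i j, inner (e i) (e j) = inner (e' i) (e' j)) ->
  range e = range e' ->
  exists U : unitary K, (forall i, U (e i) = e' i) /\
    forall x, span_proj (range e) (U x) = U (span_proj (range e) x).
Proof.
move=> gram ee'; have [W [We We' W'W WW']] := isometric_extension gram.
rewrite -ee' in WW'; set P := span_proj (range e) in W'W WW' *.
have PP x : P (P x) = P x by exact: span_proj_idem.
have Pe i : P (e i) = e i by apply: span_proj_mem; exists i.
have WP x : W (P x) = P (W x) by rewrite -[RHS]WW' W'W.
have W'P x : adj W (P x) = P (adj W x) by rewrite -[RHS]W'W WW'.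
have Pc x : P (x - P x) = 0 by rewrite opfB PP subrr.
have PW x : P (W x) = W x.
  rewrite -WP; apply/esym/eqP; rewrite -subr_eq0 -opfB; apply/eqP/inner_xx0.
  by rewrite adjP W'W Pc inner0r.
have PW' x : P (adj W x) = adj W x.
  rewrite -W'P; apply/esym/eqP; rewrite -subr_eq0 -opfB; apply/eqP/inner_xx0.
  by rewrite -adjP' WW' Pc inner0r.
pose U := opD W (opB (@op1 _ K) P).
have UE x : U x = W x + (x - P x) by [].
have U'E x : adj U x = adj W x + (x - P x) by [].
have PU x : P (U x) = W x by rewrite UE opfD opfB PP subrr addr0 PW.
have PU' x : P (adj U x) = adj W x by rewrite U'E opfD opfB PP subrr addr0 PW'.
have W0 x : W (x - P x) = 0 by rewrite opfB WP PW subrr.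
have W'0 x : adj W (x - P x) = 0 by rewrite opfB W'P PW' subrr.
have U'U x : adj U (U x) = x.
  by rewrite U'E PU UE opfD W'0 addr0 W'W [W x + _]addrC addrK addrC subrK.
have UU' x : U (adj U x) = x.
  by rewrite UE PU' U'E opfD W0 addr0 WW' [adj W x + _]addrC addrK addrC subrK.
exists (op_unitary U'U UU'); split=> [i|x].
  by change (U (e i) = e' i); rewrite UE Pe subrr addr0.
change (P (U x) = U (P x)); by rewrite PU UE WP PW PP subrr addr0.
Qed.

End gram_unitary.

Section powers.
Variable G : groupType.
Local Open Scope group_scope.

Lemma expgzS (g : G) (j : int) : expgz g (j + 1)%R = g * expgz g j.
Proof.
case: j => [n|[|n]].
- by rewrite -PoszD addn1 /= expgS.
- by rewrite /= expg0 expg1 mulgV.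
- have -> : (Negz n.+1 + 1)%R = Negz n by lia.
  by rewrite /= (expgSr g n.+1) invgM mulVKg.
Qed.

Lemma expgzDn (g : G) (j : int) (n : nat) : expgz g (j + n%:Z)%R = g ^+ n * expgz g j.
Proof.
elim: n => [|n IH]; first by rewrite addr0 expg0 mul1g.
by rewrite -addn1 PoszD addrA expgzS IH mulgA -expgS addn1.
Qed.

Lemma expgzNn (g : G) (n : nat) : expgz g (- n%:Z)%R = g ^- n.
Proof. by case: n => [|n] //=; rewrite expg0 invg1. Qed.

Lemma BS12_comm_neg (d t : G) (m : nat) : d * t * d^-1 = t ^+ 2 ->
  t * d ^- m = d ^- m * t ^+ (2 ^ m).
Proof.
move=> dt; elim: m => [|m IH]; first by rewrite expg0 invg1 mulg1 mul1g expn0 expg1.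
have dtn n : d * t ^+ n = t ^+ (2 * n) * d.
  elim: n => [|n IHn]; first by rewrite muln0 !expg0 mulg1 mul1g.
  rewrite expgSr mulgA IHn -mulgA -[d * t](mulgVK d) dt mulgA -expgnDr mulnS.
  by rewrite addnC.
rewrite expgS invgM mulgA IH -!mulgA; congr (_ * _).
by apply: (mulgI d); rewrite mulVKg mulgA dtn mulgK expnS.
Qed.

End powers.

(** * Dilation of Parseval wavelets *)

Section orbits.
Variables (R : realType) (K : hilbertType R).

Lemma unitary_orbit (U : unitary K) (h : int -> K) :
  (forall n, U (h n) = h (n + 1)) -> forall j, expgz U j (h 0) = h j.
Proof.
move=> Uh; elim/int_ind => [//|n IH|n IH].
  by rewrite -addn1 PoszD [LHS](congr1 (fun V : unitary K => V (h 0)) (expgzS U n)) /= IH Uh.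
apply: (can_inj (unitaryK U)).
have e : (- n.+1%:Z + 1 = - n%:Z)%R by lia.
have := congr1 (fun V : unitary K => V (h 0)) (expgzS U (- n.+1%:Z)).
by rewrite e IH /= Uh e => ->.
Qed.

End orbits.

Section udsum_powers.
Variables (R : realType) (H K : hilbertType R).

Lemma udsum_expgz (U : unitary H) (V : unitary K) j :
  expgz (udsum U V) j = udsum (expgz U j) (expgz V j).
Proof.
have en n : (udsum U V ^+ n)%g = udsum (U ^+ n)%g (V ^+ n)%g.
  elim: n => [|n IH]; first by apply: unitary_ext => -[x y].
  by rewrite !expgS IH udsumM.
case: j => n /=; first exact: en.
rewrite en; apply: (mulgI (udsum (U ^+ n.+1)%g (V ^+ n.+1)%g)).
by rewrite mulgV -udsumM !mulgV; apply: unitary_ext => -[x y].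
Qed.

End udsum_powers.

Section dilation.
Variables (R : realType) (H : hilbertType R) (D T : unitary H) (psi : H).
Local Notation C := R[i].
Local Notation g := (wavelet_system D T psi).

Lemma system_D j n : D (g (j, n)) = g (j + 1, n).
Proof.
rewrite /wavelet_system /dilation_translation /=.
by rewrite [in RHS]expgzS.
Qed.

(** Restricted to scales - m: at a scale m > 0 the relation reads
    T^(2^m) D^m = D^m T, so that T^(2^m) rather than T acts by a shift. *)
Lemma system_T (m : nat) n : BS12_rep D T ->
  T (g (- m%:Z, n)) = g (- m%:Z, n + (2 ^ m)%N%:Z).
Proof.
move=> BS; rewrite /wavelet_system /dilation_translation /=.
have := congr1 (fun V : unitary H => V (expgz T n psi)) (BS12_comm_neg m BS).
by rewrite /= -expgzNn => ->; rewrite expgzDn.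
Qed.

Lemma gram_shift (f : int * int -> int * int) (U : unitary H) (i j : int * int) :
  injective f -> (forall i, U (g i) = g (f i)) ->
  (i == j)%:R - inner (g i) (g j) = (f i == f j)%:R - inner (g (f i)) (g (f j)) :> C.
Proof. by move=> fi Ug; rewrite (inj_eq fi) -!Ug unitary_inner. Qed.

(** On the complementary family k of [naimark], D' and the part T0 of T' on
    the span of the k_(j,n) with j <= 0 exist because the Gram matrix of k
    inherits the symmetries of g; [doubling_extension] produces T'. *)
Lemma parseval_dilation : BS12_rep D T -> parseval g ->
  exists (K : hilbertType R) (D' T' : unitary K) (psi2 : K),
    BS12_rep D' T' /\ orthonormal_wavelet (udsum D D') (udsum T T') (hdpair psi psi2).
Proof.
move=> BS gP; have [K [k [k_gram k_total gk_total]]] := naimark gP.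
have perp_total (J : Type) (e : J -> K) : (forall i, exists j, e j = k i) ->
    forall y, perp (range e) y -> y = 0.
  by move=> ek y ye; apply: k_total => i; have [j <-] := ek i; apply: ye; exists j.
(* the shift in j, unitary as its image is again all of k *)
have [D' [D'k _]] : exists D' : unitary K, (forall i, D' (k i) = k (i.1 + 1, i.2)) /\
    forall x, span_proj (range k) (D' x) = D' (span_proj (range k) x).
  apply: gram_unitary.
    move=> i j; rewrite !k_gram; apply: (gram_shift (U := D) (f := fun i => (i.1 + 1, i.2))).
      by move=> [a b] [c d] /= [/addIr -> ->].
    by move=> [a b]; exact: system_D.
  apply/seteqP; split=> _ [[a b] _ <-]; last by exists (a + 1, b).
  by exists (a - 1, b) => //=; rewrite subrK.
have {}D'k j n : D' (k (j, n)) = k (j + 1, n) by exact: (D'k (j, n)).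
have D'Vk j n : unitaryV D' (k (j, n)) = k (j - 1, n).
  by apply: (can_inj (unitaryK D')); rewrite unitaryVK D'k subrK.
pose e (p : nat * int) := k (- p.1%:Z, p.2).
pose e' (p : nat * int) := k (- p.1%:Z, p.2 + (2 ^ p.1)%N%:Z).
have eE (m : nat) n : e (m, n) = k (- m%:Z, n) by [].
(* T0 is n |-> n + 2^m at scale - m, and the identity off the span of e *)
have [T0 [T0e T0P]] : exists T0 : unitary K, (forall p, T0 (e p) = e' p) /\
    forall x, span_proj (range e) (T0 x) = T0 (span_proj (range e) x).
  apply: gram_unitary.
    move=> [m n] [m' n']; rewrite /e /e' /= !k_gram; congr (_ - _).
      congr ((_ : bool)%:R); apply/eqP/eqP => -[/oppr_inj [->]]; first by move=> ->.
      by move=> /addIr ->.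
    by rewrite -!system_T // unitary_inner.
  apply/seteqP; split=> _ [[m n] _ <-]; last by exists (m, n + (2 ^ m)%N%:Z).
  by exists (m, n - (2 ^ m)%N%:Z) => //; rewrite /e' /= subrK.
have {}T0e (m : nat) n : T0 (k (- m%:Z, n)) = k (- m%:Z, n + (2 ^ m)%N%:Z).
  exact: (T0e (m, n)).
set P0 := span_proj (range e) in T0P.
have P0k (m : nat) n : P0 (k (- m%:Z, n)) = k (- m%:Z, n).
  by apply: span_proj_mem; exists (m, n).
have nS (m : nat) : (- m%:Z - 1 = - m.+1%:Z)%R by lia.
have P0_proj : projection P0 by split=> x //; exact: span_proj_idem.
have P0_incr x : D' (P0 (unitaryV D' (P0 x))) = P0 x.
  apply: (@op_eq_on_span _ _ _ (opM (uop D') (opM P0 (opM (adj (uop D')) P0))) P0 (range e)).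
    move=> _ [[m n] _ <-]; change (D' (P0 (unitaryV D' (P0 (e (m, n))))) = P0 (e (m, n))).
    by rewrite !eE !P0k D'Vk nS P0k D'k -nS subrK.
  move=> y ye; change (D' (P0 (unitaryV D' (P0 y))) = P0 y).
  by rewrite (span_proj_perp ye) (unitaryf0 (unitaryV D')) opf0 unitaryf0.
have P0_total y : (forall n, P0 (iter n (unitaryV D') y) = 0) -> y = 0.
  move=> yP; apply: k_total => -[j l].
  have iter_k (n : nat) i : iter n (unitaryV D') (k (i, l)) = k (i - n%:Z, l).
    elim: n => [|n IH]; first by rewrite subr0.
    by rewrite iterS IH D'Vk; congr (k (_, _)); lia.
  have iter_inner (n : nat) a b :
      inner (iter n (unitaryV D') a) (iter n (unitaryV D') b) = inner a b.
    by elim: n => [//|n IH]; rewrite !iterS unitary_inner.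
  have [m mE] : exists m : nat, (j - `|j|%N%:Z = - m%:Z)%R.
    by exists (absz ((absz j)%:Z - j)); lia.
  rewrite -(iter_inner `|j|%N) iter_k mE -P0k (adjP' P0).
  by rewrite (P0_proj.1) yP inner0l.
have TTP0 x : T0 (T0 (P0 x)) = D' (T0 (unitaryV D' (P0 x))).
  apply: (@op_eq_on_span _ _ _ (opM (uop T0) (opM (uop T0) P0))
    (opM (uop D') (opM (uop T0) (opM (adj (uop D')) P0))) (range e)).
    move=> _ [[m n] _ <-].
    change (T0 (T0 (P0 (e (m, n)))) = D' (T0 (unitaryV D' (P0 (e (m, n)))))).
    rewrite eE P0k !T0e D'Vk nS T0e D'k -nS subrK -addrA.
    by congr (k (_, n + _)); rewrite expnS; lia.
  move=> y ye; change (T0 (T0 (P0 y)) = D' (T0 (unitaryV D' (P0 y)))).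
  by rewrite (span_proj_perp ye) (unitaryf0 (unitaryV D')) !unitaryf0.
have [T' [T'T' T'P0]] := doubling_extension P0_proj P0_incr P0_total T0P TTP0.
exists K, D', T', (k (0, 0)); split.
  by apply: unitary_ext => x; rewrite expg2 /=; exact/esym/T'T'.
have T'k n : T' (k (0, n)) = k (0, n + 1).
  by have := T'P0 (k (- 0%:Z, n)); rewrite P0k T0e expn0.
have sysE i : wavelet_system (udsum D D') (udsum T T') (hdpair psi (k (0, 0))) i =
    hdpair (g i) (k i).
  case: i => j n; rewrite /wavelet_system /dilation_translation !udsum_expgz /=.
  congr hdpair.
  rewrite (unitary_orbit (h := fun n => k (0, n)) T'k).
  by rewrite (unitary_orbit (h := fun j => k (j, n)) (D'k ^~ n)).
apply: orthonormal_basis_total => [i j|[x y] xy].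
  by rewrite !sysE hdsum_innerE /= k_gram addrC subrK.
have [] := gk_total x y; last by move=> -> ->.
by move=> i; have := xy i; rewrite sysE hdsum_innerE.
Qed.

End dilation.

(** * Positive operators *)

Section positive.
Variables (R : realType) (H : hilbertType R).
Local Notation C := R[i].
Implicit Types (E P Q G : op H H) (x y : H).

(** Positivity without a bound: op only records the adjoint. *)
Definition posop E := (forall x y, inner (E x) y = inner x (E y)) /\
  forall x, 0 <= inner (E x) x.

(** Cauchy-Schwarz for the form of E at x and E x. *)
Lemma posop_bound E (m : R) : posop E ->
  (forall x, inner (E x) x <= m%:C * `|x| ^+ 2) ->
  forall x, `|E x| ^+ 2 <= m%:C ^+ 2 * `|x| ^+ 2.
Proof.
move=> [Es E0] Em x.
have [->|Ex0] := eqVneq (E x) 0.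
  rewrite normr0 expr0n /=; apply: mulr_ge0; last exact: exprn_ge0.
  by rewrite -rmorphXn lecR sqr_ge0.
have gt : 0 < `|E x| ^+ 2 by rewrite exprn_gt0 // normr_gt0.
have := op_cauchy_schwarz Es E0 x (E x).
rewrite inner_normE ger0_norm ?exprn_ge0 // => h.
rewrite -(ler_pM2r gt) -expr2; apply: le_trans h _.
apply: le_trans (ler_pM (E0 _) (E0 _) (Em _) (Em _)) _.
by rewrite le_eqVlt; apply/orP; left; apply/eqP; ring.
Qed.

Lemma posop_ker E x : posop E -> inner (E x) x = 0 -> E x = 0.
Proof.
move=> [Es E0] Ex; apply: inner_xx0.
have := op_cauchy_schwarz Es E0 x (E x); rewrite Ex mul0r => h.
have : `|inner (E x) (E x)| ^+ 2 == 0 by rewrite eq_le h exprn_ge0.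
by rewrite sqrf_eq0 normr_eq0 => /eqP.
Qed.

Lemma positive_operatorP E (M : C) : posop E -> (forall x, `|E x| <= M * `|x|) ->
  positive_operator E.
Proof.
by move=> [Es E0] EM; split => //; split => //; split; [exact: op_linear | exists M].
Qed.

Lemma positive_operator_op (E : H -> H) : positive_operator E ->
  exists E' : op H H, opf E' = E /\ posop E'.
Proof. by move=> [[_ Es] E0]; exists (Op Es). Qed.

(** Z = 1 - G / m is a contraction, and the square root of 1 - Z = G / m is
    rescaled.  The commutation clause is what makes the root unique. *)
Lemma positive_sqrt G (m : R) : 0 < m -> posop G ->
  (forall x, inner (G x) x <= m%:C * `|x| ^+ 2) ->
  exists P, [/\ posop P, forall x, P (P x) = G x,
    forall x, `|P x| <= (2 * Num.sqrt m)%:C * `|x| &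
    forall A : op H H, (forall x, A (G x) = G (A x)) -> forall x, A (P x) = P (A x)].
Proof.
move=> m0 [Gs G0] Gm.
have mC : 0 < m%:C :> C by rewrite ltcR.
pose Z := opB (@op1 _ H) (opZ (m%:C^-1) G).
have ZE x : Z x = x - m%:C^-1 *: G x by [].
have mC' : Num.conj (m%:C^-1) = m%:C^-1 :> C by rewrite geC0_conj // invr_ge0 ltW.
have Zs x y : inner (Z x) y = inner x (Z y).
  by rewrite !ZE innerBl innerBr innerZl innerZr mC' Gs.
have ZxE x : inner (Z x) x = `|x| ^+ 2 - m%:C^-1 * inner (G x) x.
  by rewrite ZE innerBl innerZl inner_normE.
have Z0 x : 0 <= inner (Z x) x by rewrite ZxE subr_ge0 mulrC ler_pdivrMr // mulrC.
have Z1 x : inner (Z x) x <= 1%:C * `|x| ^+ 2.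
  by rewrite mul1r ZxE gerBl mulr_ge0 // invr_ge0 ltW.
have Zc : contraction Z.
  move=> x; rewrite -(@ler_pXn2r _ 2) ?nnegrE //.
  by have := posop_bound (conj Zs Z0) Z1 x; rewrite expr1n mul1r.
have [F [FF F1 FC Fs]] := contraction_sqrt Zc.
have {}Fs x y : inner (F x) y = inner x (F y).
  rewrite adjP Fs // => z; apply: inner_inj => t.
  by rewrite -adjP' -Zs.
have F0 x : 0 <= inner (F x) x.
  have h : `|x - F x| ^+ 2 <= `|x| ^+ 2 by rewrite ler_pXn2r ?nnegrE.
  rewrite normBsq -Fs in h.
  have {h} : `|F x| ^+ 2 <= inner (F x) x *+ 2.
    rewrite -subr_ge0 in h; rewrite -subr_ge0.
    by apply: le_trans h _; rewrite le_eqVlt; apply/orP; left; apply/eqP; ring.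
  by move/(le_trans (exprn_ge0 2 (normr_ge0 _))); rewrite pmulrn_lge0.
pose s := Num.sqrt m.
have s0 : 0 <= s%:C :> C by rewrite lecR sqrtr_ge0.
have sC : Num.conj s%:C = s%:C :> C by rewrite geC0_conj.
have ss : s%:C * s%:C = m%:C :> C by rewrite -rmorphM /= -expr2 sqr_sqrtr // ltW.
pose P := opZ s%:C F.
have PE x : P x = s%:C *: F x by [].
exists P; split.
- split=> [x y|x]; first by rewrite !PE innerZl innerZr sC Fs.
  by rewrite PE innerZl mulr_ge0.
- move=> x; rewrite !PE opfZ scalerA ss FF ZE opprB addrC subrK scalerA.
  by rewrite divff ?scale1r // gt_eqF.
- move=> x; rewrite PE normrZ ger0_norm // rmorphM /= [2%:C * _]mulrC -mulrA.
  rewrite ler_wpM2l // rmorph_nat mulr_natl mulr2n -{1}[F x](subKr x).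
  by apply: le_trans (ler_normB _ _) _; rewrite lerD2l.
- move=> A AG x; rewrite !PE opfZ FC // => y.
  by rewrite !ZE opfB opfZ AG.
Qed.

(** Compare any root T with the root P0 from [positive_sqrt].  T commutes with
    G = T T, hence with P0, so (P0 + T) (P0 - T) = 0.  For y = (P0 - T) x both
    terms of inner (P0 y) y + inner (T y) y = 0 are nonnegative, so
    P0 y = T y = 0 and |y|^2 = inner x (P0 y - T y) = 0. *)
Lemma positive_sqrt_unique G P Q (m : R) : 0 < m -> posop G ->
  (forall x, inner (G x) x <= m%:C * `|x| ^+ 2) ->
  posop P -> (forall x, P (P x) = G x) ->
  posop Q -> (forall x, Q (Q x) = G x) -> forall x, P x = Q x.
Proof.
move=> m0 Gp Gm.
have [P0 [P0p PP0 _ P0C]] := positive_sqrt m0 Gp Gm.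
suff key T : posop T -> (forall x, T (T x) = G x) -> forall x, P0 x = T x.
  by move=> Pp PP Qp QQ x; rewrite -(key P) // (key Q).
move=> Tp TT x.
have TP0 z : T (P0 z) = P0 (T z) by apply: P0C => {}z; rewrite -!TT.
set y := P0 x - T x.
have sum0 : inner (P0 y) y + inner (T y) y = 0.
  rewrite -innerDl {1 2}/y !opfB PP0 TT TP0.
  by rewrite addrA subrK subrr inner0l.
have /andP[/eqP h1 /eqP h2] : (inner (P0 y) y == 0) && (inner (T y) y == 0).
  by rewrite -paddr_eq0 ?sum0 //; [exact: P0p.2 | exact: Tp.2].
have P0y := posop_ker P0p h1; have Ty := posop_ker Tp h2.
apply/eqP; rewrite -subr_eq0; apply/eqP/inner_xx0; rewrite -/y.
by rewrite {1}/y innerBl P0p.1 Tp.1 P0y Ty !inner0r subrr.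
Qed.

Lemma inv_opE (S : H -> H) (G : op H H) : inverse_operator S G -> inv_op S = G.
Proof.
move=> SG; have [_ h2 _] : inverse_operator S (inv_op S).
  by apply: (@getPex _ [set B | inverse_operator S B]); exists (opf G).
by apply/funext => x; case: SG => _ _ SG; rewrite -{1}(SG x) h2.
Qed.

Lemma sqrt_opE G P (m : R) (M : C) : 0 < m -> posop G ->
  (forall x, inner (G x) x <= m%:C * `|x| ^+ 2) ->
  posop P -> (forall x, `|P x| <= M * `|x|) -> (forall x, P (P x) = G x) ->
  sqrt_op G = P.
Proof.
move=> m0 Gp Gm Pp PM PP.
have [Qp QQ] : positive_operator (sqrt_op G) /\ sqrt_op G \o sqrt_op G = G.
  apply: (@getPex _ [set P : H -> H | positive_operator P /\ P \o P = G]).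
  exists (opf P); split; first exact: positive_operatorP Pp PM.
  exact/funext.
have [Q [QE Qpos]] := positive_operator_op Qp.
rewrite -QE in QQ *; apply/funext => x.
apply: (positive_sqrt_unique m0 Gp Gm Qpos _ Pp PP) => z.
by rewrite -QQ.
Qed.

(** Cauchy-Schwarz for the form of E at x and P x, where P is the inverse:
    |x|^4 <= inner (E x) x times inner x (P x), and a |P x| <= |x|. *)
Lemma posop_lower E P (a : R) : 0 < a -> posop E ->
  (forall x, a%:C * `|x| <= `|E x|) -> (forall x, E (P x) = x) ->
  forall x, a%:C * `|x| ^+ 2 <= inner (E x) x.
Proof.
move=> a0 [Es E0] aE EP x.
have aC : 0 < a%:C :> C by rewrite ltcR.
have [->|x0] := eqVneq x 0; first by rewrite normr0 expr0n mulr0 inner0r.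
have xgt : 0 < `|x| ^+ 2 by rewrite exprn_gt0 // normr_gt0.
have := op_cauchy_schwarz Es E0 x (P x).
rewrite Es EP inner_normE ger0_norm ?exprn_ge0 // => h.
have h2 : a%:C * inner x (P x) <= `|x| ^+ 2.
  have p0 : 0 <= inner x (P x) by have := E0 (P x); rewrite EP.
  rewrite -(ger0_norm p0); apply: le_trans (ler_wpM2l (ltW aC) (cauchy_schwarz _ _)) _.
  by rewrite mulrCA expr2 ler_wpM2l // -[leRHS](congr1 _ (EP x)).
rewrite -(ler_pM2r xgt) -mulrA -expr2.
apply: le_trans (ler_wpM2l (ltW aC) h) _.
by rewrite mulrCA; apply: ler_wpM2l.
Qed.

(** A positive operator satisfies |E x|^2 <= m inner (E x) x, so being bounded
    below in norm implies being bounded below as a form. *)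
Lemma posop_invertible_coercive E (m M : R) : 0 < m -> posop E ->
  (forall x, inner (E x) x <= m%:C * `|x| ^+ 2) ->
  (forall x, `|x| <= M%:C * `|E x|) ->
  exists2 c : R, 0 < c & forall x, c%:C * `|x| ^+ 2 <= inner (E x) x.
Proof.
move=> m0 [Es E0] Em EM.
have mC : 0 < m%:C :> C by rewrite ltcR.
have h x : `|E x| ^+ 2 <= m%:C * inner (E x) x.
  have [->|Ex0] := eqVneq (E x) 0.
    by rewrite normr0 expr0n inner0l mulr0.
  have gt : 0 < `|E x| ^+ 2 by rewrite exprn_gt0 // normr_gt0.
  have := op_cauchy_schwarz Es E0 x (E x).
  rewrite inner_normE ger0_norm ?exprn_ge0 // => h.
  rewrite -(ler_pM2r gt) -expr2; apply: le_trans h _.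
  by rewrite mulrAC mulrC; apply: ler_wpM2r.
have k0 : 0 < M ^+ 2 * m + 1.
  by rewrite ltr_wpDl // mulr_ge0 ?sqr_ge0 // ltW.
exists (M ^+ 2 * m + 1)^-1; first by rewrite invr_gt0.
move=> x; rewrite fmorphV mulrC ler_pdivrMr ?ltcR //.
apply: (@le_trans _ _ ((M ^+ 2 * m)%:C * inner (E x) x)); last first.
  by rewrite mulrC ler_wpM2l // lecR lerDl.
rewrite rmorphM /= rmorphXn /= -mulrA.
apply: (@le_trans _ _ (M%:C ^+ 2 * `|E x| ^+ 2)).
  rewrite -exprMn ler_pXn2r ?nnegrE // ; exact: le_trans (normr_ge0 x) (EM x).
by rewrite ler_wpM2l // -rmorphXn lecR sqr_ge0.
Qed.

End positive.

(** * Spectrum and optimal frame bounds *)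

Section spectrum.
Variables (R : realType) (H : hilbertType R).
Local Notation C := R[i].

Lemma add_conj_Re (z : C) : z + Num.conj z = (2 * complex.Re z)%:C.
Proof.
by case: z => u v; apply/eqP; rewrite eq_complex /= subrr eqxx andbT; apply/eqP; ring.
Qed.

(** For l = p + i q off the segment, E - l is coercive after multiplication by
    i or -i when q is nonzero, by 1 when p < a and by -1 when b < p. *)
Lemma spectrum_posop (E : op H H) (a b M : R) : posop E ->
  (forall x, a%:C * `|x| ^+ 2 <= inner (E x) x) ->
  (forall x, inner (E x) x <= b%:C * `|x| ^+ 2) ->
  (forall x, `|E x| <= M%:C * `|x|) ->
  spectrum E `<=` [set s%:C | s in `[a, b]].
Proof.
move=> [Es E0] aE Eb EM l lE.
have [//|nl] := pselect ([set s%:C | s in `[a, b]] l).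
exfalso; apply: lE.
pose T := opB E (opZ l (@op1 _ H)).
case: l nl @T => p q nl T.
have TE x : exists e n : R, [/\ inner (T x) x = ((e - p * n) +i* (- (q * n)))%C,
    `|x| ^+ 2 = n%:C, 0 <= n, a * n <= e & e <= b * n].
  have [eE _] := complex_ge0P (E0 x).
  have [nE n0] := complex_ge0P (exprn_ge0 2 (normr_ge0 x)).
  exists (complex.Re (inner (E x) x)), (complex.Re (`|x| ^+ 2)); split => //.
  - rewrite /= innerBl innerZl inner_normE; rewrite {1}eE {1}nE.
    by apply/eqP; rewrite eq_complex /=; apply/andP; split; apply/eqP; ring.
  - by have := aE x; rewrite eE nE -rmorphM lecR.
  - by have := Eb x; rewrite eE nE -rmorphM lecR.
have [r rE] : exists r : R, `|(p +i* q)%C : C| = r%:C.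
  by eexists; exact: (complex_ge0P (normr_ge0 _)).1.
have TM x : `|T x| <= (M + r)%:C * `|x|.
  apply: le_trans (ler_normB _ _) _; rewrite rmorphD mulrDl; apply: lerD => //.
  by rewrite normrZ rE.
have [c [w [c0 w1 cT]]] : exists (c : R) (w : C), [/\ 0 < c, `|w| = 1 &
    forall x, (2 * c)%:C * `|x| ^+ 2 <= w * inner (T x) x + Num.conj (w * inner (T x) x)].
  (* w = u + i v, with all quantities real *)
  have pick (u v c : R) : 0 < c -> u ^+ 2 + v ^+ 2 = 1 ->
      (forall e n, 0 <= n -> a * n <= e -> e <= b * n ->
        c * n <= u * (e - p * n) + v * (q * n)) ->
      exists (c : R) (w : C), [/\ 0 < c, `|w| = 1 &
    forall x, (2 * c)%:C * `|x| ^+ 2 <= w * inner (T x) x + Num.conj (w * inner (T x) x)].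
    move=> c0 uv h; exists c, (u +i* v)%C; split => //.
      by rewrite normc_def uv sqrtr1.
    move=> x; have [e [n [-> -> n0 an nb]]] := TE x.
    rewrite add_conj_Re -rmorphM lecR -mulrA ler_pM2l //=.
    by rewrite mulrN opprK; exact: h.
  have [q0|q0|q0] := ltgtP q 0.
  - by apply: (pick 0 (-1) (- q)) => [||e n *]; [lra|ring|lra].
  - by apply: (pick 0 1 q) => [||e n *]; [lra|ring|lra].
  have [pa|ap] := ltP p a.
    by apply: (pick 1 0 (a - p)) => [||e n *]; [lra|ring|lra].
  have [bp|pb] := ltP b p.
    by apply: (pick (-1) 0 (p - b)) => [||e n *]; [lra|ring|lra].
  exfalso; apply: nl; exists p; last by rewrite q0.
  by rewrite /= in_itv /= ap pb.
have [B [BT TB Bc]] := coercive_inverse c0 TM w1 cT.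
exists (opf B); split => //; split; first exact: op_linear.
by exists (c^-1)%:C.
Qed.

Lemma resolvent_bounded_below (E : H -> H) (l : C) : ~ spectrum E l ->
  exists M : R, forall x, `|x| <= M%:C * `|E x - l *: x|.
Proof.
move=> /contrapT[B [[_ [M BM]] EB _]]; exists (complex.Re `|M|) => x.
have := BM (E x - l *: x); rewrite EB => h.
rewrite -(complex_ge0P (normr_ge0 M)).1 -[X in _ * X]ger0_norm // -normrM ger0_norm //.
exact: le_trans h.
Qed.

End spectrum.

Section optimal.
Variables (R : realType) (H : hilbertType R) (I : choiceType) (f : I -> H).
Variables (a b : R).
Hypotheses (f_frame : is_frame f) (a0 : 0 < a) (ab : a <= b).
Hypothesis optimal : optimal_frame_bounds f a b.
Local Notation C := R[i].

Lemma frame_energy_real : exists (e n : H -> R), forall x,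
  [/\ l2_inner (frame_coef f x) (frame_coef f x) = (e x)%:C, `|x| ^+ 2 = (n x)%:C, 0 <= n x &
      (n x = 0 -> e x = 0)].
Proof.
have [a' [b' fab]] := f_frame.
have [a'0 ab' _] := fab; have [fb h] := (frame_boundsP _ a'0 ab').1 fab.
exists (fun x => complex.Re (l2_inner (frame_coef f x) (frame_coef f x))), (fun x => complex.Re (`|x| ^+ 2)) => x.
have [eE e0] := complex_ge0P (l2_inner_ge0 (frame_coef_l2 x fb)).
have [nE n0] := complex_ge0P (exprn_ge0 2 (normr_ge0 x)).
split => // n_eq0; have /andP[_] := h x.
rewrite eE nE -rmorphM lecR n_eq0 mulr0 => e0'; apply/eqP.
by rewrite eq_le e0 e0'.
Qed.

(** The supremum and infimum in the definition of optimal bounds are attained.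
    They are taken in R, where they default to 0 for empty or unbounded sets:
    positivity of a excludes the zero space, in which every pair is a pair of
    frame bounds. *)
Lemma optimal_bounds : [/\ bessel f b,
  forall x, a%:C * `|x| ^+ 2 <= l2_inner (frame_coef f x) (frame_coef f x) <= b%:C * `|x| ^+ 2,
  exists x : H, x != 0,
  forall c : R, 0 < c -> ~ forall x, (a + c)%:C * `|x| ^+ 2 <= l2_inner (frame_coef f x) (frame_coef f x) &
  forall c : R, 0 < c -> ~ forall x, l2_inner (frame_coef f x) (frame_coef f x) <= (b - c)%:C * `|x| ^+ 2].
Proof.
have [e [n enP]] := frame_energy_real.
have [a1 [b1 fab1]] := f_frame.
have [a10 ab1 _] := fab1; have [fb1 h1] := (frame_boundsP _ a10 ab1).1 fab1.
have fbP a' b' : 0 < a' -> a' <= b' ->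
    (frame_bounds f a' b' <-> forall x, a' * n x <= e x <= b' * n x).
  move=> a'0 ab'; rewrite frame_boundsP //; split=> [[_ h] x|h].
    by have := h x; have [-> -> _ _] := enP x; rewrite -!rmorphM !lecR.
  have h' x : a'%:C * `|x| ^+ 2 <= l2_inner (frame_coef f x) (frame_coef f x) <= b'%:C * `|x| ^+ 2.
    by have := h x; have [-> -> _ _] := enP x; rewrite -!rmorphM !lecR.
  split => // x F; have /andP[_] := h' x; apply: le_trans.
  exact: sum_le_l2_inner (frame_coef_l2 x fb1).
have h1' := (fbP _ _ a10 ab1).1 fab1.
have [supE infE] := optimal.
set X := [set a' | _] in supE; set Y := [set b' | _] in infE.
(* otherwise the supremum defaults to 0, against 0 < a *)
have supX : has_sup X.
  by apply: contrapT => /sup_out e0; move: a0; rewrite supE e0 ltxx.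
have Xa c : X c -> c <= a by move=> Xc; rewrite supE; apply: ub_le_sup => //; case: supX.
have Y0 : has_lbound Y by exists 0 => c [a' [a'0 ac _]]; exact: le_trans (ltW a'0) ac.
have Yb c : Y c -> b <= c by move=> Yc; rewrite infE; exact: ge_inf.
have [x x0] : exists x : H, x != 0.
  apply: contrapT => H0.
  have n0 x : n x = 0.
    have [_ nE _ _] := enP x; apply: complexI; rewrite -nE.
    have [->|x0] := eqVneq x 0; first by rewrite normr0 expr0n.
    by exfalso; apply: H0; exists x.
  suff : a + 1 <= a by lra.
  have a10' : 0 < a + 1 by rewrite addr_gt0.
  apply: Xa; exists (a + 1); apply/(fbP _ _ a10' (lexx _)) => y.
  by have [_ _ _ /(_ (n0 y)) ->] := enP y; rewrite n0 !mulr0 lexx.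
have npos y : y != 0 -> 0 < n y.
  by move=> y0; have [_ nE _ _] := enP y; rewrite -ltcR -nE exprn_gt0 // normr_gt0.
have ae y : a * n y <= e y.
  have [_ _ n0 ne] := enP y; have [/eqP n_eq|n_ne] := boolP (n y == 0).
    by rewrite ne // n_eq mulr0.
  have ngt : 0 < n y by rewrite lt0r n_ne.
  rewrite -ler_pdivlMr // supE; apply: ge_sup; first by case: supX.
  move=> c [b' fcb]; have [c0 cb _] := fcb.
  by rewrite ler_pdivlMr //; have /andP[] := (fbP _ _ c0 cb).1 fcb y.
have eb y : e y <= b * n y.
  have [_ _ n0 ne] := enP y; have [/eqP n_eq|n_ne] := boolP (n y == 0).
    by rewrite ne // n_eq mulr0.
  have ngt : 0 < n y by rewrite lt0r n_ne.
  rewrite -ler_pdivrMr // infE; apply: lb_le_inf; first by exists b1, a1.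
  move=> c [a' fac]; have [a'0 ac _] := fac.
  by rewrite ler_pdivrMr //; have /andP[] := (fbP _ _ a'0 ac).1 fac y.
have aeb : frame_bounds f a b by apply/(fbP _ _ a0 ab) => y; rewrite ae eb.
have [fb hb] := (frame_boundsP _ a0 ab).1 aeb.
split => //; first by exists x.
- move=> c c0 h; have h' y : (a + c) * n y <= e y.
    by have := h y; have [-> -> _ _] := enP y; rewrite -rmorphM lecR.
  have acb : a + c <= b.
    by rewrite -(ler_pM2r (npos x x0)); exact: le_trans (h' x) (eb x).
  suff : a + c <= a by lra.
  have ac0 : 0 < a + c by rewrite addr_gt0.
  by apply: Xa; exists b; apply/(fbP _ _ ac0 acb) => y; rewrite h' eb.
- move=> c c0 h; have h' y : e y <= (b - c) * n y.
    by have := h y; have [-> -> _ _] := enP y; rewrite -rmorphM lecR.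
  have acb : a <= b - c.
    by rewrite -(ler_pM2r (npos x x0)); exact: le_trans (ae x) (h' x).
  suff : b <= b - c by lra.
  by apply: Yb; exists a; apply/(fbP _ _ a0 acb) => y; rewrite h' ae.
Qed.

End optimal.

(** * The equivalence *)

Section sqrt_spectrum.
Variables (R : realType) (H : hilbertType R).
Local Notation C := R[i].

(** If A (or B) were outside the spectrum, E - A (or B - E) would be bounded
    below by some c > 0 as a form, which improves the bound A^2 (or B^2)
    of S = E^2. *)
Lemma sqrt_spectrum (S E P : op H H) (A B : R) : 0 < A -> A <= B -> posop E ->
  (forall x, E (E x) = S x) -> (forall x, E (P x) = x) ->
  (forall x, (A ^+ 2)%:C * `|x| ^+ 2 <= inner (S x) x <= (B ^+ 2)%:C * `|x| ^+ 2) ->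
  (exists x : H, x != 0) ->
  (forall c : R, 0 < c -> ~ forall x, (A ^+ 2 + c)%:C * `|x| ^+ 2 <= inner (S x) x) ->
  (forall c : R, 0 < c -> ~ forall x, inner (S x) x <= (B ^+ 2 - c)%:C * `|x| ^+ 2) ->
  [set A%:C; B%:C] `<=` spectrum E /\ spectrum E `<=` [set a%:C | a in `[A, B]].
Proof.
move=> A0 AB Ep EE EP Sb [x0 x0_neq0] optA optB.
have B0 : 0 < B by exact: lt_le_trans AB.
have A0C : 0 <= A%:C :> C by rewrite lecR ltW.
have B0C : 0 <= B%:C :> C by rewrite lecR ltW.
have [Es E0] := Ep.
have ES x : `|E x| ^+ 2 = inner (S x) x by rewrite -EE Es inner_normE.
have Elow x : A%:C * `|x| <= `|E x|.
  rewrite -(@ler_pXn2r _ 2) ?nnegrE ?mulr_ge0 // exprMn ES -rmorphXn.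
  by case/andP: (Sb x).
have Eup x : `|E x| <= B%:C * `|x|.
  rewrite -(@ler_pXn2r _ 2) ?nnegrE ?mulr_ge0 // exprMn ES -rmorphXn.
  by case/andP: (Sb x).
have El x := posop_lower A0 Ep Elow EP x.
have Eu x : inner (E x) x <= B%:C * `|x| ^+ 2.
  rewrite -(ger0_norm (E0 x)); apply: le_trans (cauchy_schwarz _ _) _.
  by rewrite expr2 mulrA; apply: ler_wpM2r.
split; last exact: spectrum_posop Ep El Eu Eup.
have conjR (r : R) : Num.conj r%:C = r%:C :> C.
  by apply/eqP; rewrite eq_complex /= oppr0 !eqxx.
have not_spec l : ((exists M : R, forall x, `|x| <= M%:C * `|E x - l *: x|) ->
    False) -> spectrum E l.
  by move=> h; have [//|/resolvent_bounded_below/h] := pselect (spectrum E l).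
move=> l [] /= ->; apply: not_spec => -[M EM].
  pose Q := opB E (opZ A%:C (@op1 _ H)).
  have QE x : inner (Q x) x = inner (E x) x - A%:C * `|x| ^+ 2.
    by rewrite /= innerBl innerZl inner_normE.
  have Qp : posop Q.
    split=> [x y|x]; last by rewrite QE subr_ge0.
    by rewrite /= innerBl innerBr innerZl innerZr conjR Es.
  have Qu x : inner (Q x) x <= B%:C * `|x| ^+ 2.
    by rewrite QE; apply: le_trans (Eu x); rewrite gerBl mulr_ge0 ?exprn_ge0.
  have [c c0 Qc] := posop_invertible_coercive B0 Qp Qu EM.
  apply: (optA (c ^+ 2)) => [|x]; first by rewrite exprn_gt0.
  have [->|xn0] := eqVneq x 0; first by rewrite normr0 expr0n mulr0 inner0r.
  have xgt : 0 < `|x| by rewrite normr_gt0.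
  have h : (A + c)%:C * `|x| <= `|E x|.
    rewrite -(ler_pM2r xgt) -mulrA -expr2.
    apply: (@le_trans _ _ (inner (E x) x)).
      by rewrite rmorphD /= mulrDl addrC -lerBrDr -QE.
    by rewrite -(ger0_norm (E0 x)); exact: cauchy_schwarz.
  have Ac0 : 0 <= (A + c)%:C :> C by rewrite lecR addr_ge0 // ltW.
  rewrite -ES; apply: (@le_trans _ _ ((A + c)%:C ^+ 2 * `|x| ^+ 2)); last first.
    by rewrite -exprMn ler_pXn2r ?nnegrE ?mulr_ge0.
  apply: ler_wpM2r; rewrite ?exprn_ge0 // -rmorphXn lecR.
  by rewrite sqrrD lerD2r lerDl mulrn_wge0 // mulr_ge0 // ltW.
pose Q := opB (opZ B%:C (@op1 _ H)) E.
have QE x : inner (Q x) x = B%:C * `|x| ^+ 2 - inner (E x) x.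
  by rewrite /= innerBl innerZl inner_normE.
have Qp : posop Q.
  split=> [x y|x]; last by rewrite QE subr_ge0.
  by rewrite /= innerBl innerBr innerZl innerZr conjR Es.
have Qu x : inner (Q x) x <= B%:C * `|x| ^+ 2 by rewrite QE gerBl.
have QM x : `|x| <= M%:C * `|Q x| by rewrite /= distrC.
have [c c0 Qc] := posop_invertible_coercive B0 Qp Qu QM.
have Ec x : inner (E x) x <= (B - c)%:C * `|x| ^+ 2.
  by rewrite rmorphB /= mulrBl lerBrDr addrC -lerBrDr -QE.
have cB : c <= B.
  have xgt : 0 < `|x0| ^+ 2 by rewrite exprn_gt0 // normr_gt0.
  have := le_trans (E0 x0) (Ec x0).
  by rewrite pmulr_lge0 // lecR subr_ge0.
apply: (optB (c * B)) => [|x]; first by rewrite mulr_gt0.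
rewrite -ES; apply: le_trans (posop_bound Ep Ec x) _.
apply: ler_wpM2r; rewrite ?exprn_ge0 // -rmorphXn lecR.
(* since c <= B, the bound (B - c)^2 improves on B^2 by at least c B *)
have -> : (B - c) ^+ 2 = B ^+ 2 - c * B - c * (B - c) by ring.
by rewrite gerBl mulr_ge0 // ?subr_ge0 // ltW.
Qed.

End sqrt_spectrum.

Section equivalence.
Variables (R : realType) (H : hilbertType R).
Local Notation C := R[i].

Lemma frame_operator_selfadj (I : choiceType) (f : I -> H) b x y : bessel f b ->
  inner (frame_operator f x) y = inner x (frame_operator f y).
Proof.
move=> fb; rewrite (inner_frame_operator _ _ fb) [RHS]innerC.
by rewrite (inner_frame_operator _ _ fb) -l2_innerC //; exact: frame_coef_l2 fb.
Qed.

Lemma dilation_translation00 (D T : unitary H) x :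
  dilation_translation D T (0, 0) x = x.
Proof. by []. Qed.

Variables (D T : unitary H) (psi : H) (A B : R).
Local Notation f := (wavelet_system D T psi).
Hypotheses (BS : BS12_rep D T) (f_frame : frame_wavelet D T psi)
  (A0 : 0 < A) (AB : A <= B)
  (optimal : optimal_frame_bounds f (A ^+ 2) (B ^+ 2)).

Let A2 : 0 < A ^+ 2. Proof. by rewrite exprn_gt0. Qed.
Let B0 : 0 < B. Proof. exact: lt_le_trans AB. Qed.
Let AB2 : A ^+ 2 <= B ^+ 2.
Proof. by rewrite ler_pXn2r ?nnegrE // ltW. Qed.

Lemma frame_operator_op : exists S : op H H, [/\ opf S = frame_operator f,
  posop S, forall x y, inner (S x) y = l2_inner (frame_coef f x) (frame_coef f y) &
  forall x, (A ^+ 2)%:C * `|x| ^+ 2 <= inner (S x) x <= (B ^+ 2)%:C * `|x| ^+ 2].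
Proof.
have [fb fAB _ _ _] := optimal_bounds f_frame A2 AB2 optimal.
exists (Op (fun x y => frame_operator_selfadj x y fb)); split => //.
- split=> [x y|x] /=; first exact: frame_operator_selfadj fb.
  by rewrite (inner_frame_operator _ _ fb); apply: l2_inner_ge0; exact: frame_coef_l2 fb.
- by move=> x y /=; rewrite (inner_frame_operator _ _ fb).
- by move=> x /=; rewrite (inner_frame_operator _ _ fb).
Qed.

(** Here inv_op and sqrt_op are computed: the inverse of S exists by
    coercivity, it is positive, and its positive root is unique. *)
Lemma frame_operator_sqrt : exists S P : op H H, [/\ opf S = frame_operator f,
  sqrt_op (inv_op (frame_operator f)) = P, posop P &
  (forall x, S (P (P x)) = x) /\ (forall x, P (P (S x)) = x)].
Proof.
have [S [SE Sp Sip Sb]] := frame_operator_op.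
have A2C : 0 < (A ^+ 2)%:C :> C by rewrite ltcR.
have B2C : 0 <= (B ^+ 2)%:C :> C by rewrite lecR exprn_ge0 // ltW.
have SM x : `|S x| <= (B ^+ 2)%:C * `|x|.
  rewrite -(@ler_pXn2r _ 2) ?nnegrE ?mulr_ge0 // exprMn.
  by apply: posop_bound => // y; case/andP: (Sb y).
have Sc x : (2 * A ^+ 2)%:C * `|x| ^+ 2 <=
    1 * inner (S x) x + Num.conj (1 * inner (S x) x).
  rewrite mul1r geC0_conj; last exact: Sp.2.
  have -> : (2 * A ^+ 2)%:C = 2 * (A ^+ 2)%:C :> C by rewrite mulr_natl rmorphMn mulr_natl.
  rewrite -mulr2n -[leRHS]mulr_natl -mulrA ler_pM2l ?ltr0n //.
  by case/andP: (Sb x).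
have [G [GS SG Gb]] := coercive_inverse A2 SM (normr1 _) Sc.
have Gp : posop G.
  split=> [x y|x].
    by rewrite -{1}(SG y) -Sp.1 SG.
  by rewrite -{2}(SG x) -Sp.1; exact: Sp.2.
have Gm x : inner (G x) x <= ((A ^+ 2)^-1)%:C * `|x| ^+ 2.
  rewrite -(ger0_norm (Gp.2 x)); apply: le_trans (cauchy_schwarz _ _) _.
  by rewrite expr2 mulrA; apply: ler_wpM2r.
have m0 : 0 < (A ^+ 2)^-1 by rewrite invr_gt0.
have [P [Pp PP PM _]] := positive_sqrt m0 Gp Gm.
exists S, P; split => //; last by split=> x; rewrite PP.
have SGinv : inverse_operator (frame_operator f) G.
  split; [|by move=> x; rewrite -SE|by move=> x; rewrite -SE].
  by split; [exact: op_linear | exists ((A ^+ 2)^-1)%:C].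
by rewrite (inv_opE SGinv) (sqrt_opE m0 Gp Gm Pp PM PP).
Qed.

Lemma dilation_of_commutant :
  local_commutant (range (dilation_translation D T)) psi
    (sqrt_op (inv_op (frame_operator f))) ->
  exists (K : hilbertType R) (D' T' : unitary K) (psi1 : H) (psi2 : K) (E : H -> H),
    [/\ BS12_rep D' T',
        orthonormal_wavelet (udsum D D') (udsum T T') (hdpair psi1 psi2),
        positive_operator E,
        [set A%:C; B%:C] `<=` spectrum E /\
          spectrum E `<=` [set a%:C | a in `[A, B]] &
        forall j k : int,
          E (dilation_translation D T (j, k) psi1) =
          dilation_translation D T (j, k) psi].
Proof.
have [S [P [SE -> Pp [SPP PPS]]]] := frame_operator_sqrt.
have [S' [S'E Sp Sip Sb]] := frame_operator_op.
have SS' x : S' x = S x by rewrite -[S' x]/(opf S' x) S'E -SE.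
have [fb fAB Hn optA optB] := optimal_bounds f_frame A2 AB2 optimal.
move=> [_ Pcomm].
(* S^(1/2) = S S^(-1/2) *)
pose E := opM S P.
have EP x : E (P x) = x by exact: SPP.
have PE x : P (E x) = x.
  by rewrite -{1}(PPS x) EP PPS.
have Ep : posop E.
  split=> [x y|x].
    by rewrite -{1}(PE y) -Pp.1 PE.
  by rewrite -{2}(PE x) -Pp.1; exact: Pp.2.
have EE x : E (E x) = S' x by rewrite SS' -[RHS](congr1 S (PE x)).
have g_sys i : wavelet_system D T (P psi) i = P (f i).
  by rewrite /wavelet_system Pcomm //; exists i.
have g_coef x : frame_coef (wavelet_system D T (P psi)) x = frame_coef f (P x).
  by apply/funext => i; rewrite /frame_coef g_sys Pp.1.
have gP : parseval (wavelet_system D T (P psi)).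
  split=> [x|x y]; rewrite !g_coef; first exact: frame_coef_l2 fb.
  by rewrite -Sip SS' -Pp.1 [P _](PE x).
have [K [D' [T' [psi2 [BS' onw]]]]] := parseval_dilation BS gP.
exists K, D', T', (P psi), psi2, (opf E); split => //.
- apply: (@positive_operatorP _ _ _ B%:C) => // x.
  have B0C : 0 <= B%:C :> C by rewrite lecR ltW.
  rewrite -(@ler_pXn2r _ 2) ?nnegrE ?mulr_ge0 // exprMn -inner_normE -Ep.1 EE -rmorphXn.
  by case/andP: (Sb x).
- apply: (sqrt_spectrum A0 AB Ep EE EP Sb Hn).
    by move=> c c0 h; apply: (optA c c0) => x; rewrite -Sip.
  by move=> c c0 h; apply: (optB c c0) => x; rewrite -Sip.
- by move=> j k; rewrite -Pcomm ?EP //; exists (j, k).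
Qed.

Lemma commutant_of_dilation :
  (exists (K : hilbertType R) (D' T' : unitary K) (psi1 : H) (psi2 : K) (E : H -> H),
    [/\ BS12_rep D' T',
        orthonormal_wavelet (udsum D D') (udsum T T') (hdpair psi1 psi2),
        positive_operator E,
        [set A%:C; B%:C] `<=` spectrum E /\
          spectrum E `<=` [set a%:C | a in `[A, B]] &
        forall j k : int,
          E (dilation_translation D T (j, k) psi1) =
          dilation_translation D T (j, k) psi]) ->
  local_commutant (range (dilation_translation D T)) psi
    (sqrt_op (inv_op (frame_operator f))).
Proof.
move=> [K [D' [T' [psi1 [psi2 [E0 [_ onw /positive_operator_op[E [<- Ep]] [_ spE] Epsi]]]]]]].
have Eg i : E (wavelet_system D T psi1 i) = f i by case: i => j k; exact: Epsi.
have [on_gram on_cvg] := onw.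
set w := wavelet_system (udsum D D') _ _ in on_gram on_cvg.
have wE i : (w i).1 = wavelet_system D T psi1 i.
  by rewrite /w /wavelet_system /dilation_translation !udsum_expgz.
have wb := orthonormal_bessel on_gram.
have w_coef x : frame_coef w (hdpair x 0) = frame_coef (wavelet_system D T psi1) x.
  by apply/funext => i; rewrite /frame_coef hdsum_innerE /= inner0l addr0 wE.
have g2 x : l2 (frame_coef (wavelet_system D T psi1) x) by rewrite -w_coef; exact: frame_coef_l2 wb.
have g_parseval x y : l2_inner (frame_coef (wavelet_system D T psi1) x)
    (frame_coef (wavelet_system D T psi1) y) = inner x y.
  have e : frame_operator w (hdpair x 0) = hdpair x 0.
    exact: (normed_cvg_unique (frame_operator_cvg wb) (on_cvg _)).
  by rewrite -!w_coef -(inner_frame_operator _ _ wb) e hdsum_innerE /= inner0l addr0.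
have [S [SE Sp Sip Sb]] := frame_operator_op.
have f_coef x : frame_coef f x = frame_coef (wavelet_system D T psi1) (E x).
  by apply/funext => i; rewrite /frame_coef -Eg Ep.1.
have EE x : E (E x) = S x.
  by apply: inner_inj => y; rewrite Sip !f_coef g_parseval Ep.1.
(* 0 is not in the spectrum, as 0 < A *)
have [P0 P0inv] : exists P : H -> H, inverse_operator (fun x => E x - 0 *: x) P.
  apply: contrapT => n0; have /spE [a] : spectrum E 0 by [].
  rewrite /= in_itv /= => /andP[Aa _] /eqP; rewrite eq_complex /= => /andP[/eqP a0 _].
  by move: (lt_le_trans A0 Aa); rewrite a0 ltxx.
have [[P0lin [M PM]] P0E EP0] := P0inv.
have PE x : P0 (E x) = x by rewrite -[RHS]P0E scale0r subr0.
have EP x : E (P0 x) = x by have := EP0 x; rewrite scale0r subr0.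
have Ps x y : inner (P0 x) y = inner x (P0 y).
  by rewrite -{1}(EP y) -Ep.1 EP.
pose P : op H H := Op Ps.
have Pp : posop P.
  split=> // x; change (0 <= inner (P0 x) x).
  by rewrite -{2}(EP x) -Ep.1; exact: Ep.2.
pose G := opM P P.
have Gp : posop G.
  by split=> [x y|x]; rewrite /= !Ps // -Ps inner_ge0.
have MM (x : H) : 0 <= M * `|x| by exact: le_trans (normr_ge0 (P0 x)) (PM x).
have [m mE] : exists m : R, `|M| = m%:C by eexists; exact: (complex_ge0P (normr_ge0 _)).1.
have Pm x : `|P x| <= m%:C * `|x|.
  by apply: le_trans (PM x) _; rewrite -mE -(ger0_norm (MM x)) normrM normr_id.
have SGinv : inverse_operator (frame_operator f) G.
  rewrite -SE; split=> [|x|x]; last 2 first.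
  - by rewrite -EE; change (P0 (P0 (E (E x))) = x); rewrite !PE.
  - by rewrite -EE; change (E (E (P0 (P0 x))) = x); rewrite !EP.
  split; first exact: op_linear.
  exists (`|M| * `|M|) => x; rewrite mE; apply: le_trans (Pm _) _.
  by rewrite -mulrA; apply: ler_wpM2l; rewrite ?Pm // -mE.
have Gm x : inner (G x) x <= (m ^+ 2 + 1)%:C * `|x| ^+ 2.
  rewrite /= Ps inner_normE rmorphD mulrDl rmorphXn /= -exprMn.
  rewrite ler_wpDr ?mul1r ?exprn_ge0 // ler_pXn2r ?nnegrE //.
  exact: le_trans (normr_ge0 (P x)) (Pm x).
have m0 : 0 < m ^+ 2 + 1 by rewrite ltr_wpDl // sqr_ge0.
rewrite (inv_opE SGinv) (sqrt_opE m0 Gp Gm Pp Pm) //.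
split; first by split; [exact: op_linear | exists M].
have psiE : psi = E psi1 by have := Epsi 0 0; rewrite !dilation_translation00.
have Ppsi : P psi = psi1 by rewrite psiE; exact: PE.
move=> _ [jk _ <-]; rewrite Ppsi -[dilation_translation D T jk psi](Eg jk).
exact: PE.
Qed.

End equivalence.

Theorem theorem4p1 (R : realType) (H : hilbertType R) (D T : unitary H)
    (psi : H) (A B : R) :
  BS12_rep D T ->
  frame_wavelet D T psi ->
  0 < A -> A <= B ->
  optimal_frame_bounds (wavelet_system D T psi) (A ^+ 2) (B ^+ 2) ->
  let S := frame_operator (wavelet_system D T psi) in
  local_commutant (range (dilation_translation D T)) psi (sqrt_op (inv_op S))
  <->
  exists (K : hilbertType R) (D' T' : unitary K)
         (psi1 : H) (psi2 : K) (E : H -> H),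
    [/\ BS12_rep D' T',
        orthonormal_wavelet (udsum D D') (udsum T T') (hdpair psi1 psi2),
        positive_operator E,
        [set A%:C; B%:C] `<=` spectrum E /\
          spectrum E `<=` [set a%:C | a in `[A, B]] &
        forall j k : int,
          E (dilation_translation D T (j, k) psi1) =
          dilation_translation D T (j, k) psi].
Proof.
move=> BS f_frame A0 AB optimal S; split.
  exact: dilation_of_commutant.
exact: commutant_of_dilation.
Qed.
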